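(* If $d>2$ is an integer and $m\in\{6,7,8,9,10\}$, then no $m$-stiff configuration exists in $S^{d-1}$.
   Context: $S^{d-1}$ is the unit sphere in $\mathbb{R}^d$ with standard inner product $\langle\cdot,\cdot\rangle$. A spherical $t$-design is a finite (nonempty) subset $X\subset S^{d-1}$ such that $\frac{1}{|X|}\sum_{x\in X} f(x)=\frac{1}{|S^{d-1}|}\int_{S^{d-1}} f(x)\,dx$ for every polynomial $f$ in $d$ variables of degree at most $t$, where $|S^{d-1}|$ is the surface volume of $S^{d-1}$. For positive integers $m,d$, a finite subset $X\subset S^{d-1}$ is called an $m$-stiff configuration if it is a spherical $(2m-1)$-design and there exists $z\in S^{d-1}$ such that the set $D(z,X)=\{\langle z,x\rangle : x\in X\}$ has at most $m$ elements. *)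

(* Defs.v *)
From mathcomp Require Import all_boot all_order all_algebra.
From mathcomp Require Import finmap.
From mathcomp Require Import all_classical all_reals all_analysis.
From mathcomp Require Import -(notations) mpoly.

Set Implicit Arguments.
Unset Strict Implicit.
Unset Printing Implicit Defensive.

Import Order.TTheory GRing.Theory Num.Theory.
Import numFieldNormedType.Exports.

Local Open Scope fset_scope.
Local Open Scope classical_set_scope.
Local Open Scope ring_scope.

Definition dot (R : realType) (d : nat) (u v : 'rV[R]_d) : R :=
  \sum_(i < d) u ord0 i * v ord0 i.

(* [unit_sphere d] is S^(d-1). The library's norm on 'rV[R]_d is the sup norm,
   hence the inner product here. *)
Definition unit_sphere (R : realType) (d : nat) : set 'rV[R]_d :=
  [set x | dot x x = 1].

(* The surface integral of f over S^(d-1), unnormalised, in spherical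
   coordinates: for k >= 1, S^k is parametrised by
     (theta, y) |-> (cos theta, sin theta * y),
   theta in [0, pi], y in S^(k-1), whose area element is
     sin(theta)^(k-1) dtheta dsigma_(k-1)(y).
   On S^0 = {-1, 1} the surface measure is the counting measure, and
   S^(-1) is empty. *)
Fixpoint sphere_integral (R : realType) (d : nat) :
    ('rV[R]_d -> R) -> R :=
  match d return ('rV[R]_d -> R) -> R with
  | 0%N => fun _ => 0
  | d'.+1 =>
    match d' return (('rV[R]_d' -> R) -> R) -> ('rV[R]_d'.+1 -> R) -> R with
    | 0%N => fun _ f => f (const_mx 1) + f (const_mx (- 1))
    | k.+1 => fun sphere_integral_pred f =>
        \int[lebesgue_measure]_(theta in `[0, pi])
          (sin theta ^+ k *
           sphere_integral_pred (fun y : 'rV[R]_k.+1 =>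
             f (row_mx (const_mx (cos theta) : 'rV[R]_1) (sin theta *: y))))
    end (@sphere_integral R d')
  end.

Definition sphere_area (R : realType) (d : nat) : R :=
  @sphere_integral R d (fun _ => 1).

(* [mpoly.msize f] is 1 + the total degree of f, and 0 for f = 0. *)
Definition spherical_design (R : realType) (d t : nat)
    (X : {fset 'rV[R]_d}) : Prop :=
  [/\ X != fset0,
      (forall x, x \in X -> unit_sphere x) &
      forall f : mpoly.mpoly d R, (mpoly.msize f <= t.+1)%N ->
        #|` X|%:R^-1 * \sum_(x <- X) mpoly.meval (x ord0) f =
        (sphere_area R d)^-1 *
          sphere_integral (fun x : 'rV[R]_d => mpoly.meval (x ord0) f)].

Definition inner_products (R : realType) (d : nat) (z : 'rV[R]_d)
    (X : {fset 'rV[R]_d}) : {fset R} :=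
  [fset dot z x | x in X].

Definition stiff_configuration (R : realType) (d m : nat)
    (X : {fset 'rV[R]_d}) : Prop :=
  spherical_design (2 * m - 1) X /\
  exists2 z : 'rV[R]_d, unit_sphere z & (#|` inner_products z X| <= m)%N.

(* Main.v *)
Require Import Defs.
From mathcomp Require Import all_boot all_order all_algebra.
From mathcomp Require Import finmap.
From mathcomp Require Import all_classical all_reals all_analysis.
From mathcomp Require Import polyrcf.
From mathcomp Require Import ring lra zify.
From mathcomp Require Import -(notations) mpoly.

(** The design property determines the moments of <z,x>, so the values <z,x> are the nodes of a
    quadrature rule for the Gegenbauer weight, exact in degree 2m-1 and with positive rational weights:
    there are exactly m nodes and they are the zeros of the Gegenbauer polynomial P, which has rational
    coefficients. The weight at the node t is K / ((1 - t^2) P'(t)^2) with K rational. For d > 2 the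
    function n (n+a) P^2 + (1 - x^2) P'^2 (Sonin) is strictly increasing in |x|, so nodes of different
    absolute value have different weights; being determined over Q by its weight, t^2 is rational.
    Hence the polynomial of degree m./2 whose roots are the 1/t^2 would split over Q. It does not:
    for m = 6, 7 its discriminant being a square leads to p^2 + 3 r^2 = q^3, which is handled by
    Euler's lemma; for m = 8, 9 one combines 2-adic valuations of the roots with the discriminant;
    for m = 10 one uses 3-adic valuations. *)

Set Implicit Arguments.
Unset Strict Implicit.
Unset Printing Implicit Defensive.

Import Order.TTheory GRing.Theory Num.Theory.
Import numFieldNormedType.Exports.

Local Open Scope classical_set_scope.
Local Open Scope ring_scope.

(** * Moments of linear forms on the sphere *)

(** The only arithmetic trace of [X] is that the weight of a node t is the proportion of points x
    with <z,x> = t; afterwards only the parameter [a] = d - 2 matters. For d = 2 the function of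
    Sonin is constant and all weights agree, as they must: regular 2m-gons are m-stiff. The
    reciprocals 1/t^2 are preferred to t^2 because the coefficients of P, divided by the lowest one,
    are polynomials in [a] with constant denominators. So a fixed multiple of every 1/t^2 is an
    algebraic integer whatever d is, rational roots become integers, and congruences apply uniformly
    in d. Once the second coefficient is removed, the polynomial depends on d only through the odd
    integer M = 2 d + 2 m - 5. The obstacle is that it splits, with multiple roots, at some values
    of M outside the range of d, for instance as (w + 1)^3 (w - 3) for m = 8 and M = 5. A congruence
    condition on M alone would exclude these as well, so the distinctness of the roots or the
    distance of M to such a value has to enter. *)

Definition trig_moment (R : realType) (a b : nat) : R :=
  \int[lebesgue_measure]_(x in `[0, pi]) (cos x ^+ a * sin x ^+ b).

Lemma continuous_integrable_0pi (R : realType) (f : R -> R) : continuous f ->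
  lebesgue_measure.-integrable `[0, pi] (EFin \o f).
Proof.
move=> cf; apply: continuous_compact_integrable; first exact: segment_compact.
exact: continuous_subspaceT.
Qed.

Lemma continuous_trig (R : realType) (a b : nat) :
  continuous (fun x : R => cos x ^+ a * sin x ^+ b).
Proof.
move=> x; apply: cvgM.
  exact: (continuous_comp (@continuous_cos R x) (@exprn_continuous R a _)).
exact: (continuous_comp (@continuous_sin R x) (@exprn_continuous R b _)).
Qed.

Lemma Rintegral_derive_0pi (R : realType) (F f : R -> R) :
  (forall x : R, is_derive x 1 F (f x)) -> continuous f ->
  \int[lebesgue_measure]_(x in `[0, pi]) f x = F pi - F 0.
Proof.
move=> dF cf; rewrite /Rintegral.
have cF : continuous F.
  by move=> x; apply: differentiable_continuous; apply/derivable1_diffP; case: (dF x).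
rewrite (@continuous_FTC2 R f F 0 pi) //.
- exact: pi_gt0.
- exact: continuous_subspaceT.
- split.
  + by move=> x _; case: (dF x).
  + exact/cvg_at_right_filter/cF.
  + exact/cvg_at_left_filter/cF.
- by move=> x _; rewrite derive1E; case: (dF x).
Qed.

(** The function cos^a sin^(b+1) vanishes at 0 and pi, so its derivative has integral zero. At a = 0
    the factor [a%:R] kills the term with the truncated exponent [a.-1], and what remains is the
    vanishing of [trig_moment R 1 b], the start of the induction for odd exponents. *)
Lemma trig_moment_ibp (R : realType) (a b : nat) :
  a%:R * trig_moment R a.-1 b.+2 = b.+1%:R * trig_moment R a.+1 b.
Proof.
pose f (x : R) := b.+1%:R * (cos x ^+ a.+1 * sin x ^+ b)
                    - a%:R * (cos x ^+ a.-1 * sin x ^+ b.+2).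
have cf c n k : continuous (fun x : R => c * (cos x ^+ n * sin x ^+ k)).
  by move=> x; apply: cvgM; [exact: cvg_cst|exact: continuous_trig].
have dF (x : R) : is_derive x 1 (fun x => cos x ^+ a * sin x ^+ b.+1) (f x).
  have -> : (fun x => cos x ^+ a * sin x ^+ b.+1) = (@cos R ^+ a) * (@sin R ^+ b.+1).
    by apply/funext => y; rewrite fctE !exprfctE.
  apply: (is_derive_eq (is_deriveM (is_deriveX a (is_derive_cos x)) (is_deriveX b.+1 (is_derive_sin x)))).
  rewrite /f /GRing.scale /= !exprfctE.
  case: (a) => [|n] /=; rewrite ?expr0 ?exprS; ring.
have cF : continuous f by move=> x; apply: cvgB; exact: cf.
have H := Rintegral_derive_0pi dF cF.
rewrite sinpi sin0 !expr0n /= !mulr0 subrr in H.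
move: H; rewrite /f RintegralB //; try exact/continuous_integrable_0pi/cf.
rewrite !RintegralZl //; try exact/continuous_integrable_0pi/continuous_trig.
by move/eqP; rewrite subr_eq0 => /eqP <-.
Qed.

Lemma trig_moment_step (R : realType) (a b : nat) :
  trig_moment R a b = trig_moment R a.+2 b + trig_moment R a b.+2.
Proof.
rewrite /trig_moment -RintegralD //; try exact/continuous_integrable_0pi/continuous_trig.
apply: eq_Rintegral => x _.
rewrite -[LHS]mulr1 -(cos2Dsin2 x) !exprS; ring.
Qed.

Lemma trig_moment_odd (R : realType) (a b : nat) : odd a -> trig_moment R a b = 0.
Proof.
have [n] := ubnP a; elim: n a b => // n IH [|[|a]] b //= han oa.
  have := trig_moment_ibp R 0 b; rewrite mul0r => /esym /eqP.
  by rewrite mulf_eq0 pnatr_eq0 => /eqP.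
have := trig_moment_ibp R a.+1 b; rewrite IH ?mulr0; last 2 first.
- by rewrite -ltnS ltnW.
- by move: oa; rewrite negbK.
by move/esym/eqP; rewrite mulf_eq0 pnatr_eq0 => /eqP.
Qed.

Lemma trig_moment_recl (R : realType) (a b : nat) :
  (a + b).+2%:R * trig_moment R a.+2 b = a.+1%:R * trig_moment R a b.
Proof.
rewrite (trig_moment_step _ a) mulrDr (trig_moment_ibp R a.+1) -mulrDl -natrD.
by rewrite addSn addnS.
Qed.

(* c j is the integral over the sphere of the 2j-th power of a unit linear form. *)
Definition dot_moment (R : realType) (d : nat) (c : nat -> R) (z : 'rV[R]_d) (k : nat) : R :=
  if odd k then 0 else c k./2 * dot z z ^+ k./2.

Lemma dot_row_mx (R : realType) (n : nat) (z : 'rV[R]_(1 + n)) (a : R) (y : 'rV[R]_n) :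
  dot z (row_mx (const_mx a : 'rV_1) y) = z ord0 ord0 * a + dot (rsubmx z) y.
Proof.
rewrite /dot big_split_ord /= big_ord_recl big_ord0 addr0.
congr (_ + _).
  rewrite row_mxEl !mxE; congr (z _ _ * _); exact/val_inj.
by apply: eq_bigr => i _; rewrite row_mxEr !mxE.
Qed.

Lemma dot_rsubmx (R : realType) (n : nat) (z : 'rV[R]_(1 + n)) :
  dot z z = z ord0 ord0 ^+ 2 + dot (rsubmx z) (rsubmx z).
Proof.
rewrite -{2}(hsubmxK z) -[lsubmx z](_ : const_mx (z ord0 ord0) = _).
  by rewrite dot_row_mx expr2.
by apply/rowP => i; rewrite !mxE; congr (z _ _); apply/val_inj; rewrite /= (ord1 i).
Qed.

Lemma dotZr (R : realType) (n : nat) (z y : 'rV[R]_n) (a : R) : dot z (a *: y) = a * dot z y.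
Proof. by rewrite /dot mulr_sumr; apply: eq_bigr => i _; rewrite mxE mulrCA. Qed.

Lemma Rintegral_sum_trig (R : realType) (I : Type) (s : seq I) (u : I -> R) (a b : I -> nat) :
  \int[lebesgue_measure]_(x in `[0, pi]) (\sum_(i <- s) u i * (cos x ^+ a i * sin x ^+ b i))
  = \sum_(i <- s) u i * trig_moment R (a i) (b i).
Proof.
have cs (t : seq I) : continuous (fun x : R => \sum_(i <- t) u i * (cos x ^+ a i * sin x ^+ b i)).
  elim: t => [|i t IH].
    rewrite (_ : (fun _ => _) = fun=> 0); first by move=> x; exact: cvg_cst.
    by apply/funext => x; rewrite big_nil.
  rewrite (_ : (fun _ => _) = fun x : R => u i * (cos x ^+ a i * sin x ^+ b i)
    + \sum_(k <- t) u k * (cos x ^+ a k * sin x ^+ b k)); last first.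
    by apply/funext => x; rewrite big_cons.
  move=> x; apply: cvgD; last exact: IH.
  by apply: cvgM; [exact: cvg_cst|exact: continuous_trig].
elim: s => [|i s IH].
  by rewrite big_nil; under eq_Rintegral do rewrite big_nil; rewrite Rintegral_cst // mul0r.
rewrite big_cons; under eq_Rintegral do rewrite big_cons.
rewrite RintegralD //; last 2 first.
- apply/continuous_integrable_0pi => x; apply: cvgM; [exact: cvg_cst|exact: continuous_trig].
- exact/continuous_integrable_0pi/cs.
by rewrite IH RintegralZl //; exact/continuous_integrable_0pi/continuous_trig.
Qed.

Lemma sum_even (R : nmodType) (F : nat -> R) (j : nat) : (forall l, odd l -> F l = 0) ->
  \sum_(0 <= l < j.*2.+1) F l = \sum_(0 <= l < j.+1) F l.*2.
Proof.
move=> F0; elim: j => [|j IH]; first by rewrite !big_nat1.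
by rewrite doubleS big_nat_recr // big_nat_recr //= IH F0 ?addr0 -?doubleS -?big_nat_recr //= odd_double.
Qed.

(** Rotation invariance in disguise: in the expansion of (z0 cos theta + sin theta <z',y>)^(2 j),
    the integrated terms of even index are ['C(j, l)] times a quantity free of l, so they add up to
    a power of z0^2 + |z'|^2. The induction on l compares consecutive binomial coefficients,
    consecutive values of [c] and, by [trig_moment_ibp], consecutive moments. *)
Lemma trig_moment_bin (R : realType) (n : nat) (c : nat -> R) (j l : nat) :
  (forall i, (n.+1 + i.*2)%:R * c i.+1 = (i.*2.+1)%:R * c i) -> (l <= j)%N ->
  'C(j.*2, l.*2)%:R * c l * trig_moment R (j.*2 - l.*2) (l.*2 + n)
  = 'C(j, l)%:R * (c 0%N * trig_moment R j.*2 n).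
Proof.
move=> rc; elim: l => [_|l IH lj]; first by rewrite !bin0 !mul1r double0 subn0.
have [p jE] : exists p, j = (l + p).+1 by exists (j - l.+1)%N; lia.
have {IH} := IH (ltnW lj); set Y := _ * trig_moment R j.*2 n => IH.
have b1 := mul_bin_left j.*2 l.*2; have b2 := mul_bin_left j.*2 l.*2.+1.
have b3 := mul_bin_left j l.
have ib := trig_moment_ibp R p.*2.+1 (l.*2 + n).
have r := rc l.
have e1 : (j.*2 - l.*2 = p.*2.+2)%N by lia.
have e2 : (j.*2 - l.*2.+1 = p.*2.+1)%N by lia.
have e3 : (j - l = p.+1)%N by lia.
have e4 : (j.*2 - l.+1.*2 = p.*2)%N by lia.
rewrite e1 in b1; rewrite e2 in b2; rewrite e3 in b3.
rewrite e1 in IH; rewrite e4 doubleS !addSn; rewrite /= in ib.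
move/(congr1 (fun i => i%:R : R)): b1; move/(congr1 (fun i => i%:R : R)): b2; move/(congr1 (fun i => i%:R : R)): b3.
rewrite !natrM => b3 b2 b1.
have ne (i : nat) : i.+1%:R != 0 :> R by rewrite pnatr_eq0.
(* These five factors are the denominators of the ratios; multiplying by them first lets the
   recurrences be chained without division. *)
apply: (mulfI (ne l)); apply: (mulfI (ne l.*2.+1)); apply: (mulfI (ne l.*2)).
apply: (mulfI (ne (n + l.*2)%N)); apply: (mulfI (ne p.*2)).
set A := 'C(_, l.*2.+2)%:R in b2 *; set B := 'C(_, l.*2.+1)%:R in b1 b2.
set C := 'C(_, l.*2)%:R in b1 IH; set D := 'C(_, l.+1)%:R in b3 *; set E := 'C(_, l)%:R in b3 IH.
set W0 := trig_moment R p.*2.+2 _ in ib IH; set W1 := trig_moment R p.*2 _ in ib *.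
rewrite [in LHS]addSn in r.
set V := c l.+1 in r *; set U := c l in r IH.
transitivity ((l.+1%:R * ((n + l.*2).+1%:R * V)) * (l.*2.+2%:R * A) * l.*2.+1%:R * (p.*2.+1%:R * W1)); first by ring.
rewrite r b2 ib.
transitivity ((l.+1%:R * (l.*2.+1%:R * U)) * p.*2.+1%:R * (l.*2.+1%:R * B) * ((l.*2 + n).+1%:R * W0)); first by ring.
rewrite b1.
transitivity (l.+1%:R * l.*2.+1%:R * p.*2.+1%:R * p.*2.+2%:R * (l.*2 + n).+1%:R * (C * U * W0)); first by ring.
rewrite IH.
transitivity (l.*2.+2%:R * l.*2.+1%:R * (n + l.*2).+1%:R * p.*2.+1%:R * (l.+1%:R * D) * Y); last by ring.
rewrite b3 (addnC n).
have -> : p.*2.+2%:R = 2%:R * p.+1%:R :> R by rewrite -natrM; congr _%:R; lia.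
have -> : l.*2.+2%:R = 2%:R * l.+1%:R :> R by rewrite -natrM; congr _%:R; lia.
ring.
Qed.

Lemma dot_moment_step (R : realType) (n : nat) (c : nat -> R) (z : 'rV[R]_(1 + n.+1)) (k : nat) :
  (forall i, (n.+1 + i.*2)%:R * c i.+1 = (i.*2.+1)%:R * c i) ->
  \sum_(0 <= l < k.+1) 'C(k, l)%:R * z ord0 ord0 ^+ (k - l)
     * dot_moment c (rsubmx z) l * trig_moment R (k - l) (l + n)
  = dot_moment (fun j => c 0%N * trig_moment R j.*2 n) z k.
Proof.
move=> rc; rewrite {2}/dot_moment; case: ifPn => [ok|ek].
  rewrite big_nat big1 // => l /andP[_ lk]; rewrite /dot_moment.
  case: ifPn => [_|el]; first by rewrite mulr0 mul0r.
  by rewrite trig_moment_odd ?mulr0 // oddB // ok (negPf el).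
have -> : k = (k./2).*2 by rewrite -[LHS]odd_double_half (negPf ek).
move: (k./2) => j {k ek}; rewrite doubleK sum_even; last first.
  by move=> l ol; rewrite /dot_moment ol mulr0 mul0r.
rewrite (dot_rsubmx z) exprDn mulr_sumr big_mkord; apply: eq_bigr => -[l lj] _ /=.
rewrite /dot_moment odd_double doubleK.
transitivity ('C(j.*2, l.*2)%:R * c l * trig_moment R (j.*2 - l.*2) (l.*2 + n) *
  z ord0 ord0 ^+ (j.*2 - l.*2) * dot (rsubmx z) (rsubmx z) ^+ l); first by ring.
rewrite trig_moment_bin // -doubleB -[(j - l).*2]mul2n exprM -mulr_natl; ring.
Qed.

(** The statement is about finite sums of powers because expanding <z, (cos theta, sin theta y)>^k
    by the binomial formula puts such a sum under the inner integral; this form carries the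
    linearity used by the induction. The recurrence for [c] is what lets the binomial terms
    recombine in the next dimension. *)
Lemma sphere_integral_dot (R : realType) (n : nat) :
  exists2 c : nat -> R,
    forall i, (n.+1 + i.*2)%:R * c i.+1 = (i.*2.+1)%:R * c i &
    forall (z : 'rV[R]_n.+1) (I : Type) (s : seq I) (a : I -> R) (k : I -> nat),
      sphere_integral (fun x => \sum_(i <- s) a i * dot z x ^+ k i) =
      \sum_(i <- s) a i * dot_moment c z (k i).
Proof.
elim: n => [|n [c rc IH]].
  exists (fun=> 2) => [i|z I s a k]; first by rewrite add1n.
  rewrite /= -big_split /=; apply: eq_bigr => i _; rewrite -mulrDr; congr (_ * _).
  rewrite /dot_moment /dot !big_ord_recl !big_ord0 !addr0 !mxE mulr1 mulrN1 exprNn.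
  rewrite -[in LHS](odd_double_half (k i)) -signr_odd oddD odd_double addbF oddb.
  case: (odd _); first by rewrite mulN1r subrr.
  by rewrite mul1r add0n -mul2n exprM -expr2; ring.
exists (fun j => c 0%N * trig_moment R j.*2 n) => [i|z I s a k].
  have := trig_moment_recl R i.*2 n; rewrite -doubleS => /(congr1 (fun x => c 0%N * x)).
  by rewrite mulrCA [in RHS]mulrCA => <-; congr (_%:R * _); lia.
under [RHS]eq_bigr do rewrite -(dot_moment_step z _ rc).
pose t : seq (I * nat) := [seq (i, l) | i <- s, l <- index_iota 0 (k i).+1].
pose u (p : I * nat) := a p.1 * ('C(k p.1, p.2)%:R * z ord0 ord0 ^+ (k p.1 - p.2)
   * dot_moment c (rsubmx (z : 'rV_(1 + n.+1))) p.2).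
transitivity (\int[lebesgue_measure]_(x in `[0, pi])
   \sum_(p <- t) u p * (cos x ^+ (k p.1 - p.2) * sin x ^+ (p.2 + n))); last first.
  rewrite Rintegral_sum_trig big_allpairs_dep; apply: eq_bigr => i _.
  by rewrite mulr_sumr; apply: eq_bigr => l _; rewrite /u /= !mulrA.
apply: eq_Rintegral => x _.
transitivity (sin x ^+ n * sphere_integral (fun y : 'rV[R]_n.+1 =>
  \sum_(p <- t) (a p.1 * 'C(k p.1, p.2)%:R * (z ord0 ord0 * cos x) ^+ (k p.1 - p.2) * sin x ^+ p.2)
     * dot (rsubmx (z : 'rV_(1 + n.+1))) y ^+ p.2)).
  congr (_ * sphere_integral _); apply/funext => y.
  rewrite big_allpairs_dep; apply: eq_bigr => i _.
  rewrite dot_row_mx dotZr exprDn mulr_sumr big_mkord; apply: eq_bigr => l _ /=.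
  by rewrite [(sin x * _) ^+ _]exprMn -mulr_natl; ring.
rewrite IH mulr_sumr; apply: eq_bigr => p _; rewrite /u exprMn exprD; ring.
Qed.

Lemma stiff_moments (R : realType) (d t : nat) (X : {fset 'rV[R]_d}) (z : 'rV[R]_d) :
  (0 < d)%N -> spherical_design t X -> dot z z = 1 ->
  exists2 mu : nat -> R,
    [/\ mu 0%N = 1, mu 1%N = 0 & forall k, (d + k)%:R * mu k.+2 = (k.+1)%:R * mu k] &
    forall k, (k <= t)%N -> #|` X|%:R^-1 * \sum_(x <- X) dot z x ^+ k = mu k.
Proof.
case: d X z => // n X z _ [X0 _ hX] zz.
have [c rc hc] := sphere_integral_dot R n.
have key k : (k <= t)%N -> #|` X|%:R^-1 * \sum_(x <- X) dot z x ^+ k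
    = (sphere_area R n.+1)^-1 * dot_moment c z k.
  move=> kt; pose l : mpoly.mpoly n.+1 R := \sum_(i < n.+1) z ord0 i *: mpoly.mpolyX R (mpoly.mnm1 i).
  have lE (x : 'rV_n.+1) : mpoly.meval (x ord0) (l ^+ k) = dot z x ^+ k.
    rewrite rmorphXn /= /l rmorph_sum /=; congr (_ ^+ _); apply: eq_bigr => i _.
    by rewrite mpoly.mevalZ mpoly.mevalXU.
  have lk : (mpoly.msize (l ^+ k) <= t.+1)%N.
    have l2 : (mpoly.msize l <= 2)%N.
      rewrite /l; apply: (leq_trans (mpoly.mmeasure_sum _ _ _ _)).
      apply/bigmax_leqP => i _; apply: (leq_trans (mpoly.msizeZ_le _ _)).
      by rewrite mpoly.msizeX mpoly.mdeg1.
    apply: (@leq_trans k.+1) => //; elim: (k) => [|j IH]; first by rewrite expr0 mpoly.msize1.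
    have [l0|l0] := eqVneq l 0; first by rewrite l0 expr0n /= mpoly.msize0.
    have h (a b e : nat) : (a <= 2 -> b <= e -> (a + b).-1 <= e.+1)%N by lia.
    by rewrite exprS mpoly.msizeM ?expf_neq0 //; exact: h.
  have := hX (l ^+ k) lk.
  under eq_bigr do rewrite lE; move=> ->; congr (_ * _).
  have := hc z unit [:: tt] (fun=> 1) (fun=> k); rewrite big_seq1 mul1r => <-.
  by congr sphere_integral; apply/funext => x; rewrite big_seq1 mul1r lE.
(* The design identity for f = 1 says this, and with it that the area is nonzero. *)
have area : (sphere_area R n.+1)^-1 * c 0%N = 1.
  have := key 0%N (leq0n _); rewrite /dot_moment /= expr0 mulr1 => <-.
  under eq_bigr do rewrite expr0.
  rewrite big_const_seq iter_addr_0 count_predT mulVf // pnatr_eq0.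
  by rewrite -lt0n cardfs_gt0.
exists (fun k => (sphere_area R n.+1)^-1 * dot_moment c z k) => //; split.
- by rewrite /dot_moment /= expr0 mulr1.
- by rewrite /dot_moment /= mulr0.
move=> k; rewrite /dot_moment /= negbK; case: ifPn => [|ek]; first by rewrite !mulr0.
have kE : k = (k./2).*2 by rewrite -[LHS]odd_double_half (negPf ek).
rewrite zz !expr1n !mulr1 mulrCA [in RHS]mulrCA; congr (_ * _).
by rewrite {1 3}kE; exact: rc.
Qed.

(** * Quadrature rules and Gegenbauer polynomials *)

Definition quad (R : rcfType) (w : R -> R) (T : seq R) (p : {poly R}) : R :=
  \sum_(t <- T) w t * p.[t].

Definition nodal (R : rcfType) (T : seq R) : {poly R} := \prod_(t <- T) ('X - t%:P).

(** [gauss_ibp] stands for the weight (1 - x^2)^((a-1)/2), for a = d - 2 the density of <z,x> up to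
    a constant: it says that the derivative of (1 - x^2)^((a+1)/2) f has integral zero. With
    [gauss_one] it fixes all moments up to degree 2m - 1; f has degree at most 2m - 2, so both sides
    stay in that range. The number of nodes is only bounded by m here; for m > 1 equality is a
    consequence. *)
Record gauss_rule (R : rcfType) (a m : nat) (w : R -> R) (T : seq R) : Prop := GaussRule {
  gauss_uniq : uniq T;
  gauss_size : (size T <= m)%N;
  gauss_gt0 : forall t, t \in T -> 0 < w t;
  gauss_one : quad w T 1 = 1;
  gauss_ibp : forall f : {poly R}, (size f <= 2 * m - 1)%N ->
    quad w T ((1 - 'X^2) * f^`()) = a.+1%:R * quad w T ('X * f) }.

Lemma quadD (R : rcfType) (w : R -> R) T p q : quad w T (p + q) = quad w T p + quad w T q.
Proof. by rewrite /quad -big_split; apply: eq_bigr => t _; rewrite hornerD mulrDr. Qed.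

Lemma quadZ (R : rcfType) (w : R -> R) T c p : quad w T (c *: p) = c * quad w T p.
Proof. by rewrite /quad mulr_sumr; apply: eq_bigr => t _; rewrite hornerZ mulrCA. Qed.

Lemma quadB (R : rcfType) (w : R -> R) T p q : quad w T (p - q) = quad w T p - quad w T q.
Proof. by rewrite quadD -scaleN1r quadZ mulN1r. Qed.

Lemma root_nodal (R : rcfType) (T : seq R) t : t \in T -> (nodal T).[t] = 0.
Proof. by move=> tT; apply/rootP; rewrite root_prod_XsubC. Qed.

Lemma size_nodal (R : rcfType) (T : seq R) : size (nodal T) = (size T).+1.
Proof. exact: size_prod_XsubC. Qed.

Lemma quad_nodal (R : rcfType) (w : R -> R) T p : quad w T (p * nodal T) = 0.
Proof.
by rewrite /quad big_seq big1 // => t tT; rewrite hornerM root_nodal ?mulr0.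
Qed.

Lemma coef_mul1subX2 (R : nzRingType) (q : {poly R}) i :
  ((1 - 'X^2) * q)`_i = q`_i - (if (i < 2)%N then 0 else q`_(i - 2)).
Proof. by rewrite mulrBl mul1r coefB -commr_polyXn coefMXn. Qed.

Lemma coef_gegenbauer (R : comNzRingType) (p : {poly R}) (b : nat) (c : R) i :
  ((1 - 'X^2) * p^`()^`() - b.+1%:R *: ('X * p^`()) + c *: p)`_i =
  (i.+2 * i.+1)%:R * p`_i.+2 - ((i * (i + b))%:R - c) * p`_i.
Proof.
rewrite coefD coefB coef_mul1subX2 !coefZ coefXM !coef_deriv.
case: i => [|[|i]] /=; [| |rewrite subSS subSS subn0]; ring.
Qed.

Lemma horner_1subX2 (R : comNzRingType) (x : R) : (1 - 'X^2 : {poly R}).[x] = 1 - x ^+ 2.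
Proof. by rewrite hornerD hornerN hornerXn -polyC1 hornerC. Qed.

Lemma size_deriv_leq (R : nzRingType) (p : {poly R}) : (size p^`() <= (size p).-1)%N.
Proof. exact: size_poly. Qed.

(** The Gegenbauer operator with parameter lambda = a/2 in degree n. *)
Definition gegenbauer_op (R : comNzRingType) (a : nat) (n : nat) (p : {poly R}) : {poly R} :=
  (1 - 'X^2) * p^`()^`() - a.+1%:R *: ('X * p^`()) + (n * (n + a))%:R *: p.

(** The operator is symmetric for the rule: two uses of [gauss_ibp], with f = P' g and f = P g',
    move the derivatives from P to g, and all that is left is a multiple of P, which vanishes at the
    nodes. *)
Lemma quad_gegenbauer (R : rcfType) (a m : nat) (w : R -> R) (T : seq R) (g : {poly R}) :
  gauss_rule a m w T -> (size g <= size T)%N ->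
  quad w T (gegenbauer_op a (size T) (nodal T) * g) = 0.
Proof.
move=> G sg; have nm := gauss_size G.
set P := nodal T; set n := size T in sg nm *.
have sP : size P = n.+1 by exact: size_nodal.
have sP' := size_deriv_leq P; rewrite sP /= in sP'.
have sg' := size_deriv_leq g.
have i1 := gauss_ibp G (f := P^`() * g).
have i2 := gauss_ibp G (f := P * g^`()).
have s1 := size_polyMleq P^`() g; have s2 := size_polyMleq P g^`().
have {}i1 := i1 (leq_trans s1 _); have {}i2 := i2 (leq_trans s2 _).
have -> : gegenbauer_op a n P * g = (1 - 'X^2) * (P^`() * g)^`() - a.+1%:R *: ('X * (P^`() * g))
   - ((1 - 'X^2) * (P * g^`())^`()) + ((1 - 'X^2) * g^`()^`() + (n * (n + a))%:R *: g) * P.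
  by rewrite /gegenbauer_op !derivM -!mul_polyC; ring.
rewrite quadD quad_nodal addr0 !quadB quadZ i1; last first.
  by move: sg sP' nm; move: (size P^`()) (size g) (n) => x y k; lia.
rewrite subrr sub0r i2; last first.
  by rewrite sP; move: sg sg' nm; move: (size g^`()) (size g) (n) => x y k; lia.
by rewrite (mulrC P) mulrA quad_nodal mulr0 oppr0.
Qed.

(** The eigenvalue n (n + a) cancels the leading coefficient, so r has degree below the number of
    nodes. Tested against itself it gives a vanishing sum of terms [w t] r(t)^2 with positive
    weights; hence r is zero at every node, and r = 0. *)
Lemma gegenbauer_eq (R : rcfType) (a m : nat) (w : R -> R) (T : seq R) :
  gauss_rule a m w T -> gegenbauer_op a (size T) (nodal T) = 0.
Proof.
move=> G; set r := gegenbauer_op _ _ _.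
have sP := size_nodal T.
have sr : (size r <= size T)%N.
  apply/leq_sizeP => j nj; rewrite coef_gegenbauer nth_default ?sP; last by lia.
  rewrite mulr0 sub0r; have [->|nj'] := eqVneq j (size T); first by rewrite subrr mul0r oppr0.
  by rewrite nth_default ?mulr0 ?oppr0 // sP; lia.
have := quad_gegenbauer G sr; rewrite -/r /quad big_seq => /eqP.
rewrite psumr_eq0 => [/allP r0|t tT]; last first.
  by rewrite hornerM -expr2 mulr_ge0 ?sqr_ge0 // ltW // (gauss_gt0 G).
apply: (roots_geq_poly_eq0 _ (gauss_uniq G) sr); apply/allP => t tT; apply/rootP/eqP.
have := r0 t tT; rewrite tT /= mulf_eq0 gt_eqF ?(gauss_gt0 G) //=.
by rewrite hornerM -expr2 expf_eq0.
Qed.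

Lemma nodal_coef (R : rcfType) (a m : nat) (w : R -> R) (T : seq R) i :
  gauss_rule a m w T -> (i.+2 * i.+1)%:R * (nodal T)`_i.+2 =
   ((i * (i + a))%:R - (size T * (size T + a))%:R) * (nodal T)`_i.
Proof.
move/gegenbauer_eq/(congr1 (fun p : {poly R} => p`_i)).
by rewrite coef_gegenbauer coef0 => /eqP; rewrite subr_eq0 => /eqP.
Qed.

Lemma quad_deriv_nodal (R : rcfType) (a m : nat) (w : R -> R) (T : seq R) (g : {poly R}) :
  gauss_rule a m w T -> (size g + size T < 2 * m)%N ->
  quad w T ((1 - 'X^2) * (nodal T)^`() * g) = 0.
Proof.
move=> G sg; have := gauss_ibp G (f := nodal T * g).
have := size_polyMleq (nodal T) g; rewrite size_nodal => s1.
move=> /(_ (leq_trans s1 _)).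
have -> : quad w T ('X * (nodal T * g)) = 0 by rewrite (mulrC (nodal T)) mulrA quad_nodal.
have -> : (1 - 'X^2) * (nodal T * g)^`()
    = (1 - 'X^2) * (nodal T)^`() * g + (1 - 'X^2) * g^`() * nodal T by rewrite derivM; ring.
by rewrite mulr0 quadD quad_nodal addr0; apply; move: sg; move: (size g) (size T) => x y; lia.
Qed.

Lemma nodal_rem (R : rcfType) (T : seq R) t : t \in T -> nodal T = ('X - t%:P) * nodal (rem t T).
Proof. by move=> tT; rewrite /nodal (perm_big _ (perm_to_rem tT)) big_cons. Qed.

Lemma nodal_deriv (R : rcfType) (T : seq R) t : t \in T ->
  (nodal T)^`().[t] = (nodal (rem t T)).[t].
Proof.
by move=> tT; rewrite (nodal_rem tT) derivM derivXsubC mul1r !hornerE subrr mul0r addr0.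
Qed.

Lemma nodal_deriv_neq0 (R : rcfType) (T : seq R) t : uniq T -> t \in T -> (nodal T)^`().[t] != 0.
Proof.
move=> uT tT; rewrite nodal_deriv // -[_ == _]/(root _ _) root_prod_XsubC.
by rewrite mem_rem_uniq // inE eqxx.
Qed.

Lemma quad_nodal_rem (R : rcfType) (w : R -> R) (T : seq R) t (p : {poly R}) : uniq T -> t \in T ->
  quad w T (p * nodal (rem t T)) = w t * p.[t] * (nodal T)^`().[t].
Proof.
move=> uT tT; rewrite nodal_deriv // /quad (bigD1_seq t) //= hornerM mulrA big_seq_cond big1 ?addr0 //.
move=> s /andP[sT st]; rewrite hornerM (_ : (nodal _).[s] = 0) ?mulr0 //.
by apply: root_nodal; rewrite mem_rem_uniq // inE st.
Qed.

(** If all nodes were 1 or -1, the identity [gauss_ibp] for f = X would read 0 = a + 1. A node with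
    1 - t^2 nonzero is what makes the constant K of [gauss_weight] nonzero. *)
Lemma gauss_not_pm1 (R : rcfType) (a m : nat) (w : R -> R) (T : seq R) :
  (1 < m)%N -> gauss_rule a m w T -> exists2 t, t \in T & t ^+ 2 != 1.
Proof.
move=> m1 G; case: (boolP (has (fun t => t ^+ 2 != 1) T)) => [/hasP //|/hasPn h].
have := gauss_ibp G (f := 'X); rewrite size_polyX derivX mulr1 => /(_ _).
have -> : quad w T (1 - 'X^2) = 0.
  rewrite /quad big_seq big1 // => t tT; rewrite horner_1subX2.
  by have := h t tT; rewrite negbK => /eqP ->; rewrite subrr mulr0.
have -> : quad w T ('X * 'X) = 1.
  rewrite -(gauss_one G) /quad [LHS]big_seq [RHS]big_seq; apply: eq_bigr => t tT.
  rewrite -expr2 hornerXn (_ : horner 1 t = 1); last by rewrite -polyC1 hornerC.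
  by have := h t tT; rewrite negbK => /eqP ->.
have m2 : (2 <= 2 * m - 1)%N by lia.
by move=> /(_ m2) /esym /eqP; rewrite mulr1 pnatr_eq0.
Qed.

(** Tested against P / (X - t), the polynomial (1 - X^2) P' sees only the node t and gives w(t) (1 -
    t^2) P'(t)^2. It is orthogonal to low degrees, so with fewer than m nodes this would vanish for
    every t. With m nodes, P / (X - t) may be replaced by X^(m-1), as both are monic of the same
    degree, and the value no longer depends on t. *)
Lemma gauss_weight (R : rcfType) (a m : nat) (w : R -> R) (T : seq R) :
  (1 < m)%N -> gauss_rule a m w T ->
  let K := quad w T ((1 - 'X^2) * (nodal T)^`() * 'X^(m.-1)) in
  [/\ size T = m, K != 0 & {in T, forall t, w t * ((1 - t ^+ 2) * (nodal T)^`().[t] ^+ 2) = K}].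
Proof.
move=> m1 G K; have nm := gauss_size G; have uT := gauss_uniq G.
have [t0 t0T t01] := gauss_not_pm1 m1 G.
have srem t : t \in T -> size (nodal (rem t T)) = size T.
  by move=> tT; rewrite size_nodal size_rem // prednK // (leq_ltn_trans (leq0n (index t T))) // index_mem.
have E t : t \in T -> quad w T ((1 - 'X^2) * (nodal T)^`() * nodal (rem t T)) =
   w t * ((1 - t ^+ 2) * (nodal T)^`().[t] ^+ 2).
  by move=> tT; rewrite quad_nodal_rem // hornerM horner_1subX2; ring.
have ne : w t0 * ((1 - t0 ^+ 2) * (nodal T)^`().[t0] ^+ 2) != 0.
  apply: mulf_neq0; first by rewrite gt_eqF ?(gauss_gt0 G).
  by apply: mulf_neq0; [rewrite subr_eq0 eq_sym|rewrite expf_neq0 ?nodal_deriv_neq0].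
have nE : size T = m.
  apply/eqP; rewrite eqn_leq nm leqNgt; apply/negP => lt; move/negP: ne; apply; apply/eqP.
  by rewrite -E // (quad_deriv_nodal G) // srem //; lia.
have EK : {in T, forall t, w t * ((1 - t ^+ 2) * (nodal T)^`().[t] ^+ 2) = K}.
  move=> t tT; rewrite -E //; apply/eqP; rewrite -subr_eq0 -quadB -mulrBr (quad_deriv_nodal G) //.
  suff : (size (nodal (rem t T) - 'X^(m.-1))%R < size T)%N by rewrite -nE mul2n -addnn ltn_add2r.
  have mT : (0 < size T)%N by lia.
  have /monicP l1 := monic_prod_XsubC (rem t T) xpredT id.
  rewrite -(prednK mT) ltnS; apply/leq_sizeP => j; rewrite leq_eqVlt => /predU1P[<-|lj].
    rewrite coefB coefXn nE eqxx -{1}nE -(srem t tT).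
    by move: l1; rewrite /lead_coef -/(nodal _) => ->; rewrite subrr.
  by rewrite coefB coefXn -nE gtn_eqF // subr0 nth_default // srem //; lia.
by split=> //; rewrite -(EK t0).
Qed.

(** * Parity of the nodal polynomial and Sonin's function *)

Lemma eigen_neq (R : numDomainType) (a n i : nat) : (i < n)%N ->
  (i * (i + a))%:R - (n * (n + a))%:R != 0 :> R.
Proof. by move=> lt; rewrite subr_eq0 eqr_nat; nia. Qed.

Lemma nodal_parity (R : rcfType) (a m : nat) (w : R -> R) (T : seq R) i :
  gauss_rule a m w T -> odd (size T + i) -> (nodal T)`_i = 0.
Proof.
move=> G; have [k] := ubnP ((size T).+1 - i); elim: k i => // k IH i lt odi.
have [li|li] := leqP (size T).+1 i; first by rewrite nth_default // size_nodal.
have iT : (i < size T)%N.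
  by rewrite ltn_neqAle -ltnS li andbT; apply: contraTneq odi => ->; rewrite addnn odd_double.
have := nodal_coef i G; rewrite IH; last 2 first.
- by move: lt li; move: (size T) => n; lia.
- by rewrite !addnS /= negbK.
by rewrite mulr0 => /esym /eqP; rewrite mulf_eq0 (negPf (eigen_neq _ _ iT)) => /eqP.
Qed.

Lemma horner_parity (R : comNzRingType) (p : {poly R}) n x :
  (forall i, odd (n + i) -> p`_i = 0) -> p.[- x] = (-1) ^+ n * p.[x].
Proof.
move=> par; rewrite !horner_coef mulr_sumr; apply: eq_bigr => i _.
have [ni|ni] := boolP (odd (n + i)); first by rewrite par // !mul0r mulr0.
have {}ni : odd i = odd n by move: ni; rewrite oddD; do 2 case: odd.
by rewrite (exprNn x) -(signr_odd _ i) ni signr_odd mulrCA.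
Qed.

Definition sonin (R : rcfType) (a : nat) (T : seq R) : {poly R} :=
  (size T * (size T + a))%:R *: nodal T ^+ 2 + (1 - 'X^2) * (nodal T)^`() ^+ 2.

Lemma sonin_node (R : rcfType) (a : nat) (T : seq R) t : t \in T ->
  (sonin a T).[t] = (1 - t ^+ 2) * (nodal T)^`().[t] ^+ 2.
Proof.
move=> tT; rewrite /sonin hornerD hornerZ horner_exp root_nodal // expr0n mulr0 add0r.
by rewrite hornerM horner_1subX2 horner_exp.
Qed.

(** The factor n (n + a) in front of P^2 is chosen so that the terms in P P' cancel once the
    differential equation has replaced (1 - x^2) P''. *)
Lemma deriv_sonin (R : rcfType) (a m : nat) (w : R -> R) (T : seq R) : gauss_rule a m w T ->
  (sonin a T)^`() = (2 * a)%:R *: ('X * (nodal T)^`() ^+ 2).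
Proof.
move=> G; have := gegenbauer_eq G; rewrite /gegenbauer_op => ode.
have : (1 - 'X^2) * (nodal T)^`()^`() = a.+1%:R *: ('X * (nodal T)^`())
    - (size T * (size T + a))%:R *: nodal T.
  by apply/eqP; rewrite -subr_eq0; apply/eqP; rewrite -[RHS]ode; ring.
move=> {}ode; rewrite /sonin !poly.derivE.
transitivity ((size T * (size T + a))%:R *: (nodal T * (nodal T)^`() *+ 2)
   - 'X * (nodal T)^`() ^+ 2 *+ 2 + ((1 - 'X^2) * (nodal T)^`()^`()) * (nodal T)^`() *+ 2).
  by rewrite -!mul_polyC; ring.
by rewrite ode -!mul_polyC; ring.
Qed.

Lemma sonin_even (R : rcfType) (a m : nat) (w : R -> R) (T : seq R) x : gauss_rule a m w T ->
  (sonin a T).[- x] = (sonin a T).[x].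
Proof.
move=> G.
have e1 := horner_parity x (fun i => nodal_parity G (i := i)).
have e2 : (nodal T)^`().[- x] = (-1) ^+ (size T).+1 * (nodal T)^`().[x].
  apply: (@horner_parity _ _ (size T).+1) => i; rewrite addSnnS => h.
  by rewrite coef_deriv (nodal_parity G h) mul0rn.
rewrite /sonin !(horner_1subX2, hornerZ, horner_exp, hornerM, hornerD) e1 e2 (sqrrN x).
by rewrite !exprMn !sqrr_sign !mul1r.
Qed.

(* The derivative 2 a x P'^2 is nonnegative but vanishes at critical points of P: strictness follows as
   a polynomial that is constant on an interval is constant. *)
Lemma sonin_lt (R : rcfType) (a m : nat) (w : R -> R) (T : seq R) x y : (0 < a)%N -> (0 < size T)%N ->
  gauss_rule a m w T -> 0 <= x -> x < y -> (sonin a T).[x] < (sonin a T).[y].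
Proof.
move=> a0 T0 G x0 xy; set g := sonin a T.
have mono : {in `[x, y] &, {homo horner g : u v / u <= v}}.
  apply: ler_hornerW => z /[!in_itv]/= /andP[xz _]; rewrite (deriv_sonin G) hornerZ hornerM hornerX horner_exp.
  by apply: mulr_ge0; rewrite ?ler0n //; apply: mulr_ge0; [exact: le_trans x0 (ltW xz)|exact: sqr_ge0].
have xI : x \in `[x, y] by rewrite in_itv /= lexx ltW.
have yI : y \in `[x, y] by rewrite in_itv /= lexx ltW.
rewrite lt_neqAle mono ?andbT ?(ltW xy) //; apply/negP => /eqP gxy.
pose u (i : nat) := x + (y - x) / i.+1%:R.
have uI i : u i \in `[x, y].
  rewrite in_itv /= /u lerDl divr_ge0 ?ler0n ?subr_ge0 ?(ltW xy) //=.
  by rewrite -lerBrDl ler_pdivrMr ?ltr0n // ler_peMr ?subr_ge0 ?ler1n // ltW.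
have inju : injective u.
  move=> i j /addrI; have yx : y - x != 0 by rewrite subr_eq0 gt_eqF.
  by move/(mulfI yx)/invr_inj/eqP; rewrite eqr_nat => /eqP[].
have : g - (g.[x])%:P = 0.
  apply: (@roots_geq_poly_eq0 _ _ (map u (iota 0 (size (g - (g.[x])%:P))))).
  - apply/allP => _ /mapP[i _ ->]; rewrite /root hornerD hornerN hornerC subr_eq0 eq_le.
    have := uI i; rewrite in_itv /= => /andP[l1 l2].
    by rewrite {1}gxy !mono.
  - by rewrite map_inj_uniq ?iota_uniq.
  - by rewrite size_map size_iota.
(* A constant Sonin function would have derivative zero, hence P' = 0; but the leading coefficient
   of P' is the number of nodes. *)
move/(congr1 (fun p : {poly R} => p^`())); rewrite derivB derivC subr0 deriv0 (deriv_sonin G).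
move/eqP; rewrite scaler_eq0 pnatr_eq0 muln_eq0 /= (gtn_eqF a0) mulf_eq0 polyX_eq0 /= expf_eq0 /=.
move/eqP/(congr1 (fun p : {poly R} => p`_(size T).-1)); rewrite coef0 coef_deriv prednK //.
have /monicP := monic_prod_XsubC T xpredT id; rewrite /lead_coef -/(nodal _) size_nodal /= => ->.
by move/eqP; rewrite pnatr_eq0 (gtn_eqF T0).
Qed.

Lemma sonin_inj_sqr (R : rcfType) (a m : nat) (w : R -> R) (T : seq R) x y : (0 < a)%N -> (0 < size T)%N ->
  gauss_rule a m w T -> (sonin a T).[x] = (sonin a T).[y] -> x ^+ 2 = y ^+ 2.
Proof.
move=> a0 T0 G.
have ab z : (sonin a T).[z] = (sonin a T).[`|z|].
  by case: (ger0P z) => // _; rewrite (sonin_even _ G).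
rewrite (ab x) (ab y) -(normr_id x) => e; rewrite -[LHS]real_normK ?num_real // -[RHS]real_normK ?num_real //.
rewrite normr_id in e; congr (_ ^+ 2).
case: (ltgtP `|x| `|y|) => // l; [have := sonin_lt a0 T0 G (normr_ge0 x) l|have := sonin_lt a0 T0 G (normr_ge0 y) l];
by rewrite e ltxx.
Qed.

(** * Rationality of the squared nodes *)

Definition rational (R : rcfType) (x : R) : Prop := exists q : rat, x = ratr q.

Lemma rationalD (R : rcfType) (x y : R) : rational x -> rational y -> rational (x + y).
Proof. by move=> [p ->] [q ->]; exists (p + q); rewrite rmorphD. Qed.

Lemma rationalM (R : rcfType) (x y : R) : rational x -> rational y -> rational (x * y).
Proof. by move=> [p ->] [q ->]; exists (p * q); rewrite rmorphM. Qed.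

Lemma rationalV (R : rcfType) (x : R) : rational x -> rational x^-1.
Proof. by move=> [p ->]; exists p^-1; rewrite fmorphV. Qed.

Lemma rational_nat (R : rcfType) n : rational (n%:R : R).
Proof. by exists n%:R; rewrite rmorph_nat. Qed.

Lemma rational_cancel (R : rcfType) (x y : R) : x != 0 -> rational x -> rational (x * y) -> rational y.
Proof. by move=> x0 rx rxy; rewrite -(mulKf x0 y); apply: rationalM => //; exact: rationalV. Qed.

Lemma rational_natB (R : rcfType) i j : rational (i%:R - j%:R : R).
Proof. by exists (i%:R - j%:R); rewrite rmorphB /= !rmorph_nat. Qed.

Lemma rational_poly (R : rcfType) (p : {poly R}) : (forall i, rational p`_i) ->
  exists q : {poly rat}, p = map_poly ratr q.
Proof.
move=> rp; have [f fE] := fin_all_exists (fun i : 'I_(size p) => rp i).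
exists (\poly_(i < size p) oapp f 0 (insub i)); apply/polyP => i; rewrite coef_map coef_poly.
case: ltnP => ge.
  by rewrite insubT /= -fE.
by rewrite raddf0 nth_default.
Qed.

Lemma nodal_rational (R : rcfType) (a m : nat) (w : R -> R) (T : seq R) i :
  gauss_rule a m w T -> rational (nodal T)`_i.
Proof.
move=> G; have [k] := ubnP ((size T).+1 - i); elim: k i => // k IH i lt.
have [li|li] := leqP (size T).+1 i.
  by rewrite nth_default ?size_nodal //; exact: (rational_nat _ 0).
have [->|ni] := eqVneq i (size T).
  have /monicP := monic_prod_XsubC T xpredT id; rewrite /lead_coef -/(nodal _) size_nodal /= => ->.
  exact: (rational_nat _ 1).
have iT : (i < size T)%N by rewrite ltn_neqAle ni -ltnS.
apply: (rational_cancel (eigen_neq R a iT)); first exact: rational_natB.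
rewrite -(nodal_coef i G); apply: rationalM; first exact: rational_nat.
by apply: IH; move: lt li; move: (size T) => n; lia.
Qed.

Lemma quad_rational_low (R : rcfType) (a m : nat) (w : R -> R) (T : seq R) k :
  gauss_rule a m w T -> (k < 2 * m)%N -> rational (quad w T 'X^k).
Proof.
move=> G; have [n] := ubnP k; elim: n k => // n IH [|[|k]] lt km.
- by rewrite expr0 (gauss_one G); exact: (rational_nat _ 1).
- have := gauss_ibp G (f := 1); rewrite size_poly1 -polyC1 derivC !mulr0 polyC1 mulr1 => /(_ _).
  have -> : quad w T 0 = 0 by rewrite /quad big1 // => t _; rewrite horner0 mulr0.
  move=> /(_ ltac:(lia)) /esym /eqP; rewrite mulf_eq0 pnatr_eq0 /= => /eqP.
  by rewrite expr1 => ->; exact: (rational_nat _ 0).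
have := gauss_ibp G (f := 'X^(k.+1)); rewrite size_polyXn => /(_ ltac:(lia)).
rewrite derivXn /= -exprS.
rewrite (_ : _ * _ = k.+1%:R *: ('X^k - 'X^(k.+2))); last first.
  by rewrite -mul_polyC !exprS; ring.
rewrite quadZ quadB => e.
apply: (@rational_cancel _ (a.+1 + k.+1)%:R); [by rewrite pnatr_eq0|exact: rational_nat|].
rewrite natrD mulrDl -e mulrBr subrK; apply: rationalM; first exact: rational_nat.
by apply: IH; lia.
Qed.

(** Moments are known only in degrees below 2m, and the polynomial defining K has degree 2m.
    Reducing f modulo P, which changes nothing at the nodes, brings the degree below m. *)
Lemma quad_rational (R : rcfType) (a m : nat) (w : R -> R) (T : seq R) (f : {poly rat}) :
  gauss_rule a m w T -> (0 < m)%N -> rational (quad w T (map_poly ratr f)).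
Proof.
move=> G m0; have [P PE] := rational_poly (fun i => nodal_rational i G).
have P0 : P != 0 by rewrite -(map_poly_eq0 (@ratr R)) -PE -size_poly_eq0 size_nodal.
rewrite (divp_eq f P) rmorphD rmorphM /= -PE quadD quad_nodal add0r.
have : (size (f %% P)%R <= size T)%N.
  by rewrite -ltnS -size_nodal PE size_map_poly ltn_modp.
move: (f %% P) => r sr; rewrite -(coefK r) poly_def rmorph_sum /=.
rewrite (big_morph (quad w T) (quadD w T) (_ : _ = 0)); last first.
  by rewrite /quad big1 // => t _; rewrite horner0 mulr0.
apply: big_ind => [|x y|i _]; [exact: (rational_nat _ 0)|exact: rationalD|].
rewrite -mul_polyC rmorphM /= map_polyC map_polyXn mul_polyC quadZ; apply: rationalM; first by exists r`_i.
apply: (quad_rational_low G).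
by have := leq_trans (leq_trans (ltn_ord i) sr) (gauss_size G); move: (nat_of_ord i) m0 => j; lia.
Qed.

(* The gcd over Q of P and sonin - c, where c = K / w_t is rational, is X - t or X^2 - t^2. *)
Lemma node_sqr_rational (R : rcfType) (a m : nat) (w : R -> R) (T : seq R) t :
  (0 < a)%N -> (1 < m)%N -> gauss_rule a m w T ->
  (forall s, s \in T -> rational (w s)) -> t \in T -> rational (t ^+ 2).
Proof.
move=> a0 m1 G rw tT; have [nE K0 EK] := gauss_weight m1 G.
have T0 : (0 < size T)%N by rewrite nE ltnW.
have [P PE] := rational_poly (fun i => nodal_rational i G).
have [g gE] : exists g : {poly rat}, sonin a T = map_poly ratr g.
  exists ((size T * (size T + a))%:R *: P ^+ 2 + (1 - 'X^2) * P^`() ^+ 2).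
  rewrite /sonin PE deriv_map; move: (size T * _)%N => N.
  have -> : N%:R *: map_poly (@ratr R) P ^+ 2 = map_poly ratr (N%:R%:P) * map_poly ratr (P ^+ 2).
    by rewrite map_polyC /= rmorph_nat mul_polyC rmorphXn.
  have -> : 1 - 'X^2 = map_poly ratr (1 - 'X^2) :> {poly R}.
    by rewrite raddfB /= rmorph1 map_polyXn.
  by rewrite -mul_polyC -rmorphXn -!rmorphM -rmorphD.
have [c cE] : rational ((sonin a T).[t]).
  rewrite sonin_node //; apply: (@rational_cancel _ (w t)); rewrite ?EK //.
  - by rewrite gt_eqF // (gauss_gt0 G).
  - exact: rw.
  have := quad_rational ((1 - 'X^2) * P^`() * 'X^(m.-1)) G (ltnW m1).
  by rewrite !rmorphM raddfB /= rmorph1 !map_polyXn -deriv_map -PE.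
(* The gcd is formed over Q, where the coefficients of both polynomials lie, and commutes with the
   extension to [R], where its roots are known. *)
pose D := gcdp P (g - c%:P).
have DE : map_poly ratr D = gcdp (nodal T) (sonin a T - ((sonin a T).[t])%:P).
  by rewrite gcdp_map raddfB /= -PE -gE map_polyC /= -cE.
have : map_poly ratr D %| nodal T by rewrite DE dvdp_gcdl.
case/dvdp_prod_XsubC => b; set S := mask b T => DS.
have uS : uniq S by apply: mask_uniq; exact: gauss_uniq G.
have rD s : root (map_poly ratr D) s = (s \in S) by rewrite (eqp_root DS) root_prod_XsubC.
have tS : t \in S.
  by rewrite -rD DE root_gcd root_prod_XsubC tT /= /root hornerD hornerN hornerC subrr.
have S2 s : s \in S -> s ^+ 2 = t ^+ 2.
  rewrite -rD DE root_gcd /root hornerD hornerN hornerC subr_eq0 => /andP[_ /eqP e].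
  exact: (sonin_inj_sqr a0 T0 G e).
have Spm s : s \in S -> s = t \/ s = - t.
  by move/S2/eqP; rewrite eqf_sqr => /orP[] /eqP; [left|right].
have [k [k0 kE]] : exists k, k != 0 /\ map_poly ratr D = k *: \prod_(s <- S) ('X - s%:P).
  have /eqpf_eq [k k0 e] := DS; by exists k.
have rc i : rational (k * (\prod_(s <- S) ('X - s%:P))`_i).
  by rewrite -coefZ -kE coef_map; exists D`_i.
have rk : rational k.
  have := rc (size S); have /monicP := monic_prod_XsubC S xpredT id.
  by rewrite /lead_coef size_prod_XsubC /= => ->; rewrite mulr1.
have {}rc i : rational (\prod_(s <- S) ('X - s%:P))`_i by exact: rational_cancel k0 rk (rc i).
(* Membership is tested in [rem t S], so that t = 0, which equals its opposite, falls into the case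
   of a single root. *)
have [ntS|ntS] := boolP (- t \in rem t S).
  have eS : perm_eq S [:: t; - t].
    rewrite (permPl (perm_to_rem tS)) perm_cons.
    apply: uniq_perm => [|//|s]; first exact: rem_uniq.
    rewrite inE mem_rem_uniq // inE /=; apply/andP/eqP => [[st sS]|->].
      by case: (Spm s sS) => // e; rewrite e eqxx in st.
    by move: ntS; rewrite mem_rem_uniq // inE => /andP.
  have := rc 0%N; rewrite (perm_big _ eS) big_cons big_seq1 => -[q qE].
  exists (- q); rewrite rmorphN /= -qE coef0M !coefB !coefX !coefC /= expr2; ring.
have eS : perm_eq S [:: t].
  rewrite (permPl (perm_to_rem tS)) perm_cons; apply/perm_nilP.
  case E : (rem t S) => [//|s r].
  have : s \in rem t S by rewrite E mem_head.
  move=> sr; have := sr; rewrite mem_rem_uniq // inE => /andP[st /Spm [] e].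
    by rewrite e eqxx in st.
  by move: ntS; rewrite -e sr.
have := rc 0%N; rewrite (perm_big _ eS) big_seq1 => -[q qE].
by exists (q ^+ 2); rewrite rmorphXn /= -qE coefB coefX coefC /= sub0r sqrrN.
Qed.

(* The Gegenbauer polynomial of degree m is, up to a factor,
   \sum_i gegenbauer_coef i * 'X^(2 * i + odd m). *)
Fixpoint gegenbauer_coef (F : fieldType) (a m i : nat) : F :=
  if i is j.+1 then
    let k := (j.*2 + odd m)%N in
    gegenbauer_coef F a m j * ((k * (k + a))%:R - (m * (m + a))%:R) / (k.+2 * k.+1)%:R
  else 1.

Definition gegenbauer_eq0 (a m : nat) (x : rat) : Prop :=
  \sum_(i < m./2.+1) gegenbauer_coef rat a m i * x ^+ i = 0.

Definition gegenbauer_split (a m : nat) : Prop := exists s : seq rat,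
  [/\ uniq s, (m./2 <= size s)%N & forall x, x \in s -> gegenbauer_eq0 a m x].

Lemma ratr_gegenbauer_coef (R : rcfType) (a m i : nat) :
  ratr (gegenbauer_coef rat a m i) = gegenbauer_coef R a m i.
Proof.
elim: i => [|i IH] /=; first by rewrite rmorph1.
by rewrite 2!rmorphM fmorphV rmorphB /= IH !rmorph_nat.
Qed.

Lemma nodal_gegenbauer_coef (R : rcfType) (a m : nat) (w : R -> R) (T : seq R) i :
  gauss_rule a m w T -> size T = m ->
  (nodal T)`_(i.*2 + odd m) = (nodal T)`_(odd m) * gegenbauer_coef R a m i.
Proof.
move=> G nE; elim: i => [|i IH] /=; first by rewrite mulr1.
have := nodal_coef (i.*2 + odd m) G; rewrite IH nE => e.
have ne : ((i.*2 + odd m).+2 * (i.*2 + odd m).+1)%:R != 0 :> R by rewrite pnatr_eq0.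
apply: (mulfI ne); rewrite doubleS !addSn e [RHS]mulrC -!mulrA mulVf ?mulr1 //; ring.
Qed.

Lemma nodal_gegenbauer (R : rcfType) (a m : nat) (w : R -> R) (T : seq R) t :
  gauss_rule a m w T -> size T = m -> t \in T -> t != 0 ->
  \sum_(i < m./2.+1) gegenbauer_coef R a m i * (t ^+ 2) ^+ i = 0.
Proof.
move=> G nE tT t0.
(* The coefficients of the right parity are all multiples of this lowest one, and the leading one is
   1. *)
have P0 : (nodal T)`_(odd m) != 0.
  have /monicP := monic_prod_XsubC T xpredT id; rewrite /lead_coef -/(nodal _) size_nodal /= nE.
  rewrite -{1}(odd_double_half m) addnC (nodal_gegenbauer_coef _ G nE).
  by apply: contra_eq_neq => ->; rewrite mul0r eq_sym oner_eq0.
have tm : t ^+ (odd m) != 0 by rewrite expf_neq0.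
apply: (mulfI tm); apply: (mulfI P0); rewrite !mulr0; transitivity (nodal T).[t]; last exact: root_nodal.
rewrite horner_coef size_nodal nE -(big_mkord xpredT (fun i => (nodal T)`_i * t ^+ i)).
have odd0 l : odd l -> (nodal T)`_(l + odd m) = 0.
  by move=> ol; apply: (nodal_parity G); rewrite nE !oddD ol oddb; case: odd.
transitivity (\sum_(0 <= l < m./2.*2.+1) (nodal T)`_(l + odd m) * t ^+ (l + odd m)).
  rewrite sum_even; last by move=> l ol; rewrite odd0 // mul0r.
  rewrite big_mkord !mulr_sumr; apply: eq_bigr => i _.
  by rewrite (nodal_gegenbauer_coef _ G nE) exprD -mul2n exprM; ring.
rewrite -[in RHS](odd_double_half m); case: (boolP (odd m)) => om.
  rewrite [in RHS]big_ltn // add1n big_add1 /=.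
  rewrite (nodal_parity G (i := 0)) ?nE ?addn0 ?om // mul0r add0r.
  by apply: eq_bigr => l _; rewrite addn1.
by rewrite add0n; apply: eq_bigr => l _; rewrite addn0.
Qed.

(** The nodes are symmetric by parity and only 0 is its own partner, so there are at least (m - 1) /
    2 positive ones; their squares are distinct. *)
Lemma gauss_rational_roots (R : rcfType) (a m : nat) (w : R -> R) (T : seq R) :
  (0 < a)%N -> (1 < m)%N -> gauss_rule a m w T -> (forall s, s \in T -> rational (w s)) ->
  gegenbauer_split a m.
Proof.
move=> a0 m1 G rw; have [nE _ _] := gauss_weight m1 G; have uT := gauss_uniq G.
have symT t : t \in T -> - t \in T.
  rewrite -!root_prod_XsubC /root => /eqP e.
  by rewrite (horner_parity _ (fun i => nodal_parity G (i := i))) [X in _ * X]e mulr0.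
pose Tp := [seq t <- T | 0 < t]; pose Tn := [seq t <- T | t < 0].
have sTn : size Tn = size Tp.
  rewrite -(size_map (fun t => - t) Tp); apply: perm_size; apply: uniq_perm.
  - exact: filter_uniq.
  - by rewrite map_inj_uniq ?filter_uniq //; exact: oppr_inj.
  - move=> t; rewrite mem_filter; apply/andP/mapP => [[tn tT]|[s]].
      by exists (- t); rewrite ?opprK // mem_filter oppr_gt0 tn symT.
    by rewrite mem_filter => /andP[s0 sT] ->; rewrite oppr_lt0 s0 symT.
have sz : (m <= (size Tp).*2.+1)%N.
  have := count_predC (fun t => 0 < t) T; have := count_predC (fun t => t < 0) [seq t <- T | ~~ (0 < t)].
  rewrite size_filter !count_filter.
  rewrite (eq_count (a2 := fun t => t < 0)); last first.
    by move=> t /=; case: ltgtP.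
  rewrite (eq_count (a1 := predI _ _) (a2 := pred1 0)); last first.
    by move=> t /=; case: ltgtP.
  rewrite count_uniq_mem // nE -!size_filter -/Tp -/Tn sTn => <-.
  by rewrite size_filter; case: (_ \in _); lia.
have rT (t : R) : exists q : rat, t \in T -> t ^+ 2 = ratr q.
  have [tT|] := boolP (t \in T); last by exists 0.
  by have [q e] := node_sqr_rational a0 m1 G rw tT; exists q.
have [f fE] : exists f : R -> rat, {in T, forall t, t ^+ 2 = ratr (f t)}.
  have [f fE] := fin_all_exists (fun i : 'I_(size T) => rT (tnth (in_tuple T) i)).
  exists (fun t => oapp f 0 (insub (index t T))) => t tT.
  have it : (index t T < size T)%N by rewrite index_mem.
  by rewrite insubT /= -fE (tnth_nth 0) /= nth_index.
exists (map f Tp); split.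
- rewrite map_inj_in_uniq ?filter_uniq // => x y; rewrite !mem_filter => /andP[x0 xT] /andP[y0 yT] e.
  have /eqP := congr1 (@ratr R) e; rewrite -!fE // eqf_sqr => /orP[] /eqP // xy.
  by move: x0; rewrite xy oppr_gt0 ltNge ltW.
- by rewrite size_map; move: (size Tp) sz => k; lia.
- move=> x /mapP[t]; rewrite mem_filter => /andP[t0 tT] ->.
  apply: (fmorph_inj (@ratr R)); rewrite raddf0 rmorph_sum /=.
  rewrite -[RHS](nodal_gegenbauer G nE tT) ?gt_eqF //; apply: eq_bigr => i _.
  by rewrite rmorphM rmorphXn /= -fE // ratr_gegenbauer_coef.
Qed.

(** [w t] is the proportion of points of [X] with <z,x> = t, hence rational, and positive on [T].
    Both sides of [gauss_ibp] are linear in f, so monomials suffice: for f = 1 it is the vanishing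
    of the first moment, otherwise the recurrence [muS]. *)
Lemma stiff_gauss_rule (R : realType) (a m : nat) (X : {fset 'rV[R]_a.+2}) :
  stiff_configuration m X -> exists (w : R -> R) (T : seq R),
    gauss_rule a m w T /\ forall t, t \in T -> rational (w t).
Proof.
case=> des [z zz szT].
have [mu [mu0 mu1 muS] hmu] := stiff_moments (ltn0Sn _) des zz.
have [X0 _ _] := des.
have nX : 0 < #|` X|%:R :> R by rewrite ltr0n cardfs_gt0.
pose T : seq R := inner_products z X.
pose w (t : R) : R := #|` X|%:R^-1 * (count (fun x => dot z x == t) X)%:R.
have mT x : x \in X -> dot z x \in T by move=> xX; apply/imfsetP; exists x.
have quadE (p : {poly R}) : quad w T p = #|` X|%:R^-1 * \sum_(x <- X) p.[dot z x].
  rewrite mulr_sumr /quad (partition_big_imfset _ (fun x => dot z x)) /=.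
  apply: eq_bigr => t _.
  rewrite (eq_bigr (fun=> #|` X|%:R^-1 * p.[t])) => [|x /eqP -> //].
  rewrite big_const_seq iter_addr_0 /w -mulr_natr; ring.
have quadX k : (k <= 2 * m - 1)%N -> quad w T 'X^k = mu k.
  move=> km; rewrite quadE -hmu //; congr (_ * _); apply: eq_bigr => x _.
  by rewrite hornerXn.
exists w, T; split; last first.
  move=> t _; apply: rationalM; last exact: rational_nat.
  by apply: rationalV; exact: rational_nat.
split=> //.
- exact: fset_uniq.
- move=> t /imfsetP[x /= xX ->]; rewrite /w mulr_gt0 ?invr_gt0 // ltr0n -has_count.
  by apply/hasP; exists x.
- by rewrite -(expr0 'X) quadX.
move=> f sf; rewrite -(coefK f) poly_def.
have q0 : quad w T 0 = 0 by rewrite /quad big1 // => t _; rewrite horner0 mulr0.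
have lin (op : {poly R} -> {poly R}) :
    (forall p q, op (p + q) = op p + op q) -> (forall c p, op (c *: p) = c *: op p) ->
    quad w T (op (\sum_(i < size f) f`_i *: 'X^i)) = \sum_(i < size f) f`_i * quad w T (op 'X^i).
  move=> opD opZ; have op0 : op 0 = 0 by have := opZ 0 0; rewrite !scale0r.
  rewrite (big_morph op opD op0) (big_morph (quad w T) (quadD w T) q0).
  by apply: eq_bigr => i _; rewrite opZ quadZ.
rewrite (lin (fun p => (1 - 'X^2) * p^`())); last 2 first.
- by move=> p q; rewrite derivD mulrDr.
- by move=> c p; rewrite derivZ scalerAr.
rewrite (lin (fun p => 'X * p)); last 2 first.
- by move=> p q; rewrite mulrDr.
- by move=> c p; rewrite scalerAr.
rewrite mulr_sumr; apply: eq_bigr => i _; rewrite mulrCA; congr (_ * _).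
have : (i < 2 * m - 1)%N by exact: leq_trans (ltn_ord i) sf.
case: (nat_of_ord i) => [|k] km.
  rewrite -[1]/(1%:P) expr0 -[X in X^`()]/(1%:P) derivC mulr0 q0.
  by rewrite mulr1 -(expr1 'X) quadX // mu1 mulr0.
rewrite derivXn /= -exprS (_ : _ * _ = k.+1%:R *: ('X^k - 'X^(k.+2))); last first.
  by rewrite -mul_polyC !exprS; ring.
rewrite quadZ quadB !quadX; [|lia..].
by rewrite mulrBr -(muS k); ring.
Qed.

Lemma stiff_gegenbauer_split (R : realType) (a m : nat) (X : {fset 'rV[R]_a.+3}) : (1 < m)%N ->
  stiff_configuration m X -> gegenbauer_split a.+1 m.
Proof.
by move=> m1 /stiff_gauss_rule[w [T [G rw]]]; exact: gauss_rational_roots m1 G rw.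
Qed.

(** * Arithmetic preliminaries *)

Lemma mod2P (x : int) : (exists q, x = 2 * q) \/ (exists q, x = 2 * q + 1).
Proof.
have := divz_eq x 2; have := modz_ge0 x (isT : 2 != 0 :> int); have := ltz_pmod x (isT : 0 < 2 :> int).
move=> h1 h2 h3; have [h|h] : ((x %% 2)%Z = 0) \/ ((x %% 2)%Z = 1) by lia.
  by left; exists (x %/ 2)%Z; lia.
by right; exists (x %/ 2)%Z; lia.
Qed.

Lemma mod3P (x : int) : exists q r, x = 3 * q + r /\ (r = 0 \/ r = 1 \/ r = -1).
Proof.
have := divz_eq x 3; have := modz_ge0 x (isT : 3 != 0 :> int); have := ltz_pmod x (isT : 0 < 3 :> int).
move=> h1 h2 h3; have [h|[h|h]] : ((x %% 3)%Z = 0) \/ ((x %% 3)%Z = 1) \/ ((x %% 3)%Z = 2) by lia.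
- by exists (x %/ 3)%Z, 0; split; [lia|left].
- by exists (x %/ 3)%Z, 1; split; [lia|right; left].
- by exists ((x %/ 3)%Z + 1), (-1); split; [lia|right; right].
Qed.

Lemma sqr_odd (x : int) : (exists q, x = 2 * q + 1) -> exists k, x ^+ 2 = 8 * k + 1.
Proof.
case=> q ->; case: (mod2P q) => [[r ->]|[r ->]].
  by exists (2 * r ^+ 2 + r); ring.
by exists (2 * r ^+ 2 + 3 * r + 1); ring.
Qed.

Lemma monic_root_int (n : nat) (c : nat -> int) (x : rat) :
  x ^+ n.+1 = \sum_(i < n.+1) (c i)%:~R * x ^+ i -> exists z : int, x = z%:~R.
Proof.
move=> e; set a := numq x; set d := denq x.
have d0 : d%:~R != 0 :> rat by rewrite intr_eq0 denq_neq0.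
have xE : x = a%:~R / d%:~R by rewrite divq_num_den.
have cop : coprimez d a by rewrite /coprimez /gcdz gcdnC; have := coprime_num_den x; rewrite /coprime => /eqP ->.
have E : a ^+ n.+1 = \sum_(i < n.+1) c i * a ^+ i * d ^+ (n - i) * d.
  have aE : a%:~R = x * d%:~R by rewrite xE divfK.
  apply: (@intr_inj rat); rewrite rmorphXn /= aE exprMn e rmorph_sum /= mulr_suml.
  apply: eq_bigr => -[i /= ni] _; rewrite !rmorphM !rmorphXn /= aE exprMn.
  have -> : d%:~R ^+ n.+1 = d%:~R ^+ i * d%:~R ^+ (n - i) * d%:~R :> rat.
    by rewrite -exprD subnKC // exprSr.
  ring.
have : (d %| a ^+ n.+1)%Z.
  by rewrite E; apply: rpred_sum => i _; exact: dvdz_mull.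
move=> dv; have /andP[] : (d %| 1)%Z && true.
  by rewrite andbT -(Gauss_dvdzr 1 (coprimezXr n.+1 cop)) mulr1.
rewrite dvdz1 => /eqP d1 _; exists a; rewrite xE.
have -> : d = 1 by move: d1 (denq_gt0 x); rewrite -/d; lia.
by rewrite divr1.
Qed.

Lemma cubic_root_int (c0 c1 : int) (x : rat) :
  x ^+ 3 = c1%:~R * x + c0%:~R -> exists z : int, x = z%:~R.
Proof.
move=> e; apply: (@monic_root_int 2 (fun i => nth 0 [:: c0; c1; 0] i)).
by rewrite !big_ord_recl big_ord0 /= e; ring.
Qed.

Lemma quartic_root_int (c0 c1 c2 : int) (x : rat) :
  x ^+ 4 = c2%:~R * x ^+ 2 + c1%:~R * x + c0%:~R -> exists z : int, x = z%:~R.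
Proof.
move=> e; apply: (@monic_root_int 3 (fun i => nth 0 [:: c0; c1; c2; 0] i)).
by rewrite !big_ord_recl big_ord0 /= e; ring.
Qed.

Lemma quintic_root_int (c0 c1 c2 c3 : int) (x : rat) :
  x ^+ 5 = c3%:~R * x ^+ 3 + c2%:~R * x ^+ 2 + c1%:~R * x + c0%:~R -> exists z : int, x = z%:~R.
Proof.
move=> e; apply: (@monic_root_int 4 (fun i => nth 0 [:: c0; c1; c2; c3; 0] i)).
by rewrite !big_ord_recl big_ord0 /= e; ring.
Qed.

Lemma sqr_root_int (n : int) (x : rat) : x ^+ 2 = n%:~R -> exists z : int, x = z%:~R.
Proof.
move=> e; apply: (@monic_root_int 1 (fun i => nth 0 [:: n; 0] i)).
by rewrite !big_ord_recl big_ord0 /= e; ring.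
Qed.

(** Divided differences: subtracting the equations of two roots and cancelling the difference of the
    roots lowers the degree, until only the sum of the roots is left. The quartic and the quintic
    are treated in the same way. *)
Lemma cubic_vieta (F : fieldType) (p q a b c : F) : a != b -> b != c -> a != c ->
  a ^+ 3 + p * a + q = 0 -> b ^+ 3 + p * b + q = 0 -> c ^+ 3 + p * c + q = 0 ->
  [/\ a + b + c = 0, a * b + b * c + c * a = p & a * b * c = - q].
Proof.
rewrite -subr_eq0 => ab; rewrite -subr_eq0 => bc; rewrite -subr_eq0 => ac ha hb hc.
have h1 : a ^+ 2 + a * b + b ^+ 2 + p = 0.
  apply: (mulfI ab); rewrite mulr0 -[RHS](subrr 0) -{1}ha -hb; ring.
have h2 : a ^+ 2 + a * c + c ^+ 2 + p = 0.
  apply: (mulfI ac); rewrite mulr0 -[RHS](subrr 0) -{1}ha -hc; ring.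
have s : a + b + c = 0.
  apply: (mulfI bc); rewrite mulr0 -[RHS](subrr 0) -{1}h1 -h2; ring.
have cE : c = - (a + b) by rewrite -[RHS]add0r -s; ring.
have pE : p = - (a ^+ 2 + a * b + b ^+ 2) by rewrite -[RHS]add0r -h1; ring.
split=> //; first by rewrite pE cE; ring.
by rewrite -[RHS]add0r -ha pE cE; ring.
Qed.

(** * Euler's lemma on p^2 + 3 r^2 = q^3 *)

Lemma sqrtn_ex (q : nat) : exists s, (s * s <= q < s.+1 * s.+1)%N.
Proof.
elim: q => [|q [s /andP[l u]]]; first by exists 0%N.
case: (ltnP q.+1 (s.+1 * s.+1)) => h; first by exists s; lia.
by exists s.+1; lia.
Qed.

Lemma sqr_dist_le (s i j : nat) : (i < s.+1)%N -> (j < s.+1)%N -> (i%:Z - j%:Z) ^+ 2 <= (s * s)%N%:Z.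
Proof.
move=> hi hj; have h : 0 <= (s%:Z - (i%:Z - j%:Z)) * (s%:Z + (i%:Z - j%:Z)).
  by apply: mulr_ge0; lia.
by move: h; lia.
Qed.

(** Pigeonhole: with s the integer square root of q there are (s + 1)^2 > q pairs (i, j) with
    entries at most s, so i - t j takes one residue modulo q twice. *)
Lemma thue (q : nat) (t : int) : (0 < q)%N -> exists e f : int,
  [/\ ~ (e = 0 /\ f = 0), e ^+ 2 <= q%:Z, f ^+ 2 <= q%:Z & (q%:Z %| e - t * f)%Z].
Proof.
move=> q0; have qz : q%:Z != 0 by lia.
have [s /andP[sl su]] := sqrtn_ex q.
have lt (z : int) : (`|(z %% q)%Z| < q)%N.
  by have := modz_ge0 z qz; have := ltz_pmod z (_ : 0 < q%:Z); lia.
pose h (p : 'I_s.+1 * 'I_s.+1) : 'I_q := Ordinal (lt (p.1%:Z - t * p.2%:Z)).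
have : ~~ injectiveb h.
  apply/negP => /injectiveP /leq_card; rewrite card_prod !card_ord.
  by rewrite leqNgt su.
case/injectivePn => -[i j] [[i' j'] ne /(congr1 val) /= e].
exists (i%:Z - i'%:Z), (j%:Z - j'%:Z); split.
- case=> e1 e2; move/negP: ne; apply; apply/eqP.
  by congr (_, _); apply/val_inj => /=; lia.
- by have := sqr_dist_le (ltn_ord i) (ltn_ord i'); lia.
- by have := sqr_dist_le (ltn_ord j) (ltn_ord j'); lia.
have e' : ((i%:Z - t * j%:Z) %% q)%Z = ((i'%:Z - t * j'%:Z) %% q)%Z.
  by have := modz_ge0 (i%:Z - t * j%:Z) qz; have := modz_ge0 (i'%:Z - t * j'%:Z) qz; lia.
have -> : i%:Z - i'%:Z - t * (j%:Z - j'%:Z) = (i%:Z - t * j%:Z) - (i'%:Z - t * j'%:Z) by ring.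
by rewrite -eqz_mod_dvd; apply/eqP.
Qed.

(* A norm e^2 + 3 f^2 = q is found on the lattice e = t f (mod q) where t^2 = -3: Thue's lemma
   gives one of q, 2 q, 3 q, 4 q. *)
Lemma norm_form_ex (q t : int) : 0 < q -> ~~ (2 %| q)%Z -> ~~ (3 %| q)%Z -> (q %| t ^+ 2 + 3)%Z ->
  exists e f : int, e ^+ 2 + 3 * f ^+ 2 = q /\ (q %| e - t * f)%Z.
Proof.
case: q => // q q0 q2 q3 /dvdzP[k hk].
have [e [f [ne le lf /dvdzP[l hl]]]] := @thue q t q0.
have eE : e = t * f + l * q%:Z by lia.
have [n nE] : exists n : int, e ^+ 2 + 3 * f ^+ 2 = n * q%:Z.
  exists (k * f ^+ 2 + 2 * t * f * l + l ^+ 2 * q%:Z).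
  rewrite eE; transitivity ((t ^+ 2 + 3) * f ^+ 2 + (2 * t * f * l + l ^+ 2 * q%:Z) * q%:Z); first by ring.
  by rewrite hk; ring.
have q1 : 0 < q%:Z by [].
have n0 : 0 < n.
  rewrite -(pmulr_lgt0 _ q1) -nE; have := sqr_ge0 e; have := sqr_ge0 f.
  have [f0|f0] := eqVneq f 0.
    have [e0|e0] := eqVneq e 0; first by exfalso; apply: ne.
    by rewrite f0 => _ _; have : 0 < e ^+ 2 by [rewrite exprn_even_gt0]; lia.
  by have : 0 < f ^+ 2 by [rewrite exprn_even_gt0]; lia.
have n4 : n <= 4 by rewrite -(ler_pM2r q1) -nE; lia.
have [n1|[n2|[n3|n4']]] : n = 1 \/ n = 2 \/ n = 3 \/ n = 4 by lia.
- by exists e, f; split; [rewrite nE n1 mul1r|apply/dvdzP; exists l; lia].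
(* The value 2 q: e and f have the same parity, so the norm is divisible by 4 and q would be
   even. *)
- exfalso; move/negP: q2; apply; apply/dvdzP; move: nE; rewrite n2.
  case: (mod2P e) (mod2P f) => [[x ->]|[x ->]] [[y ->]|[y ->]]; move: (q%:Z) => z; clear => nE.
  + by exists (x ^+ 2 + 3 * y ^+ 2); lia.
  + by exfalso; lia.
  + by exfalso; lia.
  + by exists (x ^+ 2 + x + 3 * y ^+ 2 + 3 * y + 1); lia.
(* The value 3 q: then e = 3 x and q = f^2 + 3 x^2. The pair (f, -x) is again on the lattice because
   t^2 = -3 modulo q. *)
- have [x [r [ex hr]]] := mod3P e.
  have r0 : r = 0.
    by move: nE hr; rewrite n3 ex; move: (q%:Z) => z; clear => nE [|[]] // rE; move: nE; rewrite rE; lia.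
  rewrite r0 addr0 in ex.
  exists f, (- x); split; first by move: nE; rewrite n3 ex; clear; lia.
  have : (q%:Z %| 3 * (f - t * - x))%Z.
    apply/dvdzP; exists (k * f + t * l).
    transitivity ((t ^+ 2 + 3) * f + t * (3 * x - t * f)); first by ring.
    by rewrite hk -ex eE; ring.
  rewrite Gauss_dvdzr // coprimez_sym; move: q3.
  by rewrite /coprimez /dvdz /gcdz /= -prime_coprime.
(* The value 4 q: the bounds on e^2 and f^2 become equalities, so e is f or -f and f divides t^2 -
   1. It also divides t^2 + 3, hence 4; being odd it is 1 or -1, and q = 1. *)
have e2 : e ^+ 2 = q%:Z by move: nE le lf; rewrite n4'; clear; lia.
have f2 : f ^+ 2 = q%:Z by move: nE le lf; rewrite n4'; clear; lia.
have f0 : f != 0 by apply: contraTneq q1 => f0; rewrite -f2 f0.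
have f4 : (f %| 4)%Z.
  have hef : (e - f) * (e + f) = 0 by move: e2; rewrite -f2; clear; lia.
  suff [z hz] : exists z, t ^+ 2 - 1 = f * z.
    apply/dvdzP; exists (k * f - z).
    transitivity ((t ^+ 2 + 3) - (t ^+ 2 - 1)); first by clear; lia.
    by rewrite hk hz -f2; ring.
  rewrite -f2 in hl; move/eqP: hef; rewrite mulf_eq0 => /orP[] /eqP ef.
    have h : 1 - t = l * f.
      have eE' : e = f by move: ef; clear; lia.
      by apply: (mulfI f0); transitivity (e - t * f); [rewrite eE'; ring|rewrite hl; ring].
    by exists (- l * (t + 1)); transitivity (- ((1 - t) * (t + 1))); [ring|rewrite h; ring].
  have h : - 1 - t = l * f.
    have eE' : e = - f by move: ef; clear; lia.
    by apply: (mulfI f0); transitivity (e - t * f); [rewrite eE'; ring|rewrite hl; ring].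
  by exists (- l * (t - 1)); transitivity (- ((- 1 - t) * (t - 1))); [ring|rewrite h; ring].
have qE : q%:Z = 1.
  have fodd : exists y, f = 2 * y + 1.
    case: (mod2P f) => [[y fE]|//]; exfalso; move/negP: q2; apply; apply/dvdzP.
    by exists (2 * y ^+ 2); rewrite -f2 fE; ring.
  have : (f %| 1)%Z.
    have c2 : coprimez f 2.
      case: fodd => y ->; rewrite coprimez_sym; apply/coprimezP; exists (- y, 1) => /=; ring.
    by move: f4; rewrite -[4%Z]/((2 : int) * (2 * 1)) !Gauss_dvdzr.
  rewrite dvdz1 => /eqP fa; rewrite -f2.
  by have [->|->] : f = 1 \/ f = -1 by move: fa; clear; lia.
by exists 1, 0; split; [rewrite qE|rewrite qE dvd1z].
Qed.

(** The conclusion says that p + r s, with s^2 = -3, is the cube of e + f s. Unique factorisation is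
    replaced by a lattice: t = p / r modulo q^3 satisfies t^2 = -3, and e + f s is an element of
    norm q with e = t f modulo q. Its cube P + S s has norm q^3 and satisfies P = t S modulo q^3,
    like p + r s, so the two differ by a unit 1 or -1, which is itself a cube. *)
Lemma euler_cube (p r q : int) : p ^+ 2 + 3 * r ^+ 2 = q ^+ 3 -> coprimez r q ->
  ~~ (2 %| q)%Z -> ~~ (3 %| q)%Z ->
  exists e f : int, p = e * (e ^+ 2 - 9 * f ^+ 2) /\ r = 3 * f * (e ^+ 2 - f ^+ 2).
Proof.
move=> N rq q2 q3.
have q0 : 0 < q.
  have : 0 <= q ^+ 3 by rewrite -N; have := sqr_ge0 p; have := sqr_ge0 r; clear; lia.
  have qn : q != 0 by apply: contra q2 => /eqP ->; exact: dvdz0.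
  by rewrite exprn_odd_ge0 // lt0r qn.
have rq3 : coprimez r (q ^+ 3) by apply: coprimezXr.
have [[u v] /= uv] := coprimezP _ _ rq3.
pose t := p * u.
have tr : (q ^+ 3 %| p - t * r)%Z.
  apply/dvdzP; exists (p * v); rewrite /t; transitivity (p * (1 - u * r)); first by ring.
  by rewrite -uv; ring.
have [l hl] := dvdzP tr.
have t3 : (q ^+ 3 %| t ^+ 2 + 3)%Z.
  have : (q ^+ 3 %| r ^+ 2 * (t ^+ 2 + 3))%Z.
    apply/dvdzP; exists (1 - l * (p + t * r)).
    transitivity (p ^+ 2 + 3 * r ^+ 2 - (p - t * r) * (p + t * r)); first by ring.
    by rewrite N hl; ring.
  by rewrite Gauss_dvdzr // coprimez_sym coprimezXl.
have [|e [f [ef /dvdzP[k hk]]]] := norm_form_ex q0 q2 q3 (_ : (q %| t ^+ 2 + 3)%Z).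
  by apply: dvdz_trans t3; rewrite exprS dvdz_mulr.
pose P := e * (e ^+ 2 - 9 * f ^+ 2); pose S := 3 * f * (e ^+ 2 - f ^+ 2).
have PS : P ^+ 2 + 3 * S ^+ 2 = q ^+ 3 by rewrite -ef /P /S; ring.
have [j hj] := dvdzP t3.
have q30 : q ^+ 3 != 0 by rewrite expf_neq0 // gt_eqF.
have hPS : P - t * S = (k ^+ 3 + j * (t * f ^+ 3 - 3 * e * f ^+ 2)) * q ^+ 3.
  transitivity ((e - t * f) ^+ 3 + (t ^+ 2 + 3) * (t * f ^+ 3 - 3 * e * f ^+ 2)); first by rewrite /P /S; ring.
  by rewrite hk hj; ring.
set m := k ^+ 3 + _ in hPS.
(* A and -B are the two parts of (p + r s) (P - S s) / q^3 with s^2 = -3; both are integers since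
   (p, r) and (P, S) lie on the same lattice modulo q^3. *)
have [B hB] : exists B, p * S - r * P = B * q ^+ 3.
  exists (l * S - m * r).
  transitivity ((p - t * r) * S - (P - t * S) * r); first by ring.
  by rewrite hl hPS; ring.
have [A hA] : exists A, p * P + 3 * r * S = A * q ^+ 3.
  exists (l * P + t * r * m + j * r * S).
  transitivity ((p - t * r) * P + t * r * (P - t * S) + (t ^+ 2 + 3) * r * S); first by ring.
  by rewrite hl hPS hj; ring.
have AB : A ^+ 2 + 3 * B ^+ 2 = 1.
  apply: (mulfI (mulf_neq0 q30 q30)); rewrite mulr1.
  transitivity ((A * q ^+ 3) ^+ 2 + 3 * (B * q ^+ 3) ^+ 2); first by ring.
  by rewrite -hA -hB; transitivity ((p ^+ 2 + 3 * r ^+ 2) * (P ^+ 2 + 3 * S ^+ 2)); [ring|rewrite N PS].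
have B0 : B = 0.
  by apply/eqP; rewrite -sqrf_eq0; apply/eqP; have := sqr_ge0 A; have := sqr_ge0 B; move: AB; clear; lia.
have A1 : A = 1 \/ A = -1.
  by move/eqP: AB; rewrite B0 expr0n mulr0 addr0 sqrf_eq1 => /orP[] /eqP; [left|right].
rewrite B0 mul0r in hB.
have pE : p = A * P.
  apply: (mulfI q30); rewrite -{1}PS; transitivity (P * (A * q ^+ 3)); last by ring.
  rewrite -hA; transitivity (P * (p * P + 3 * r * S) + 3 * S * (p * S - r * P)); first by ring.
  by rewrite hB; ring.
have rE : r = A * S.
  apply: (mulfI q30); rewrite -{1}PS; transitivity (S * (A * q ^+ 3)); last by ring.
  rewrite -hA; transitivity (S * (p * P + 3 * r * S) - P * (p * S - r * P)); first by ring.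
  by rewrite hB; ring.
case: A1 => A1; rewrite A1 in pE rE.
  by exists e, f; rewrite pE rE /P /S; split; ring.
by exists (- e), (- f); rewrite pE rE /P /S; split; ring.
Qed.

(** * The cubics for m = 6 and m = 7 *)

Lemma gcd_decomp (a b : int) : a != b -> exists g x y u v : int,
  [/\ g != 0, a = g * x, b = g * y & u * x + v * y = 1].
Proof.
move=> ab; have [u [v uv]] := Bezoutz a b.
have [x hx] := dvdzP (dvdz_gcdl a b); have [y hy] := dvdzP (dvdz_gcdr a b).
have g0 : gcdz a b != 0.
  by apply: contra ab => /eqP g0; rewrite g0 mulr0 in hx; rewrite g0 mulr0 in hy; rewrite hx hy.
exists (gcdz a b), x, y, u, v; split=> //; try by rewrite mulrC.
apply: (mulfI g0); rewrite mulr1; transitivity (u * (x * gcdz a b) + v * (y * gcdz a b)); first by ring.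
by rewrite -hx -hy.
Qed.

Lemma coprime_form (x y u v : int) : u * x + v * y = 1 ->
  coprimez (x ^+ 2 + x * y + y ^+ 2) (x * y * (x + y)).
Proof.
move=> uv; have xy : coprimez x y by apply/coprimezP; exists (u, v).
rewrite !coprimezMr !(coprimez_sym (_ + _ + _)); apply/andP; split; [apply/andP; split|].
- rewrite /coprimez (_ : _ + _ = (x + y) * x + y ^+ 2); last by ring.
  by rewrite gcdzMDl; exact: coprimezXr.
- rewrite /coprimez (_ : _ + _ = (x + y) * y + x ^+ 2); last by ring.
  by rewrite gcdzMDl; apply: coprimezXr; rewrite coprimez_sym.
- rewrite /coprimez (_ : _ + _ + _ = x * (x + y) + y ^+ 2); last by ring.
  rewrite gcdzMDl; apply: coprimezXr; rewrite coprimez_sym.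
  by rewrite /coprimez (_ : x + y = 1 * y + x) ?gcdzMDl -1?[gcdz _ _ == 1]/(coprimez _ _) 1?coprimez_sym //; ring.
Qed.

Lemma odd_form (x y u v : int) : u * x + v * y = 1 -> ~~ (2 %| x ^+ 2 + x * y + y ^+ 2)%Z.
Proof.
move=> uv; apply/negP => /dvdzP[k]; move: uv.
by case: (mod2P x) (mod2P y) => [[a ->]|[a ->]] [[b ->]|[b ->]]; clear; lia.
Qed.

Lemma even_prod (x y : int) : exists k, x * y * (x + y) = 2 * k.
Proof.
case: (mod2P x) => [[a ->]|[a ->]].
  by exists (a * y * (2 * a + y)); ring.
case: (mod2P y) => [[b ->]|[b ->]].
  by exists ((2 * a + 1) * b * (2 * a + 1 + 2 * b)); ring.
by exists ((2 * a + 1) * (2 * b + 1) * (a + b + 1)); ring.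
Qed.

Lemma dvd_sqr2 (x k : int) : x ^+ 2 = 2 * k -> exists y, x = 2 * y.
Proof. by case: (mod2P x) => [[y ->]|[y ->]]; [exists y|clear; lia]. Qed.

Lemma dvd_sqr3 (x k : int) : x ^+ 2 = 3 * k -> exists y, x = 3 * y.
Proof.
have [y [r [-> h]]] := mod3P x; case: h => [->|[|] ->] e; first by exists y; rewrite addr0.
  by exfalso; move: e; clear; lia.
by exfalso; move: e; clear; lia.
Qed.

Lemma dvdz_small (n : nat) (r : int) : (r %| n.+1%:Z)%Z -> - n.+1%:Z <= r <= n.+1%:Z.
Proof.
move=> h; have : (`|r| <= n.+1)%N by apply: dvdn_leq.
by clear; lia.
Qed.

Lemma coprimez_prime (p : nat) (q : int) : prime p -> ~~ (p%:Z %| q)%Z -> coprimez p%:Z q.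
Proof. by move=> pp; rewrite /coprimez /dvdz /gcdz /= => h; rewrite (eqP (_ : coprime p `|q|)) ?prime_coprime. Qed.

(** By Euler's lemma r = e (e^2 - 9 f^2). As r divides 2, so does e, and e^2 - 9 f^2 is too small
    for a nonzero f; hence s = 0. *)
Lemma cube_norm_small (q r s : int) : q ^+ 3 = r ^+ 2 + 3 * s ^+ 2 -> ~~ (2 %| q)%Z -> (r %| 2)%Z -> s = 0.
Proof.
move=> E q2 /[dup] r2 /dvdz_small rb.
have r0 : r <> 0 by move=> r0; move: r2; rewrite r0.
have q3 : ~~ (3 %| q)%Z.
  apply/negP => /dvdzP[k qk]; move: E; rewrite qk.
  have : r = 1 \/ r = -1 \/ r = 2 \/ r = -2 by move: rb r0; clear; lia.
  by clear; case=> [|[|[|]]] ->; lia.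
have sq : coprimez s q.
  have [[u v] /= uv] : exists p, p.1 * r ^+ 2 + p.2 * q = 1.
    apply/coprimezP; apply: coprimezXl; apply: coprimez_dvdl r2 _; exact: (@coprimez_prime 2).
  apply/coprimezP; exists (- 3 * u * s, u * q ^+ 2 + v) => /=.
  transitivity (u * (q ^+ 3 - 3 * s ^+ 2) + v * q); first by ring.
  by rewrite E -uv; ring.
have [e [f [rE sE]]] := euler_cube (esym E) sq q2 q3.
have e2 : (e %| 2)%Z by apply: dvdz_trans r2; rewrite rE dvdz_mulr.
have f0 : f = 0.
  have ee : e = 1 \/ e = -1 \/ e = 2 \/ e = -2.
    have e0 : e <> 0 by move=> e0; apply: r0; rewrite rE e0 mul0r.
    by move: (dvdz_small e2) e0; clear; lia.
  have ff : f ^+ 2 = 0 by move: ee rE rb (sqr_ge0 f); clear; case=> [|[|[|]]] ->; lia.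
  by move/eqP: ff; rewrite sqrf_eq0 => /eqP.
by rewrite sE f0 mulr0 mul0r.
Qed.

(** If 3 divides q, dividing the equation by 27 exchanges the two squares and leads back to
    [cube_norm_small]. Otherwise r = 3 f (e^2 - f^2) by Euler's lemma, and a divisor of 6 has this
    form only for e = 0. *)
Lemma cube_norm_dvd6 (q p r : int) : q ^+ 3 = p ^+ 2 + 3 * r ^+ 2 -> ~~ (2 %| q)%Z -> (r %| 6)%Z -> p = 0.
Proof.
move=> E q2 r6; have r0 : r <> 0 by move=> r0; move: r6; rewrite r0.
have [/dvdzP[k qk]|q3] := boolP (3 %| q)%Z.
  have [p1 p1E] : exists p1, p = 3 * p1.
    by apply: (@dvd_sqr3 _ (9 * k ^+ 3 - r ^+ 2)); move: E; rewrite qk; clear; lia.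
  have [r1 r1E] : exists r1, r = 3 * r1.
    by apply: (@dvd_sqr3 _ (3 * k ^+ 3 - p1 ^+ 2)); move: E; rewrite qk p1E; clear; lia.
  have [p2 p2E] : exists p2, p1 = 3 * p2.
    by apply: (@dvd_sqr3 _ (k ^+ 3 - r1 ^+ 2)); move: E; rewrite qk p1E r1E; clear; lia.
  rewrite p1E p2E (@cube_norm_small k r1 p2) ?mulr0 //.
  - by move: E; rewrite qk p1E r1E p2E; clear; lia.
  - by apply: contra q2; rewrite qk; exact: dvdz_mulr.
  - by move: r6; rewrite r1E -[6%Z]/((3 : int) * 2) dvdz_mul2l.
have rq : coprimez r q.
  apply: coprimez_dvdl r6 _; rewrite -[6%Z]/((3 : int) * 2) coprimezMl.
  by rewrite (@coprimez_prime 3) // (@coprimez_prime 2).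
have [e [f [pE rE]]] := euler_cube (esym E) rq q2 q3.
pose s := f * (e ^+ 2 - f ^+ 2).
have rs : r = 3 * s by rewrite rE /s; ring.
have s2 : (s %| 2)%Z by move: r6; rewrite rs -[6%Z]/((3 : int) * 2) dvdz_mul2l.
have f2 : (f %| 2)%Z by apply: dvdz_trans s2; exact: dvdz_mulr.
have s0 : s <> 0 by move=> s0; apply: r0; rewrite rs s0 mulr0.
have ff : f = 1 \/ f = -1 \/ f = 2 \/ f = -2.
  have f0 : f <> 0 by move=> f0; apply: s0; rewrite /s f0 mul0r.
  by move: (dvdz_small f2) f0; clear; lia.
have e2 : e ^+ 2 = 0 \/ e ^+ 2 = 2 \/ e ^+ 2 = 3 \/ e ^+ 2 = 5 \/ e ^+ 2 = 6.
  by move: (dvdz_small s2) s0 (sqr_ge0 e); rewrite /s; case: ff => [|[|[|]]] ->; clear; lia.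
have e0 : e = 0.
  have eb : - 2 <= e <= 2.
    by move: e2; clear; nia.
  move: eb e2; clear => eb.
  by have : e = 0 \/ e = 1 \/ e = -1 \/ e = 2 \/ e = -2 by [lia]; case=> [|[|[|[|]]]] ->; lia.
by rewrite pE e0 mul0r.
Qed.

(** Here a, b, -(a + b) are the roots of the depressed cubic and M = 5 X. After removing g = gcd(a,
    b), the forms q and w are coprime, and eliminating X between the two relations and the identity
    4 q^3 = 27 w^2 + dl^2, with dl the difference product, leaves q^3 = (5 e)^2 + 3 r^2 with r
    dividing 6. This forces dl = 0, against the distinctness of the roots. *)
Lemma cubic6_int_False (a b X : int) : a != b -> a + 2 * b != 0 -> 2 * a + b != 0 ->
  25 * X ^+ 2 = 2 * (a ^+ 2 + a * b + b ^+ 2) + 1 ->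
  3 * (a * b * (a + b)) = - 4 * X * (a ^+ 2 + a * b + b ^+ 2) -> False.
Proof.
move=> ab ac bc h1 h2; have [g [x [y [u [v [g0 aE bE uv]]]]]] := gcd_decomp ab.
have := coprime_form uv; have q2 := odd_form uv; have [k kE] := even_prod x y.
set q := x ^+ 2 + _ + _ in q2 *; set w := x * y * _ in kE * => qw.
have {}h1 : 25 * X ^+ 2 = 2 * g ^+ 2 * q + 1 by rewrite h1 aE bE /q; ring.
have {}h2 : 3 * (g * w) = - 4 * X * q.
  by apply: (mulfI (expf_neq0 2 g0)); transitivity (3 * (a * b * (a + b)));
    [rewrite aE bE /w|rewrite h2 aE bE /q]; ring.
have gX : coprimez g X by apply/coprimezP; exists (- 2 * g * q, 25 * X) => /=; move: h1; clear; lia.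
have /dvdzP[rho rhoE] : (g %| 4 * q)%Z.
  by rewrite -(Gauss_dvdzr _ gX); apply/dvdzP; exists (- 3 * w); move: h2; clear; lia.
have h3 : 3 * w = - X * rho.
  apply: (mulfI g0); transitivity (3 * (g * w)); first by ring.
  by rewrite h2; transitivity (- X * (4 * q)); [|rewrite rhoE]; ring.
pose dl := (x - y) * (x + 2 * y) * (2 * x + y).
have d0 : dl != 0.
  apply: mulf_neq0; first apply: mulf_neq0.
  - by rewrite subr_eq0; apply: contra ab => /eqP e; rewrite aE bE e.
  - apply: contra ac => /eqP e; have -> : a + 2 * b = g * (x + 2 * y) by rewrite aE bE; ring.
    by rewrite e mulr0.
  - apply: contra bc => /eqP e; have -> : 2 * a + b = g * (2 * x + y) by rewrite aE bE; ring.
    by rewrite e mulr0.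
have q3E : 4 * q ^+ 3 = 27 * w ^+ 2 + dl ^+ 2 by rewrite /q /w /dl; ring.
have h4 : 225 * w ^+ 2 = 32 * q ^+ 3 + rho ^+ 2.
  transitivity (25 * (3 * w) ^+ 2); first by ring.
  rewrite h3; transitivity (25 * X ^+ 2 * rho ^+ 2); first by ring.
  rewrite h1; transitivity (2 * (rho * g) ^+ 2 * q + rho ^+ 2); first by ring.
  by rewrite -rhoE; ring.
have [r rE] : exists r, rho = 2 * r.
  apply: (@dvd_sqr2 _ (450 * k ^+ 2 - 16 * q ^+ 3)).
  by transitivity (225 * w ^+ 2 - 32 * q ^+ 3); [rewrite h4|rewrite kE]; ring.
have h5 : 4 * q ^+ 3 = 25 * dl ^+ 2 + 3 * rho ^+ 2.
  transitivity (25 * (4 * q ^+ 3) - 96 * q ^+ 3); first by ring.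
  rewrite q3E; transitivity (3 * (225 * w ^+ 2) + 25 * dl ^+ 2 - 96 * q ^+ 3); first by ring.
  by rewrite h4; ring.
have [e eE] : exists e, dl = 2 * e.
  apply: (@dvd_sqr2 _ (2 * q ^+ 3 - 6 * r ^+ 2 - 12 * dl ^+ 2)).
  transitivity (25 * dl ^+ 2 + 3 * rho ^+ 2 - 3 * rho ^+ 2 - 24 * dl ^+ 2); first by ring.
  by rewrite -h5 rE; ring.
have h6 : q ^+ 3 = (5 * e) ^+ 2 + 3 * r ^+ 2.
  by apply: (@mulfI _ (4 : int) isT); rewrite h5 eE rE; ring.
(* r divides 2 q and 3 w, while q and w are coprime. *)
have r6 : (r %| 6)%Z.
  have [[s t] /= st] := coprimezP _ _ qw.
  apply/dvdzP; exists (3 * s * g - 4 * t * X).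
  transitivity (6 * (s * q + t * w)); first by rewrite st.
  have e1 : 2 * q = r * g by move: rhoE; rewrite rE; clear; lia.
  have e2 : 3 * w = - 2 * X * r by move: h3; rewrite rE; clear; lia.
  transitivity (3 * s * (2 * q) + 2 * t * (3 * w)); first by ring.
  by rewrite e1 e2; ring.
have := cube_norm_dvd6 h6 q2 r6; move/eqP; rewrite mulf_eq0 /= => /eqP e0.
by move: d0; rewrite eE e0 mulr0.
Qed.

Lemma odd_ndvd2 (q : int) : ~~ (2 %| q)%Z -> exists z, q = 2 * z + 1.
Proof.
case: (mod2P q) => [[z ->]|//] /negP[]; exact: dvdz_mulr.
Qed.

(** r^2 is 1 or 4. The first is impossible modulo 9. The second gives g^2 = q^2 and M^2 = 9 + 70 q^3
    with q odd, which is 3 modulo 4. *)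
Lemma seven_cube_norm (q r s M g : int) : 7 * q ^+ 3 = r ^+ 2 + 3 * s ^+ 2 -> (r %| 2)%Z ->
  ~~ (2 %| q)%Z -> r * g = 2 * q -> M ^+ 2 = 9 + 70 * g ^+ 2 * q -> False.
Proof.
move=> E r2 q2 rg ME.
have r0 : r <> 0 by move=> r0; move: r2; rewrite r0.
have [r1|r4] : r ^+ 2 = 1 \/ r ^+ 2 = 4.
  have : r = 1 \/ r = -1 \/ r = 2 \/ r = -2 by move: (dvdz_small r2) r0; clear; lia.
  by clear; case=> [|[|[|]]] ->; lia.
- have [x [c [qx hc]]] := mod3P q; have [y [e [sy he]]] := mod3P s.
  by move: E; rewrite r1 qx sy; case: hc => [|[|]] ->; case: he => [|[|]] ->; clear; lia.
have gq : g ^+ 2 = q ^+ 2.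
  have : 4 * g ^+ 2 = 4 * q ^+ 2.
    by transitivity ((r * g) ^+ 2); [rewrite exprMn r4|rewrite rg; ring].
  by clear; lia.
have [z zE] := odd_ndvd2 q2.
have q8 : exists k, q ^+ 3 = 2 * k + 1.
  by exists (4 * z ^+ 3 + 6 * z ^+ 2 + 3 * z); rewrite zE; ring.
case: q8 => k kE.
have {}ME : M ^+ 2 = 9 + 70 * (2 * k + 1) by rewrite ME -kE -mulrA gq; ring.
case: (mod2P M) => [[n hn]|hn].
  by move: ME; rewrite hn; clear; lia.
have [j hj] := sqr_odd hn.
by move: ME; rewrite hj; clear; lia.
Qed.

Lemma dvd_cube7 (q x : int) : q ^+ 3 = 7 * x -> exists y, q = 7 * y.
Proof.
move=> E; have /dvdzP[y ->] : (7 %| q)%Z; last by exists y; rewrite mulrC.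
apply: contraT => h.
have := coprimezXr 3 (@coprimez_prime 7 q isT h).
have : (7 %| q ^+ 3)%Z by apply/dvdzP; exists x; rewrite E mulrC.
by move=> d c; have := coprimez_dvdr d c; rewrite /coprimez gcdzz.
Qed.

(** The elimination used for m = 6, after stripping powers of 3: [hy] shows that 3 divides q and not
    g. It ends in q1^3 = r^2 + 3 (7 e)^2, the difference product now sitting in the second square,
    and r divides 14. The case where 7 divides r is descended to [seven_cube_norm]. *)
Lemma cubic7_int_False (a b y M : int) : a != b -> a + 2 * b != 0 -> 2 * a + b != 0 ->
  a ^+ 2 + a * b + b ^+ 2 = 12 + 9 * y ^+ 2 ->
  10 * (a ^+ 2 + a * b + b ^+ 2) = 3 * (M ^+ 2 - 9) ->
  - 21 * (a * b * (a + b)) = 4 * (a ^+ 2 + a * b + b ^+ 2) * M -> False.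
Proof.
move=> ab ac bc hy h1 h2; have [g [x [z [u [v [g0 aE bE uv]]]]]] := gcd_decomp ab.
have := coprime_form uv; have q2 := odd_form uv; have [k kE] := even_prod x z.
set q := x ^+ 2 + _ + _ in q2 *; set w := x * z * _ in kE * => qw.
have QE : a ^+ 2 + a * b + b ^+ 2 = g ^+ 2 * q by rewrite aE bE /q; ring.
have pE : a * b * (a + b) = g ^+ 3 * w by rewrite aE bE /w; ring.
rewrite pE QE in hy h1 h2.
have g3 : coprimez 3 g.
  apply: (@coprimez_prime 3) => //; apply/negP => /dvdzP[j jE].
  by move: hy; rewrite jE; clear; lia.
have [q1 q1E] : exists q1, q = 3 * q1.
  have /dvdzP[j jE] : (3 %| q)%Z; last by exists j; rewrite mulrC.
  rewrite -(Gauss_dvdzr _ (coprimezXr 2 g3)); apply/dvdzP; exists (4 + 3 * y ^+ 2).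
  by move: hy; clear; lia.
rewrite q1E in h1 h2.
have {}h1 : M ^+ 2 = 9 + 10 * g ^+ 2 * q1 by move: h1; clear; lia.
have {}h2 : - 7 * (g * w) = 4 * q1 * M.
  apply: (mulfI (expf_neq0 2 g0)); apply: (@mulfI _ 3) => //.
  by transitivity (- 21 * (g ^+ 3 * w)); [ring|rewrite h2; ring].
have gM : coprimez g M.
  have g9 : coprimez g (3 ^+ 2) by apply: coprimezXr; rewrite coprimez_sym.
  have [[s t] /= st] := coprimezP _ _ g9.
  apply/coprimezP; exists (s - 10 * t * g * q1, t * M) => /=.
  transitivity (s * g + t * (M ^+ 2 - 10 * g ^+ 2 * q1)); first by ring.
  by rewrite h1 -[RHS]st; ring.
have /dvdzP[rho rhoE] : (g %| 4 * q1)%Z.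
  by rewrite -(Gauss_dvdzr _ gM); apply/dvdzP; exists (- 7 * w); move: h2; clear; lia.
have h3 : - 7 * w = rho * M.
  by apply: (mulfI g0); transitivity (- 7 * (g * w)); [ring|rewrite h2 rhoE; ring].
pose dl := (x - z) * (x + 2 * z) * (2 * x + z).
have d0 : dl != 0.
  apply: mulf_neq0; first apply: mulf_neq0.
  - by rewrite subr_eq0; apply: contra ab => /eqP e; rewrite aE bE e.
  - apply: contra ac => /eqP e; have -> : a + 2 * b = g * (x + 2 * z) by rewrite aE bE; ring.
    by rewrite e mulr0.
  - apply: contra bc => /eqP e; have -> : 2 * a + b = g * (2 * x + z) by rewrite aE bE; ring.
    by rewrite e mulr0.
have q3E : 4 * q ^+ 3 = 27 * w ^+ 2 + dl ^+ 2 by rewrite /q /w /dl; ring.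
have h4 : 49 * w ^+ 2 = 9 * rho ^+ 2 + 160 * q1 ^+ 3.
  transitivity ((- 7 * w) ^+ 2); first by ring.
  rewrite h3; transitivity (M ^+ 2 * rho ^+ 2); first by ring.
  rewrite h1; transitivity (9 * rho ^+ 2 + 10 * (rho * g) ^+ 2 * q1); first by ring.
  by rewrite -rhoE; ring.
rewrite q1E in q3E.
have [d1 d1E] : exists d1, dl = 3 * d1.
  by apply: (@dvd_sqr3 _ (36 * q1 ^+ 3 - 9 * w ^+ 2)); move: q3E; clear; lia.
have [d2 d2E] : exists d2, d1 = 3 * d2.
  by apply: (@dvd_sqr3 _ (4 * q1 ^+ 3 - w ^+ 2)); move: q3E; rewrite d1E; clear; lia.
have {}q3E : 4 * q1 ^+ 3 = w ^+ 2 + 3 * d2 ^+ 2 by move: q3E; rewrite d1E d2E; clear; lia.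
have h5 : 12 * q1 ^+ 3 = 3 * rho ^+ 2 + 49 * d2 ^+ 2 by move: q3E h4; clear; lia.
have [d3 d3E] : exists d3, d2 = 3 * d3.
  by apply: (@dvd_sqr3 _ (4 * q1 ^+ 3 - rho ^+ 2 - 16 * d2 ^+ 2)); move: h5; clear; lia.
have {}h5 : 4 * q1 ^+ 3 = rho ^+ 2 + 147 * d3 ^+ 2 by move: h5; rewrite d3E; clear; lia.
have [r rE] : exists r, rho = 2 * r.
  by apply: (@dvd_sqr2 _ (98 * k ^+ 2 - 80 * q1 ^+ 3 - 4 * rho ^+ 2)); move: h4; rewrite kE; clear; lia.
have [e eE] : exists e, d3 = 2 * e.
  by apply: (@dvd_sqr2 _ (2 * q1 ^+ 3 - 2 * r ^+ 2 - 73 * d3 ^+ 2)); move: h5; rewrite rE; clear; lia.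
have h6 : q1 ^+ 3 = r ^+ 2 + 3 * (7 * e) ^+ 2 by move: h5; rewrite eE rE; clear; lia.
have rg : r * g = 2 * q1 by move: rhoE; rewrite rE; clear; lia.
have q12 : ~~ (2 %| q1)%Z by apply: contra q2; rewrite q1E; exact: dvdz_mull.
have r14 : (r %| 14)%Z.
  have [[s t] /= st] := coprimezP _ _ qw.
  apply/dvdzP; exists (21 * s * g - 4 * t * M).
  transitivity (14 * (s * q + t * w)); first by rewrite st.
  have e2 : - 7 * w = 2 * r * M by rewrite h3 rE.
  transitivity (21 * s * (2 * q1) - 2 * t * (- 7 * w)); first by rewrite q1E; ring.
  by rewrite -rg e2; ring.
have [/dvdzP[r' r'E]|r7] := boolP (7 %| r)%Z.
  have {}r'E : r = 7 * r' by rewrite r'E mulrC.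
  have [q2' q2E] : exists q2', q1 = 7 * q2'.
    by apply: (@dvd_cube7 _ (7 * r' ^+ 2 + 21 * e ^+ 2)); rewrite h6 r'E; ring.
  apply: (@seven_cube_norm q2' r' e M g).
  - by move: h6; rewrite q2E r'E; clear; lia.
  - by move: r14; rewrite r'E -[14%Z]/((7 : int) * 2) dvdz_mul2l.
  - by apply: contra q12; rewrite q2E; exact: dvdz_mull.
  - by move: rg; rewrite q2E r'E; clear; lia.
  - by rewrite h1 q2E; ring.
have r2 : (r %| 2)%Z.
  move: r14; rewrite -[14%Z]/((7 : int) * 2) Gauss_dvdzr //.
  by rewrite coprimez_sym (@coprimez_prime 7).
have := cube_norm_small h6 q12 r2; move/eqP; rewrite mulf_eq0 /= => /eqP e0.
by move: d0; rewrite d1E d2E d3E eE e0 !mulr0.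
Qed.

Lemma mod5P (x : int) : exists q r, x = 5 * q + r /\ (r = 0 \/ r = 1 \/ r = -1 \/ r = 2 \/ r = -2).
Proof.
have := divz_eq x 5; have := modz_ge0 x (isT : 5 != 0 :> int); have := ltz_pmod x (isT : 0 < 5 :> int).
move: (x %/ 5)%Z (x %% 5)%Z => q r h1 h2 h3.
have [h|h] : r <= 2 \/ 3 <= r by clear -h1; lia.
  by exists q, r; split; [lia|clear -h h2; lia].
by exists (q + 1), (r - 5); split; [lia|clear -h h1; lia].
Qed.

Lemma dvd_sqr5 (x k : int) : x ^+ 2 = 5 * k -> exists y, x = 5 * y.
Proof.
have [y [r [-> h]]] := mod5P x.
case: h => [->|h] e; first by exists y; rewrite addr0.
by exfalso; move: h e; clear; case=> [|[|[|]]] ->; lia.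
Qed.

Lemma dvd_cube3 (x k : int) : x ^+ 3 = 3 * k -> exists y, x = 3 * y.
Proof.
have [y [r [-> h]]] := mod3P x; case: h => [->|h] e; first by exists y; rewrite addr0.
by exfalso; move: h e; clear; case=> ->; lia.
Qed.

Lemma cubic_disc (F : fieldType) (a b c : F) : a + b + c = 0 ->
  ((a - b) * (b - c) * (a - c)) ^+ 2 = - 4 * (a * b + b * c + c * a) ^+ 3 - 27 * (a * b * c) ^+ 2.
Proof. by move=> s; have -> : c = - (a + b) by [rewrite -[RHS]add0r -s; ring]; ring. Qed.

Lemma no_cubic6 (M : int) (a b c : rat) : (exists k, M = 2 * k + 1) -> M ^+ 2 != 1 ->
  a != b -> b != c -> a != c ->
  (forall v, v \in [:: a; b; c] ->
     v ^+ 3 - (M%:~R ^+ 2 - 1) / 2 * v - 2 / 15 * (M%:~R * (M%:~R ^+ 2 - 1)) = 0) -> False.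
Proof.
move=> Modd M1 ab bc ac h; set N : rat := M%:~R in h.
pose p := - ((N ^+ 2 - 1) / 2); pose q := - (2 / 15 * (N * (N ^+ 2 - 1))).
have root v : v \in [:: a; b; c] -> v ^+ 3 + p * v + q = 0.
  by move=> /h e; rewrite -[RHS]e /p /q; ring.
have [s e2 e3] := cubic_vieta ab bc ac (root a (mem_head _ _)) (root b ltac:(by rewrite !inE eqxx orbT))
  (root c ltac:(by rewrite !inE eqxx !orbT)).
have N1 : N ^+ 2 - 1 != 0.
  by rewrite subr_eq0 /N -rmorphXn /= -[1]/(1%:~R) eqr_int.
(* The discriminant of the cubic is (M^2 - 1)^2 (M^2 - 25) / 50, and it is the square of the
   difference product. *)
have [y yE] : exists y : int, y ^+ 2 = 2 * (M ^+ 2 - 25).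
  have [|y yE] := @sqr_root_int (2 * (M ^+ 2 - 25)) (10 * ((a - b) * (b - c) * (a - c)) / (N ^+ 2 - 1)).
    rewrite expr_div_n exprMn cubic_disc // e2 e3 /p /q rmorphM rmorphB rmorphXn /= -/N.
    by field.
  exists y; apply: (@intr_inj rat); rewrite rmorphXn /= -yE.
  rewrite expr_div_n exprMn cubic_disc // e2 e3 /p /q rmorphM rmorphB rmorphXn /= -/N.
  by field.
(* Modulo 5 the relation reads y^2 = 2 M^2, and 2 is not a square. This removes the 5 from the
   denominator of the cubic. *)
have [X XE] : exists X, M = 5 * X.
  have [X [r [MX hr]]] := mod5P M; have [z [t [yz ht]]] := mod5P y.
  case: hr => [r0|hr]; first by exists X; rewrite MX r0 addr0.
  exfalso; move: yE; rewrite MX yz; move: hr ht; clear.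
  by case=> [|[|[|]]] ->; case=> [|[|[|[|]]]] ->; lia.
have [j jE] : exists j, 25 * X ^+ 2 - 1 = 2 * j.
  case: Modd => k kE; exists (2 * k ^+ 2 + 2 * k); move: kE; rewrite XE; clear => kE.
  by transitivity ((5 * X) ^+ 2 - 1); [|rewrite kE]; ring.
have NX : N = 5 * X%:~R by rewrite /N XE rmorphM.
have jN : N ^+ 2 - 1 = 2 * j%:~R.
  by rewrite NX; transitivity ((25 * X ^+ 2 - 1)%:~R : rat); [ring|rewrite jE; ring].
have int_root v : v \in [:: a; b; c] -> exists z : int, v = z%:~R.
  move=> /h e.
  have e' : (3 * v) ^+ 3 = (9 * j)%:~R * (3 * v) + (36 * j * X)%:~R.
    rewrite jN NX in e.
    have {}e : v ^+ 3 = j%:~R * v + 4 / 3 * (j%:~R * X%:~R) by rewrite -[LHS]subr0 -e; field.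
    by transitivity (27 * v ^+ 3); [ring|rewrite e !rmorphM /=; field].
  have [z zE] := cubic_root_int e'.
  (* z = 3 v has a cube divisible by 3, so v itself is an integer. *)
  have [t tE] : exists t, z = 3 * t.
    apply: (@dvd_cube3 _ (3 * j * z + 12 * j * X)); apply: (@intr_inj rat).
    by rewrite rmorphXn /= -zE e' zE !(rmorphM, rmorphD) /=; ring.
  exists t; apply: (@mulfI _ 3) => //; by rewrite zE tE rmorphM.
have [x xE] := int_root a (mem_head _ _).
have [z zE] := int_root b ltac:(by rewrite !inE eqxx orbT).
have cE : c = - (x + z)%:~R by rewrite rmorphD /= -xE -zE -[RHS]add0r -s; ring.
have QE : 2 * (x ^+ 2 + x * z + z ^+ 2) = 25 * X ^+ 2 - 1.
  have e : x%:~R ^+ 2 + x%:~R * z%:~R + z%:~R ^+ 2 = (N ^+ 2 - 1) / 2 :> rat.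
    by rewrite -[RHS]opprK -/p -e2 cE xE zE rmorphD /=; ring.
  apply: (@intr_inj rat); rewrite jE.
  transitivity (2 * (x%:~R ^+ 2 + x%:~R * z%:~R + z%:~R ^+ 2) : rat); first by ring.
  by rewrite e jN rmorphM /=; field.
apply: (@cubic6_int_False x z X).
- by apply: contra ab => /eqP e; rewrite xE zE e.
- apply: contra bc => /eqP e; rewrite cE zE -subr_eq0 opprK -rmorphD /=.
  by have -> : z + (x + z) = x + 2 * z by [ring]; rewrite e.
- apply: contra ac => /eqP e; rewrite cE xE -subr_eq0 opprK -rmorphD /=.
  by have -> : x + (x + z) = 2 * x + z by [ring]; rewrite e.
- by rewrite QE; ring.
apply: (@mulfI _ 2) => //; rewrite (_ : 2 * (- 4 * X * _) = - 4 * X * (2 * (x ^+ 2 + x * z + z ^+ 2))); last by ring.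
rewrite QE; apply: (@intr_inj rat).
move: e3; rewrite xE zE cE /q NX !(rmorphM, rmorphD, rmorphB, rmorphXn, rmorphN) /= => e3.
have {}e3 : x%:~R * z%:~R * (x%:~R + z%:~R) = - (2 / 15 * (5 * X%:~R * ((5 * X%:~R) ^+ 2 - 1))) :> rat.
  by rewrite -[LHS]opprK -[in RHS](opprK (2 / 15 * _)) -e3; ring.
by rewrite e3; field.
Qed.

Lemma no_cubic7 (M : int) (a b c : rat) : M ^+ 2 != 9 ->
  a != b -> b != c -> a != c ->
  (forall v, v \in [:: a; b; c] ->
     v ^+ 3 - 3 / 10 * (M%:~R ^+ 2 - 9) * v - 2 / 35 * (M%:~R * (M%:~R ^+ 2 - 9)) = 0) -> False.
Proof.
move=> M9 ab bc ac h; set N : rat := M%:~R in h.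
pose p := - (3 / 10 * (N ^+ 2 - 9)); pose q := - (2 / 35 * (N * (N ^+ 2 - 9))).
have root v : v \in [:: a; b; c] -> v ^+ 3 + p * v + q = 0.
  by move=> /h e; rewrite -[RHS]e /p /q; ring.
have [s e2 e3] := cubic_vieta ab bc ac (root a (mem_head _ _)) (root b ltac:(by rewrite !inE eqxx orbT))
  (root c ltac:(by rewrite !inE eqxx !orbT)).
have N9 : N ^+ 2 - 9 != 0.
  apply: contra M9; rewrite subr_eq0 => /eqP e; apply/eqP/(@intr_inj rat).
  by rewrite rmorphXn /= -/N e; ring.
(* Up to rational squares the discriminant is 30 (M^2 - 49). As 30 is squarefree it divides Y,
   whence M^2 = 49 + 30 y^2. *)
have [Y YE] : exists Y : int, Y ^+ 2 = 30 * (M ^+ 2 - 49).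
  pose t := (N ^+ 2 - 9) / 10.
  have tN : N ^+ 2 = 10 * t + 9 by rewrite /t; field.
  have t0 : t != 0 by rewrite mulf_neq0.
  have pt : p = - 3 * t by rewrite /p tN; field.
  have qt : q = - (4 / 7 * (N * t)) by rewrite /q tN; field.
  have e : (35 / 9 * ((a - b) * (b - c) * (a - c)) / t) ^+ 2 = (30 * (M ^+ 2 - 49))%:~R.
    transitivity (30 * (N ^+ 2 - 49)); last by rewrite /N; ring.
    rewrite expr_div_n exprMn cubic_disc // e2 e3 pt qt tN.
    have -> : (- - (4 / 7 * (N * t))) ^+ 2 = 16 / 49 * (N ^+ 2) * t ^+ 2 by field.
    by rewrite tN; field.
  have [Y YE] := sqr_root_int e.
  by exists Y; apply: (@intr_inj rat); rewrite rmorphXn /= -YE.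
have [Y1 Y1E] : exists Y1, Y = 2 * Y1.
  by apply: (@dvd_sqr2 _ (15 * (M ^+ 2 - 49))); rewrite YE; ring.
have [Y2 Y2E] : exists Y2, Y1 = 3 * Y2.
  by apply: (@dvd_sqr3 _ (10 * (M ^+ 2 - 49) - Y1 ^+ 2)); move: YE; rewrite Y1E; clear; lia.
have [y yE] : exists y, Y2 = 5 * y.
  by apply: (@dvd_sqr5 _ (6 * (M ^+ 2 - 49) - 7 * Y2 ^+ 2)); move: YE; rewrite Y1E Y2E; clear; lia.
have {YE} ME : M ^+ 2 = 49 + 30 * y ^+ 2 by move: YE; rewrite Y1E Y2E yE; clear; lia.
pose K := 4 + 3 * y ^+ 2.
have KN : N ^+ 2 - 9 = 10 * K%:~R.
  by transitivity ((M ^+ 2 - 9)%:~R : rat); [rewrite /N; ring|rewrite ME /K; ring].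
have int_root v : v \in [:: a; b; c] -> exists z : int, v = z%:~R.
  move=> /h e; rewrite KN in e.
  have {}e : v ^+ 3 = 3 * K%:~R * v + 4 / 7 * (N * K%:~R) by rewrite -[LHS]subr0 -e; field.
  have e' : (7 * v) ^+ 3 = (147 * K)%:~R * (7 * v) + (196 * K * M)%:~R.
    by transitivity (343 * v ^+ 3); [ring|rewrite e !rmorphM /= -/N; field].
  have [z zE] := cubic_root_int e'.
  have [t tE] : exists t, z = 7 * t.
    apply: (@dvd_cube7 _ (21 * K * z + 28 * K * M)); apply: (@intr_inj rat).
    by rewrite rmorphXn /= -zE e' zE; ring.
  exists t; apply: (@mulfI _ 7) => //; by rewrite zE tE rmorphM.
have [x xE] := int_root a (mem_head _ _).
have [z zE] := int_root b ltac:(by rewrite !inE eqxx orbT).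
have cE : c = - (x + z)%:~R by rewrite rmorphD /= -xE -zE -[RHS]add0r -s; ring.
have QE : x ^+ 2 + x * z + z ^+ 2 = 12 + 9 * y ^+ 2.
  have e : x%:~R ^+ 2 + x%:~R * z%:~R + z%:~R ^+ 2 = 3 / 10 * (N ^+ 2 - 9) :> rat.
    by rewrite -[RHS]opprK -/p -e2 cE xE zE rmorphD /=; ring.
  apply: (@intr_inj rat).
  transitivity (x%:~R ^+ 2 + x%:~R * z%:~R + z%:~R ^+ 2 : rat); first by ring.
  by rewrite e KN /K; field.
apply: (@cubic7_int_False x z y M).
- by apply: contra ab => /eqP e; rewrite xE zE e.
- apply: contra bc => /eqP e; rewrite cE zE -subr_eq0 opprK -rmorphD /=.
  by have -> : z + (x + z) = x + 2 * z by [ring]; rewrite e.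
- apply: contra ac => /eqP e; rewrite cE xE -subr_eq0 opprK -rmorphD /=.
  by have -> : x + (x + z) = 2 * x + z by [ring]; rewrite e.
- exact: QE.
- by rewrite QE ME; ring.
have {}e3 : x%:~R * z%:~R * (x%:~R + z%:~R) = - (2 / 35 * (N * (N ^+ 2 - 9))) :> rat.
  by rewrite -/q -[RHS]opprK -e3 xE zE cE rmorphD /=; ring.
apply: (@intr_inj rat); rewrite QE.
transitivity (- 21 * (x%:~R * z%:~R * (x%:~R + z%:~R)) : rat); first by ring.
by rewrite e3 KN /K /N; field.
Qed.

(** * The quartics for m = 8 and m = 9 *)

Lemma primitive_seq (p : int) (s : seq int) : 1 < p -> ~~ all (pred1 0) s ->
  exists (k : nat) t, s = map ( *%R (p ^+ k)) t /\ ~~ all (fun x => p %| x)%Z t.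
Proof.
move=> p1; have [n] := ubnP (\sum_(x <- s) `|x|)%N.
elim: n s => // n IH s lt s0.
case: (boolP (all (fun x => p %| x)%Z s)) => [/allP dv|ndv]; last first.
  by exists 0%N, s; split=> //; rewrite expr0 -[LHS]map_id; apply: eq_map => x; rewrite mul1r.
pose t := map (fun x => x %/ p)%Z s.
have st : s = map ( *%R p) t.
  rewrite -map_comp -[LHS]map_id; apply/eq_in_map => x /dv h /=.
  by rewrite mulrC divzK.
have t0 : ~~ all (pred1 0) t.
  apply: contra s0 => /allP h; rewrite st; apply/allP => _ /mapP[x xt ->] /=.
  by rewrite (eqP (h x xt)) mulr0.
have [|k [u [tu un]]] := IH t _ t0; last first.
  exists k.+1, u; split=> //; rewrite st tu -map_comp; apply: eq_map => x /=.
  by rewrite exprS mulrA.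
have /hasP[x xt x0] : has (fun x => x != 0) t by rewrite has_predC.
rewrite ltnS in lt; apply: leq_trans lt; rewrite [in X in (_ < X)%N]st; move: (t) xt => r xt.
rewrite big_map !(big_rem x xt) /=.
apply: (@leq_trans (`|x|%N.+1 + \sum_(y <- rem x r) `|y|%N)%N); first by rewrite addSn ltnS.
apply: leq_add; first by rewrite abszM; move: p1 x0; clear; nia.
by apply: leq_sum => y _; rewrite abszM; move: p1; clear; nia.
Qed.

Lemma odd_mulz (x y : int) : (exists k, x = 2 * k + 1) -> (exists k, y = 2 * k + 1) ->
  exists k, x * y = 2 * k + 1.
Proof. by move=> [j ->] [k ->]; exists (2 * j * k + j + k); ring. Qed.

(** The number of odd terms is even and not zero. Odd squares are 1 modulo 8: four of them give the
    first case, and two of them the second, where the two even factors make the product divisible by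
    4. *)
Lemma parity4 (x1 x2 x3 x4 : int) : x1 + x2 + x3 + x4 = 0 ->
  ~~ all (fun x => 2 %| x)%Z [:: x1; x2; x3; x4] ->
  (exists o, x1 ^+ 2 + x2 ^+ 2 + x3 ^+ 2 + x4 ^+ 2 = 4 * (2 * o + 1)) \/
  (exists o y, x1 ^+ 2 + x2 ^+ 2 + x3 ^+ 2 + x4 ^+ 2 = 2 * (2 * o + 1) /\ x1 * x2 * x3 * x4 = 4 * y).
Proof.
move=> s nall.
have E (x : int) : (exists k, x = 2 * k) \/ (exists k j, x = 2 * k + 1 /\ x ^+ 2 = 8 * j + 1).
  case: (mod2P x) => h; [by left|right].
  by have [j hj] := sqr_odd h; case: h => k hk; exists k, j.
case: (E x1) (E x2) (E x3) (E x4) => [[a1 h1]|[a1 [j1 [h1 g1]]]] [[a2 h2]|[a2 [j2 [h2 g2]]]]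
  [[a3 h3]|[a3 [j3 [h3 g3]]]] [[a4 h4]|[a4 [j4 [h4 g4]]]].
- by move/negP: nall; case; rewrite /= h1 h2 h3 h4 !dvdz_mulr.
- by exfalso; move: s; rewrite h1 h2 h3 h4; clear; lia.
- by exfalso; move: s; rewrite h1 h2 h3 h4; clear; lia.
- right; exists (2 * j3 + 2 * j4 + a1 ^+ 2 + a2 ^+ 2), (x3 * x4 * a1 * a2).
  by rewrite g3 g4 h1 h2; split; ring.
- by exfalso; move: s; rewrite h1 h2 h3 h4; clear; lia.
- right; exists (2 * j2 + 2 * j4 + a1 ^+ 2 + a3 ^+ 2), (x2 * x4 * a1 * a3).
  by rewrite g2 g4 h1 h3; split; ring.
- right; exists (2 * j2 + 2 * j3 + a1 ^+ 2 + a4 ^+ 2), (x2 * x3 * a1 * a4).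
  by rewrite g2 g3 h1 h4; split; ring.
- by exfalso; move: s; rewrite h1 h2 h3 h4; clear; lia.
- by exfalso; move: s; rewrite h1 h2 h3 h4; clear; lia.
- right; exists (2 * j1 + 2 * j4 + a2 ^+ 2 + a3 ^+ 2), (x1 * x4 * a2 * a3).
  by rewrite g1 g4 h2 h3; split; ring.
- right; exists (2 * j1 + 2 * j3 + a2 ^+ 2 + a4 ^+ 2), (x1 * x3 * a2 * a4).
  by rewrite g1 g3 h2 h4; split; ring.
- by exfalso; move: s; rewrite h1 h2 h3 h4; clear; lia.
- right; exists (2 * j1 + 2 * j2 + a3 ^+ 2 + a4 ^+ 2), (x1 * x2 * a3 * a4).
  by rewrite g1 g2 h3 h4; split; ring.
- by exfalso; move: s; rewrite h1 h2 h3 h4; clear; lia.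
- by exfalso; move: s; rewrite h1 h2 h3 h4; clear; lia.
- by left; exists (j1 + j2 + j3 + j4); rewrite g1 g2 g3 g4; ring.
Qed.

Lemma even_odd_mulz (u b k : int) : (exists i, u = 2 * i + 1) -> u * b = 2 * k -> exists c, b = 2 * c.
Proof.
by move=> [i ->]; case: (mod2P b) => [|[c ->]]; [by []|clear; lia].
Qed.

(** Write w_i = z x_i with z the largest common power of 2 and apply [parity4]. Comparing powers of
    2 in the sum of squares and in the product excludes everything except z = 2 with exactly two odd
    x_i: elsewhere either a parity fails, or 4 divides b and l b + 2 is twice an odd number, which
    the product contradicts. *)
Lemma quartic_even (w1 w2 w3 w4 b l u v : int) :
  (exists k, l = 2 * k + 1) -> (exists k, u = 2 * k + 1) -> (exists k, v = 2 * k + 1) -> b != 0 ->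
  w1 + w2 + w3 + w4 = 0 -> w1 ^+ 2 + w2 ^+ 2 + w3 ^+ 2 + w4 ^+ 2 = 4 * u * b ->
  w1 * w2 * w3 * w4 = - v * b * (l * b + 2) -> (exists c, b = 2 * c) ->
  exists c k, [/\ b = 2 * c, (exists j, c = 2 * j + 1) & l * c + 1 = 16 * k].
Proof.
move=> lo uo vo b0 e1 e2 e4 [c bc].
have ws : ~~ all (pred1 0) [:: w1; w2; w3; w4].
  apply/negP => /= /and5P[/eqP z1 /eqP z2 /eqP z3 /eqP z4 _].
  move/eqP: e2; rewrite z1 z2 z3 z4 !expr0n /= !addr0 eq_sym !mulf_eq0 (negPf b0) orbF => /eqP u0.
  by case: uo => k; rewrite u0; clear; lia.
have [k [t [wt nall]]] := primitive_seq (isT : 1 < 2 :> int) ws.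
case: t wt nall => [//|x1 [//|x2 [//|x3 [//|x4 [|//]]]]] [w1E w2E w3E w4E] nall.
set z := 2 ^+ k in w1E w2E w3E w4E.
have z0 : z != 0 by rewrite expf_neq0.
have {}e1 : x1 + x2 + x3 + x4 = 0.
  by apply: (mulfI z0); rewrite mulr0 -[RHS]e1 w1E w2E w3E w4E; ring.
have {}e2 : z ^+ 2 * (x1 ^+ 2 + x2 ^+ 2 + x3 ^+ 2 + x4 ^+ 2) = 4 * (u * b).
  by transitivity (4 * u * b); [rewrite -e2 w1E w2E w3E w4E; ring|ring].
have {}e4 : z ^+ 4 * (x1 * x2 * x3 * x4) = - v * b * (l * b + 2).
  by rewrite -e4 w1E w2E w3E w4E; ring.
have zk : z = 1 \/ z = 2 \/ exists t, z = 4 * t.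
  rewrite /z; case: (k) => [|[|n]]; [by left|by right; left|right; right].
  by exists (2 ^+ n); rewrite !exprS; ring.
have [[n nE]|[n [y [nE yE]]]] := parity4 e1 nall.
  have {}e2 : z ^+ 2 * (2 * n + 1) = u * b.
    by apply: (@mulfI _ (4 : int) isT); rewrite -e2 nE; ring.
  have {}e4 : u * z ^+ 2 * (x1 * x2 * x3 * x4) = - (v * (2 * n + 1)) * (l * b + 2).
    apply: (mulfI (expf_neq0 2 z0)); transitivity (u * (z ^+ 4 * (x1 * x2 * x3 * x4))); first by ring.
    rewrite e4; transitivity (- v * (u * b) * (l * b + 2)); first by ring.
    by rewrite -e2; ring.
  have [r rE] : exists r, v * (2 * n + 1) = 2 * r + 1 by apply: odd_mulz => //; exists n.
  rewrite rE in e4; exfalso; move: (x1 * x2 * x3 * x4) e4 => P e4.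
  have [t zE] : exists t, z = 2 * t.
    case: zk => [z1|[z2|[t zt]]]; [|by exists 1|by exists (2 * t); rewrite zt; ring].
    by move: e2; rewrite z1 bc; clear; lia.
  have hc : u * c = 2 * (t ^+ 2 * (2 * n + 1)).
    by apply: (@mulfI _ (2 : int) isT); transitivity (u * b); [rewrite bc; ring|rewrite -e2 zE; ring].
  by have [i iE] := even_odd_mulz uo hc; move: e4; rewrite zE bc iE; clear; lia.
have {}e2 : z ^+ 2 * (2 * n + 1) = 2 * (u * b).
  by apply: (@mulfI _ (2 : int) isT); rewrite -[RHS]/(2 * (2 * (u * b))) mulrA -[2 * 2]/(4 : int) -e2 nE; ring.
have {}e4 : 8 * u * z ^+ 2 * y = - (v * (2 * n + 1)) * (l * b + 2).
  apply: (mulfI (expf_neq0 2 z0)); transitivity (2 * u * (z ^+ 4 * (x1 * x2 * x3 * x4))); first by rewrite yE; ring.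
  rewrite e4; transitivity (- v * (2 * (u * b)) * (l * b + 2)); first by ring.
  by rewrite -e2; ring.
have [r rE] : exists r, v * (2 * n + 1) = 2 * r + 1 by apply: odd_mulz => //; exists n.
rewrite rE in e4.
case: zk => [z1|[z2|[t zt]]].
- by exfalso; move: e2; rewrite z1; clear; lia.
- have co : u * c = 2 * n + 1.
    by apply: (@mulfI _ (4 : int) isT); transitivity (2 * (u * b)); [rewrite bc; ring|rewrite -e2 z2; ring].
  have [j jE] : exists j, c = 2 * j + 1.
    by case: (mod2P c) => // -[j jE]; exfalso; move: co; rewrite jE; clear; lia.
  have : (2 ^+ 4 %| l * c + 1)%Z.
    have cr : coprimez (2 ^+ 4) (2 * r + 1).
      by apply: coprimezXl; apply/coprimezP; exists (- r, 1) => /=; ring.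
    rewrite -(Gauss_dvdzr _ cr); apply/dvdzP; exists (- u * y).
    by move: e4; rewrite z2 bc; clear; lia.
  case/dvdzP => i iE; exists c, i; split=> //; [by exists j|by rewrite iE; ring].
exfalso.
have hc : u * c = 2 * (2 * t ^+ 2 * (2 * n + 1)).
  by apply: (@mulfI _ (4 : int) isT); transitivity (2 * (u * b)); [rewrite bc; ring|rewrite -e2 zt; ring].
by have [i iE] := even_odd_mulz uo hc; move: e4; rewrite zt bc iE; clear; lia.
Qed.

(** The w_i are odd, so (w1 w2)^2 = 1 modulo 8 and the product condition gives w3 w4 = w1 w2 modulo
    8. Since the sum vanishes, the third symmetric function is (w3 w4 - w1 w2) (w1 + w2), and w1 +
    w2 is even. *)
Lemma quartic_odd (w1 w2 w3 w4 k : int) : w1 + w2 + w3 + w4 = 0 -> w1 * w2 * w3 * w4 = 8 * k + 1 ->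
  exists j, w1 * w2 * w3 + w1 * w2 * w4 + w1 * w3 * w4 + w2 * w3 * w4 = 16 * j.
Proof.
move=> s e4.
have odd1 (x y : int) : x * y = 8 * k + 1 -> exists i, x = 2 * i + 1.
  by case: (mod2P x) => [[i ->]|//] h; exfalso; move: h; clear; lia.
have [i1 h1] := odd1 w1 (w2 * w3 * w4) ltac:(by rewrite -e4; ring).
have [i2 h2] := odd1 w2 (w1 * w3 * w4) ltac:(by rewrite -e4; ring).
have Po : exists i, w1 * w2 = 2 * i + 1 by apply: odd_mulz; [exists i1|exists i2].
have [a aE] := sqr_odd Po.
have h8 : (2 ^+ 3 %| w3 * w4 - w1 * w2)%Z.
  have cr : coprimez (2 ^+ 3) (w1 * w2).
    by case: Po => i ->; apply: coprimezXl; apply/coprimezP; exists (- i, 1) => /=; ring.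
  rewrite -(Gauss_dvdzr _ cr); apply/dvdzP; exists (k - a).
  transitivity (w1 * w2 * w3 * w4 - (w1 * w2) ^+ 2); first by ring.
  by rewrite e4 aE; ring.
have [j jE] := dvdzP h8.
exists (j * (i1 + i2 + 1)).
transitivity ((w3 * w4 - w1 * w2) * (w1 + w2) + w1 * w2 * (w1 + w2 + w3 + w4)); first by ring.
by rewrite jE s h1 h2; ring.
Qed.

Lemma nonsquare_2odd (z n : int) : z ^+ 2 = 2 * (2 * n + 1) -> False.
Proof. by case: (mod2P z) => [[y ->]|[y ->]]; clear; lia. Qed.

Lemma nonsquare_32odd (z n : int) : z ^+ 2 = 32 * (2 * n + 1) -> False.
Proof.
move=> h; have [y yE] : exists y, z = 2 * y.
  by apply: (@dvd_sqr2 _ (16 * (2 * n + 1))); rewrite h; ring.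
have [x xE] : exists x, y = 2 * x.
  by apply: (@dvd_sqr2 _ (4 * (2 * n + 1))); move: h; rewrite yE; clear; lia.
by apply: (@nonsquare_2odd x n); move: h; rewrite yE xE; clear; lia.
Qed.

Lemma nonsquare_5mod8 (z n : int) : z ^+ 2 = 8 * n + 5 -> False.
Proof.
case: (mod2P z) => [[y ->]|h]; first by clear; lia.
by have [k ->] := sqr_odd h; clear; lia.
Qed.

Lemma quartic_odd_False (w1 w2 w3 w4 b M t k : int) :
  (exists k, M = 2 * k + 1) -> (exists k, t = 2 * k + 1) -> (exists k, b = 2 * k + 1) ->
  w1 + w2 + w3 + w4 = 0 ->
  w1 * w2 * w3 + w1 * w2 * w4 + w1 * w3 * w4 + w2 * w3 * w4 = 8 * (t * b * M) ->
  w1 * w2 * w3 * w4 = 8 * k + 1 -> False.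
Proof.
move=> Mo to bo e1 e3 e4; have [j] := quartic_odd e1 e4; rewrite e3.
by have [i ->] := odd_mulz (odd_mulz to bo) Mo; clear; lia.
Qed.

(** For b = 2 c even, [quartic_even] makes c - 5 equal to 8 times an odd number, so z^2 is 32 times
    an odd number. For b = 1 modulo 4 the product of the w_i is 1 modulo 8, and [quartic_odd]
    applies; for b = 3 modulo 4, z^2 is 5 modulo 8. *)
Lemma quartic8_int_False (w1 w2 w3 w4 b M u t z : int) :
  (exists k, M = 2 * k + 1) -> (exists k, u = 2 * k + 1) -> (exists k, t = 2 * k + 1) -> b != 0 ->
  w1 + w2 + w3 + w4 = 0 -> w1 ^+ 2 + w2 ^+ 2 + w3 ^+ 2 + w4 ^+ 2 = 4 * u * b ->
  w1 * w2 * w3 + w1 * w2 * w4 + w1 * w3 * w4 + w2 * w3 * w4 = 8 * (t * b * M) ->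
  forall v k, v = 8 * k + 3 -> w1 * w2 * w3 * w4 = - v * b * (11 * b + 2) ->
  z ^+ 2 = 7 * b * (b - 10) -> False.
Proof.
move=> Mo uo to b0 e1 e2 e3 v k vE e4 h.
case: (mod2P b) => [be|bo].
  have lo : exists k, 11 = 2 * k + 1 :> int by exists 5.
  have vo : exists k, v = 2 * k + 1 by exists (4 * k + 1); rewrite vE; ring.
  have [c [i [bE [j cE] iE]]] := quartic_even lo uo vo b0 e1 e2 e4 be.
  have c5 : c - 5 = 8 * (2 * (3 * i - 2 * c) - 1) by move: iE; clear; lia.
  have [n nE] : exists n, 7 * (c * (2 * (3 * i - 2 * c) - 1)) = 2 * n + 1.
    apply: odd_mulz; first by exists 3.
    by apply: odd_mulz; [exists j|exists (3 * i - 2 * c - 1); ring].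
  apply: (@nonsquare_32odd z n); rewrite -nE h bE.
  by transitivity (28 * c * (c - 5)); [ring|rewrite c5; ring].
case: bo => i'; case: (mod2P i') => [[i ->]|[i ->]] bE.
  apply: (@quartic_odd_False w1 w2 w3 w4 b M t
    (- (k * (176 * i ^+ 2 + 96 * i + 13) + 66 * i ^+ 2 + 36 * i) - 5) Mo to _ e1 e3).
    by exists (2 * i).
  by rewrite e4 vE bE; ring.
by apply: (@nonsquare_5mod8 z (14 * i ^+ 2 - 14 * i - 19)); rewrite h bE; ring.
Qed.

(** As for m = 8 with c - 7 in place of c - 5, and with the classes 1 and 3 modulo 4 exchanged. *)
Lemma quartic9_int_False (w1 w2 w3 w4 b M u t z : int) :
  (exists k, M = 2 * k + 1) -> (exists k, u = 2 * k + 1) -> (exists k, t = 2 * k + 1) -> b != 0 ->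
  w1 + w2 + w3 + w4 = 0 -> w1 ^+ 2 + w2 ^+ 2 + w3 ^+ 2 + w4 ^+ 2 = 4 * u * b ->
  w1 * w2 * w3 + w1 * w2 * w4 + w1 * w3 * w4 + w2 * w3 * w4 = 8 * (t * b * M) ->
  forall v k, v = 8 * k + 1 -> w1 * w2 * w3 * w4 = - v * b * (1 * b + 2) ->
  z ^+ 2 = 15 * b * (b - 14) -> False.
Proof.
move=> Mo uo to b0 e1 e2 e3 v k vE e4 h.
case: (mod2P b) => [be|bo].
  have lo : exists k, 1 = 2 * k + 1 :> int by exists 0.
  have vo : exists k, v = 2 * k + 1 by exists (4 * k); rewrite vE; ring.
  have [c [i [bE [j cE] iE]]] := quartic_even lo uo vo b0 e1 e2 e4 be.
  have c5 : c - 7 = 8 * (2 * i - 1) by move: iE; clear; lia.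
  have [n nE] : exists n, 15 * (c * (2 * i - 1)) = 2 * n + 1.
    apply: odd_mulz; first by exists 7.
    by apply: odd_mulz; [exists j|exists (i - 1); ring].
  apply: (@nonsquare_32odd z n); rewrite -nE h bE.
  by transitivity (60 * c * (c - 7)); [ring|rewrite c5; ring].
case: bo => i'; case: (mod2P i') => [[i ->]|[i ->]] bE.
  by apply: (@nonsquare_5mod8 z (30 * i ^+ 2 - 90 * i - 25)); rewrite h bE; ring.
apply: (@quartic_odd_False w1 w2 w3 w4 b M t
  (- (k * (16 * i ^+ 2 + 32 * i + 15)) - 2 * i ^+ 2 - 4 * i - 2) Mo to _ e1 e3).
  by exists (2 * i + 1).
by rewrite e4 vE bE; ring.
Qed.

Lemma quartic_vieta (F : fieldType) (p q r a b c d : F) :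
  a != b -> a != c -> a != d -> b != c -> b != d -> c != d ->
  (forall x, x \in [:: a; b; c; d] -> x ^+ 4 + p * x ^+ 2 + q * x + r = 0) ->
  [/\ a + b + c + d = 0, a ^+ 2 + b ^+ 2 + c ^+ 2 + d ^+ 2 = - 2 * p,
      a * b * c + a * b * d + a * c * d + b * c * d = - q & a * b * c * d = r].
Proof.
rewrite -!(subr_eq0 _ b) -!(subr_eq0 _ c) -!(subr_eq0 _ d) => ab ac ad bc bd cd h.
have ha := h a (mem_head _ _).
have h1 x : x \in [:: b; c; d] -> a - x != 0 ->
    a ^+ 3 + a ^+ 2 * x + a * x ^+ 2 + x ^+ 3 + p * (a + x) + q = 0.
  move=> hx ax; have hx' := h x (mem_behead (s := [:: a; b; c; d]) hx).
  by apply: (mulfI ax); rewrite mulr0 -[RHS](subrr 0) -{1}ha -hx'; ring.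
have hb := h1 b (mem_head _ _) ab.
have h2 x : x \in [:: c; d] -> a - x != 0 -> b - x != 0 ->
    a ^+ 2 + b ^+ 2 + x ^+ 2 + a * b + a * x + b * x + p = 0.
  move=> hx ax bx; have hx' := h1 x (mem_behead (s := [:: b; c; d]) hx) ax.
  by apply: (mulfI bx); rewrite mulr0 -[RHS](subrr 0) -{1}hb -hx'; ring.
have hc := h2 c (mem_head _ _) ac bc.
have hd := h2 d (mem_behead (s := [:: c; d]) (mem_head _ _)) ad bd.
have s : a + b + c + d = 0.
  by apply: (mulfI cd); rewrite mulr0 -[RHS](subrr 0) -{1}hc -hd; ring.
have dE : d = - (a + b + c) by rewrite -[RHS]add0r -s; ring.
have pE : p = - (a ^+ 2 + b ^+ 2 + c ^+ 2 + a * b + a * c + b * c) by rewrite -[RHS]add0r -hc; ring.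
have qE : q = - (a ^+ 3 + a ^+ 2 * b + a * b ^+ 2 + b ^+ 3 + p * (a + b)) by rewrite -[RHS]add0r -hb; ring.
have rE : r = - (a ^+ 4 + p * a ^+ 2 + q * a) by rewrite -[RHS]add0r -ha; ring.
by split=> //; rewrite ?rE ?qE ?pE dE; ring.
Qed.

Lemma quartic_disc (F : idomainType) (p q r a b c d : F) :
  a + b + c + d = 0 -> a ^+ 2 + b ^+ 2 + c ^+ 2 + d ^+ 2 = - 2 * p -> 2 != 0 :> F ->
  a * b * c + a * b * d + a * c * d + b * c * d = - q -> a * b * c * d = r ->
  ((a - b) * (a - c) * (a - d) * (b - c) * (b - d) * (c - d)) ^+ 2 =
  16 * p ^+ 4 * r - 4 * p ^+ 3 * q ^+ 2 - 128 * p ^+ 2 * r ^+ 2 + 144 * p * q ^+ 2 * r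
    - 27 * q ^+ 4 + 256 * r ^+ 3.
Proof.
move=> s e2 two e3 e4.
have dE : d = - (a + b + c) by rewrite -[RHS]add0r -s; ring.
have pE : p = - (a ^+ 2 + b ^+ 2 + c ^+ 2 + a * b + a * c + b * c).
  apply: (mulfI two); apply: oppr_inj; rewrite -mulNr -e2 dE; ring.
have qE : q = - (a * b * c + (a * b + a * c + b * c) * d) by rewrite -[LHS]opprK -e3; ring.
by rewrite -e4 qE pE dE; ring.
Qed.

(* 105 and, below, 35 are the common denominators D of the depressed quartics in w, so that D w is an
   integer; q2 is the square of the linear coefficient. *)
Lemma quartic8_disc (b : int) :
  let p := - 2 * 105 ^+ 2 * b in let q2 := (8 * (7 * 105 ^+ 2) * b) ^+ 2 * (8 * b + 1) in
  let r := - (3 * 105 ^+ 3) * b * (11 * b + 2) in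
  16 * p ^+ 4 * r - 4 * p ^+ 3 * q2 - 128 * p ^+ 2 * r ^+ 2 + 144 * p * q2 * r - 27 * q2 ^+ 2 + 256 * r ^+ 3
  = (32 * 3 ^+ 5 * 5 ^+ 4 * 7 ^+ 4 * b * (b - 3)) ^+ 2 * (7 * b * (b - 10)).
Proof. by move=> p q2 r; rewrite /p /q2 /r; clear; lia. Qed.

Lemma quartic9_disc (b : int) :
  let p := - (2 * 3 * 7 * 35) * b in let q2 := (8 * 35 ^+ 2 * b) ^+ 2 * (8 * b + 9) in
  let r := - (3 * 35 ^+ 3) * b * (b + 2) in
  16 * p ^+ 4 * r - 4 * p ^+ 3 * q2 - 128 * p ^+ 2 * r ^+ 2 + 144 * p * q2 * r - 27 * q2 ^+ 2 + 256 * r ^+ 3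
  = (32 * 3 * 5 ^+ 3 * 7 ^+ 4 * b * (b - 5)) ^+ 2 * (15 * b * (b - 14)).
Proof. by move=> p q2 r; rewrite /p /q2 /r; clear; lia. Qed.

Lemma quartic_square (p q q2 r F n w1 w2 w3 w4 : int) : F != 0 ->
  w1 + w2 + w3 + w4 = 0 -> w1 ^+ 2 + w2 ^+ 2 + w3 ^+ 2 + w4 ^+ 2 = - 2 * p ->
  w1 * w2 * w3 + w1 * w2 * w4 + w1 * w3 * w4 + w2 * w3 * w4 = - q -> w1 * w2 * w3 * w4 = r ->
  q ^+ 2 = q2 -> 16 * p ^+ 4 * r - 4 * p ^+ 3 * q2 - 128 * p ^+ 2 * r ^+ 2 + 144 * p * q2 * r
    - 27 * q2 ^+ 2 + 256 * r ^+ 3 = F ^+ 2 * n ->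
  exists z, z ^+ 2 = n.
Proof.
move=> F0 e1 e2 e3 e4 <- D; have := quartic_disc e1 e2 isT e3 e4.
set de := (w1 - w2) * _ * _ * _ * _ * _; rewrite [q ^+ 4](exprM q 2 2) D => dE.
have F0' : F%:~R != 0 :> rat by rewrite intr_eq0.
have e : (de%:~R / F%:~R) ^+ 2 = n%:~R :> rat.
  by rewrite expr_div_n -rmorphXn /= dE rmorphM rmorphXn /= mulrC mulKf // expf_neq0.
have [z zE] := sqr_root_int e.
by exists z; apply: (@intr_inj rat); rewrite rmorphXn /= -zE.
Qed.

Lemma scaled_quartic (D c2 c1 c0 : int) (p q r : rat) (w1 w2 w3 w4 : rat) :
  D != 0 -> D%:~R ^+ 2 * p = - c2%:~R -> D%:~R ^+ 3 * q = - c1%:~R -> D%:~R ^+ 4 * r = - c0%:~R ->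
  w1 != w2 -> w1 != w3 -> w1 != w4 -> w2 != w3 -> w2 != w4 -> w3 != w4 ->
  (forall w, w \in [:: w1; w2; w3; w4] -> w ^+ 4 + p * w ^+ 2 + q * w + r = 0) ->
  exists W1 W2 W3 W4 : int,
  [/\ W1 + W2 + W3 + W4 = 0, W1 ^+ 2 + W2 ^+ 2 + W3 ^+ 2 + W4 ^+ 2 = 2 * c2,
      W1 * W2 * W3 + W1 * W2 * W4 + W1 * W3 * W4 + W2 * W3 * W4 = c1 & W1 * W2 * W3 * W4 = - c0].
Proof.
move=> D0 hp hq hr h12 h13 h14 h23 h24 h34 h.
have D0' : D%:~R != 0 :> rat by rewrite intr_eq0.
have H w : w \in [:: w1; w2; w3; w4] ->
    (D%:~R * w) ^+ 4 + (- c2%:~R) * (D%:~R * w) ^+ 2 + (- c1%:~R) * (D%:~R * w) + (- c0%:~R) = 0.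
  by move=> /h e; rewrite -hp -hq -hr -[RHS](mulr0 (D%:~R ^+ 4)) -e; ring.
have int_root w : w \in [:: w1; w2; w3; w4] -> exists W : int, D%:~R * w = W%:~R.
  move=> /H e; apply: (@quartic_root_int c0 c1 c2).
  by rewrite -[LHS]subr0 -e; ring.
have [W1 W1E] := int_root w1 (mem_head _ _).
have [W2 W2E] := int_root w2 ltac:(by rewrite !inE eqxx ?orbT).
have [W3 W3E] := int_root w3 ltac:(by rewrite !inE eqxx ?orbT).
have [W4 W4E] := int_root w4 ltac:(by rewrite !inE eqxx ?orbT).
have ne (x y : rat) (X Y : int) : D%:~R * x = X%:~R -> D%:~R * y = Y%:~R -> x != y -> X%:~R != Y%:~R :> rat.
  by move=> <- <-; apply: contra => /eqP /(mulfI D0') ->.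
have hW w : w \in [:: W1%:~R; W2%:~R; W3%:~R; W4%:~R] ->
    w ^+ 4 + (- c2%:~R) * w ^+ 2 + (- c1%:~R) * w + (- c0%:~R) = 0 :> rat.
  by rewrite -W1E -W2E -W3E -W4E !inE => /or4P[] /eqP ->; apply: H; rewrite !inE eqxx ?orbT.
have [e1 e2 e3 e4] := quartic_vieta (ne _ _ _ _ W1E W2E h12) (ne _ _ _ _ W1E W3E h13)
  (ne _ _ _ _ W1E W4E h14) (ne _ _ _ _ W2E W3E h23) (ne _ _ _ _ W2E W4E h24) (ne _ _ _ _ W3E W4E h34) hW.
exists W1, W2, W3, W4; split; apply: (@intr_inj rat).
- by rewrite -[RHS]e1; ring.
- by transitivity (W1%:~R ^+ 2 + W2%:~R ^+ 2 + W3%:~R ^+ 2 + W4%:~R ^+ 2 : rat); [ring|rewrite e2; ring].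
- by rewrite -[RHS]opprK -e3; ring.
- by rewrite rmorphN /= -e4; ring.
Qed.

Lemma no_quartic8 (M b : int) (w1 w2 w3 w4 : rat) :
  (exists k, M = 2 * k + 1) -> M ^+ 2 = 8 * b + 1 -> b != 0 -> b != 3 ->
  w1 != w2 -> w1 != w3 -> w1 != w4 -> w2 != w3 -> w2 != w4 -> w3 != w4 ->
  (forall w, w \in [:: w1; w2; w3; w4] ->
    w ^+ 4 - 2 * b%:~R * w ^+ 2 - 8 / 15 * (b%:~R * M%:~R) * w - b%:~R * (11 * b%:~R + 2) / 35 = 0) -> False.
Proof.
move=> Mo Mb b0 b3 h12 h13 h14 h23 h24 h34 h.
(* The scale is kept as a variable so that [ring] and [field] work with powers of D instead of large
   numerals. *)
have [D DE] : exists D : int, D = 105 by exists 105.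
have D0 : D != 0 by rewrite DE.
have Dr : D%:~R != 0 :> rat by rewrite intr_eq0.
have D15 : 8 / 15 = 8 * 7 / D%:~R :> rat by rewrite DE; field.
have D35 : 35^-1 = 3 / D%:~R :> rat by rewrite DE; field.
have hp : D%:~R ^+ 2 * (- 2 * b%:~R) = - (2 * D ^+ 2 * b)%:~R :> rat by ring.
have hq : D%:~R ^+ 3 * (- (8 / 15 * (b%:~R * M%:~R))) = - (8 * (7 * D ^+ 2 * b * M))%:~R :> rat.
  rewrite D15; transitivity (- (8 * (7 * D%:~R ^+ 2 * b%:~R * M%:~R)) : rat); last by ring.
  by field.
have hr : D%:~R ^+ 4 * (- (b%:~R * (11 * b%:~R + 2) / 35)) = - (3 * D ^+ 3 * b * (11 * b + 2))%:~R :> rat.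
  rewrite D35; transitivity (- (3 * D%:~R ^+ 3 * b%:~R * (11 * b%:~R + 2)) : rat); last by ring.
  by field.
have [|W1 [W2 [W3 [W4 [e1 e2 e3 e4]]]]] := scaled_quartic D0 hp hq hr h12 h13 h14 h23 h24 h34.
  by move=> w /h e; rewrite -[RHS]e; ring.
(* The square part of the discriminant; it vanishes for b = 0 and b = 3, where the quartic is w^4
   and, with M = 5, (w + 1)^3 (w - 3). *)
pose F := 32 * 3 ^+ 5 * 5 ^+ 4 * 7 ^+ 4 * b * (b - 3).
have F0 : F != 0 by rewrite /F !mulf_neq0 // subr_eq0.
have [z zE] : exists z, z ^+ 2 = 7 * b * (b - 10).
  have q2E : (- (8 * (7 * D ^+ 2 * b * M))) ^+ 2 = (8 * (7 * D ^+ 2) * b) ^+ 2 * (8 * b + 1).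
    by rewrite -Mb; ring.
  apply: (quartic_square F0 e1 (p := - 2 * D ^+ 2 * b) _ _ e4 q2E).
  - by rewrite e2; ring.
  - by rewrite e3; ring.
  have -> : - (3 * D ^+ 3 * b * (11 * b + 2)) = - (3 * D ^+ 3) * b * (11 * b + 2) by ring.
  by rewrite DE; exact: quartic8_disc.
have D13 : D = 8 * 13 + 1 by rewrite DE.
have Do : exists k, D = 2 * k + 1 by exists 52.
have D2o : exists k, D ^+ 2 = 2 * k + 1 by rewrite expr2; apply: odd_mulz.
apply: (@quartic8_int_False W1 W2 W3 W4 b M (D ^+ 2) (7 * D ^+ 2) z Mo D2o _ b0 e1 _ _
  (3 * D ^+ 3) (192 * 13 ^+ 3 + 72 * 13 ^+ 2 + 9 * 13)).
- by apply: odd_mulz => //; exists 3.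
- by rewrite e2; ring.
- exact: e3.
- by rewrite D13; ring.
- by rewrite e4; ring.
- exact: zE.
Qed.

Lemma no_quartic9 (M b : int) (w1 w2 w3 w4 : rat) :
  (exists k, M = 2 * k + 1) -> M ^+ 2 = 8 * b + 9 -> b != 0 -> b != 5 ->
  w1 != w2 -> w1 != w3 -> w1 != w4 -> w2 != w3 -> w2 != w4 -> w3 != w4 ->
  (forall w, w \in [:: w1; w2; w3; w4] ->
    w ^+ 4 - 6 / 5 * b%:~R * w ^+ 2 - 8 / 35 * (b%:~R * M%:~R) * w - 3 / 35 * (b%:~R * (b%:~R + 2)) = 0) -> False.
Proof.
move=> Mo Mb b0 b5 h12 h13 h14 h23 h24 h34 h.
have [D DE] : exists D : int, D = 35 by exists 35.
have D0 : D != 0 by rewrite DE.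
have Dr : D%:~R != 0 :> rat by rewrite intr_eq0.
have D5 : 5^-1 = 7 / D%:~R :> rat by rewrite DE; field.
have D35 : 35^-1 = D%:~R^-1 :> rat by rewrite DE; field.
have hp : D%:~R ^+ 2 * (- (6 / 5 * b%:~R)) = - (6 * 7 * D * b)%:~R :> rat.
  rewrite D5; transitivity (- (6 * 7 * D%:~R * b%:~R) : rat); last by ring.
  by field.
have hq : D%:~R ^+ 3 * (- (8 / 35 * (b%:~R * M%:~R))) = - (8 * (D ^+ 2 * b * M))%:~R :> rat.
  rewrite D35; transitivity (- (8 * (D%:~R ^+ 2 * b%:~R * M%:~R)) : rat); last by ring.
  by field.
have hr : D%:~R ^+ 4 * (- (3 / 35 * (b%:~R * (b%:~R + 2)))) = - (3 * D ^+ 3 * b * (1 * b + 2))%:~R :> rat.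
  rewrite D35; transitivity (- (3 * D%:~R ^+ 3 * b%:~R * (b%:~R + 2)) : rat); last by ring.
  by field.
have [|W1 [W2 [W3 [W4 [e1 e2 e3 e4]]]]] := scaled_quartic D0 hp hq hr h12 h13 h14 h23 h24 h34.
  by move=> w /h e; rewrite -[RHS]e; ring.
pose F := 32 * 3 * 5 ^+ 3 * 7 ^+ 4 * b * (b - 5).
have F0 : F != 0 by rewrite /F !mulf_neq0 // subr_eq0.
have [z zE] : exists z, z ^+ 2 = 15 * b * (b - 14).
  have q2E : (- (8 * (D ^+ 2 * b * M))) ^+ 2 = (8 * D ^+ 2 * b) ^+ 2 * (8 * b + 9).
    by rewrite -Mb; ring.
  apply: (quartic_square F0 e1 (p := - (2 * 3 * 7 * D) * b) _ _ e4 q2E).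
  - by rewrite e2; ring.
  - by rewrite e3; ring.
  have -> : - (3 * D ^+ 3 * b * (1 * b + 2)) = - (3 * D ^+ 3) * b * (b + 2) by ring.
  by rewrite DE; exact: quartic9_disc.
have D4 : D = 8 * 4 + 3 by rewrite DE.
have Do : exists k, D = 2 * k + 1 by exists 17.
have uo : exists k, 3 * 7 * D = 2 * k + 1 by apply: odd_mulz => //; exists 10.
have D2o : exists k, D ^+ 2 = 2 * k + 1 by rewrite expr2; apply: odd_mulz.
apply: (@quartic9_int_False W1 W2 W3 W4 b M (3 * 7 * D) (D ^+ 2) z Mo uo D2o b0 e1 _ _
  (3 * D ^+ 3) (192 * 4 ^+ 3 + 216 * 4 ^+ 2 + 81 * 4 + 10)).
- by rewrite e2; ring.
- exact: e3.
- by rewrite D4; ring.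
- by rewrite e4; ring.
- exact: zE.
Qed.

(** * The quintic for m = 10 *)

Lemma val3_ex (x : int) : x != 0 -> exists (a : nat) (y : int), x = 3 ^+ a * y /\ ~~ (3 %| y)%Z.
Proof.
move=> x0; have [|k [t []]] := @primitive_seq 3 [:: x] isT; first by rewrite /= andbT.
case: t => [//|y [|//]] [xE]; rewrite /= andbT => y3.
by exists k, y.
Qed.

Lemma val3_inj (a b : nat) (x y : int) : 3 ^+ a * x = 3 ^+ b * y ->
  ~~ (3 %| x)%Z -> ~~ (3 %| y)%Z -> a = b.
Proof.
have lt (c d : nat) (u v : int) : (c < d)%N -> 3 ^+ c * u = 3 ^+ d * v -> (3 %| u)%Z.
  move=> cd; have -> : 3 ^+ d = 3 ^+ c * (3 * 3 ^+ (d - c.+1)) :> int.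
    by rewrite -exprS -exprD addnS -addSn subnKC.
  move=> e; have /(mulfI (expf_neq0 c (isT : 3 != 0 :> int))) -> : 3 ^+ c * u = 3 ^+ c * (3 * 3 ^+ (d - c.+1) * v).
    by rewrite e; ring.
  by rewrite -mulrA dvdz_mulr.
move=> e x3 y3; case: (ltngtP a b) => // ab.
  by move: x3; rewrite (lt _ _ _ _ ab e).
by move: y3; rewrite (lt _ _ _ _ ab (esym e)).
Qed.

Lemma ndvd3P (x : int) : ~~ (3 %| x)%Z -> exists k e, x = 3 * k + e /\ (e = 1 \/ e = -1).
Proof.
have [k [r [-> h]]] := mod3P x; case: h => [->|h _]; last by exists k, r.
by rewrite addr0 dvdz_mulr.
Qed.

Lemma ndvd3M (x y : int) : ~~ (3 %| x)%Z -> ~~ (3 %| y)%Z -> ~~ (3 %| x * y)%Z.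
Proof.
move=> /ndvd3P[k [e [-> he]]] /ndvd3P[j [f [-> hf]]]; apply/negP => /dvdzP[l].
by move: he hf; clear; case=> ->; case=> ->; lia.
Qed.

Lemma ndvd3X (x : int) n : ~~ (3 %| x)%Z -> ~~ (3 %| x ^+ n)%Z.
Proof. by move=> h; elim: n => [//|n IH]; rewrite exprS; exact: ndvd3M. Qed.

(* The four roots divisible by 3 satisfy T^4 ~ P up to a 3-adic unit, hence share one valuation
   a with 4 a = v(P); then the sum of their squares has valuation exactly 2 a, while Vieta forces
   it to be divisible by P. *)
Lemma quintic_esym_False (t1 t2 t3 t4 T5 P u5 f2 f3 f4 : int) :
  let T1 := 3 * t1 in let T2 := 3 * t2 in let T3 := 3 * t3 in let T4 := 3 * t4 in
  P != 0 -> ~~ (3 %| T5)%Z -> ~~ (3 %| u5)%Z ->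
  8 * ((T1 * T2 + T1 * T3 + T1 * T4 + T2 * T3 + T2 * T4 + T3 * T4) + (T1 + T2 + T3 + T4) * T5) = P * f2 ->
  8 * ((T1 * T2 * T3 + T1 * T2 * T4 + T1 * T3 * T4 + T2 * T3 * T4) +
     (T1 * T2 + T1 * T3 + T1 * T4 + T2 * T3 + T2 * T4 + T3 * T4) * T5) = P * f3 ->
  8 * (T1 * T2 * T3 * T4 + (T1 * T2 * T3 + T1 * T2 * T4 + T1 * T3 * T4 + T2 * T3 * T4) * T5) = P * f4 ->
  8 * (T1 * T2 * T3 * T4 * T5) = P * u5 -> False.
Proof.
move=> T1 T2 T3 T4 P0 T53 u53.
set S1 := T1 + T2 + T3 + T4; set S2 := T1 * T2 + _ + _ + _ + _ + _; set S3 := T1 * T2 * T3 + _ + _ + _.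
set S4 := T1 * T2 * T3 * T4 => h2 h3 h4 h5.
(* Elimination of T5 from the top degree down: up to the 3-adic units 8 T5^i, each symmetric
   function of the four other roots is a multiple of P. *)
have {}h5 : 8 * T5 * S4 = P * u5 by rewrite -h5; ring.
have {}h4 : 8 * T5 ^+ 2 * S3 = P * (T5 * f4 - u5).
  by transitivity (T5 * (P * f4) - P * u5); [rewrite -h4 -h5; ring|ring].
have {}h3 : 8 * T5 ^+ 3 * S2 = P * (T5 ^+ 2 * f3 - (T5 * f4 - u5)).
  by transitivity (T5 ^+ 2 * (P * f3) - P * (T5 * f4 - u5)); [rewrite -h3 -h4; ring|ring].
have {}h2 : 8 * T5 ^+ 4 * S1 = P * (T5 ^+ 3 * f2 - (T5 ^+ 2 * f3 - (T5 * f4 - u5))).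
  by transitivity (T5 ^+ 3 * (P * f2) - P * (T5 ^+ 2 * f3 - (T5 * f4 - u5))); [rewrite -h2 -h3; ring|ring].
set g3 := T5 * f4 - u5 in h4 h3 h2; set g2 := T5 ^+ 2 * f3 - g3 in h3 h2; set g1 := _ - g2 in h2.
have [e [P' [PE P'3]]] := val3_ex P0.
have val t : (3 * t) ^+ 4 = S1 * (3 * t) ^+ 3 - S2 * (3 * t) ^+ 2 + S3 * (3 * t) - S4 ->
    exists (a : nat) y, [/\ (4 * a.+1 = e)%N, 3 * t = 3 ^+ a.+1 * y & ~~ (3 %| y)%Z].
  (* 8 T5^4 times the quartic equation reads 8 T5^4 (3 t)^4 = P v, and v is prime to 3 since it is -
     T5^3 u5 modulo 3. *)
  move=> rt; pose v := 3 * (g1 * 9 * t ^+ 3 - T5 * g2 * 3 * t ^+ 2 + T5 ^+ 2 * g3 * t) - T5 ^+ 3 * u5.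
  have v3 : ~~ (3 %| v)%Z.
    have /ndvd3P[k [s [kE hs]]] := ndvd3M (ndvd3X 3 T53) u53.
    rewrite /v kE; apply/negP => /dvdzP[l]; move: (_ + T5 ^+ 2 * g3 * t) hs => w; clear.
    by case=> ->; lia.
  have E : 8 * T5 ^+ 4 * (3 * t) ^+ 4 = P * v.
    rewrite rt; transitivity ((8 * T5 ^+ 4 * S1) * (3 * t) ^+ 3 - T5 * (8 * T5 ^+ 3 * S2) * (3 * t) ^+ 2
      + T5 ^+ 2 * (8 * T5 ^+ 2 * S3) * (3 * t) - T5 ^+ 3 * (8 * T5 * S4)); first by ring.
    by rewrite h2 h3 h4 h5 /v; ring.
  have t0 : t != 0.
    apply/negP => /eqP t0; have : 8 * T5 ^+ 4 * (3 * t) ^+ 4 = 0 by rewrite t0; ring.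
    by rewrite E => /eqP; rewrite mulf_eq0 (negPf P0) /= => /eqP v0; move: v3; rewrite v0.
  have [a [y [tE y3]]] := val3_ex t0.
  exists a, y; split=> //; last by rewrite tE exprS mulrA.
  apply: (@val3_inj _ _ (8 * T5 ^+ 4 * y ^+ 4) (P' * v)).
  - transitivity (P * v); last by rewrite PE mulrA.
    have -> : 3 ^+ (4 * a.+1) = (3 * 3 ^+ a) ^+ 4 :> int by rewrite -exprS -exprM mulnC.
    by rewrite -E tE; ring.
  - by rewrite !ndvd3M ?ndvd3X.
  - by rewrite ndvd3M.
have [a [y1 [ae T1E y13]]] := val t1 ltac:(rewrite /S1 /S2 /S3 /S4 /T1 /T2 /T3 /T4; ring).
have [a2 [y2 [ae2 T2E y23]]] := val t2 ltac:(rewrite /S1 /S2 /S3 /S4 /T1 /T2 /T3 /T4; ring).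
have [a3 [y3 [ae3 T3E y33]]] := val t3 ltac:(rewrite /S1 /S2 /S3 /S4 /T1 /T2 /T3 /T4; ring).
have [a4 [y4 [ae4 T4E y43]]] := val t4 ltac:(rewrite /S1 /S2 /S3 /S4 /T1 /T2 /T3 /T4; ring).
have E2 : a2 = a by move: ae ae2; clear; lia.
have E3 : a3 = a by move: ae ae3; clear; lia.
have E4 : a4 = a by move: ae ae4; clear; lia.
rewrite E2 in T2E; rewrite E3 in T3E; rewrite E4 in T4E.
set z := 3 ^+ a.+1 in T1E T2E T3E T4E.
have z0 : z != 0 by rewrite expf_neq0.
have Pz : P = z ^+ 4 * P' by rewrite PE -ae /z -exprM mulnC.
have sq : z ^+ 2 * (y1 ^+ 2 + y2 ^+ 2 + y3 ^+ 2 + y4 ^+ 2) = S1 ^+ 2 - 2 * S2.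
  transitivity ((z * y1) ^+ 2 + (z * y2) ^+ 2 + (z * y3) ^+ 2 + (z * y4) ^+ 2); first by ring.
  by rewrite -T1E -T2E -T3E -T4E /S1 /S2 /T1 /T2 /T3 /T4; ring.
have sqE : 64 * T5 ^+ 8 * (y1 ^+ 2 + y2 ^+ 2 + y3 ^+ 2 + y4 ^+ 2) =
    z ^+ 2 * (P' * (P * g1 ^+ 2 - 16 * T5 ^+ 5 * g2)).
  apply: (mulfI (expf_neq0 2 z0)); transitivity (64 * T5 ^+ 8 * (S1 ^+ 2 - 2 * S2)); first by rewrite -sq; ring.
  transitivity ((8 * T5 ^+ 4 * S1) ^+ 2 - 16 * T5 ^+ 5 * (8 * T5 ^+ 3 * S2)); first by ring.
  by rewrite h2 h3 {2}Pz {1}expr2 {1}Pz; ring.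
have : (3 %| 64 * T5 ^+ 8 * (y1 ^+ 2 + y2 ^+ 2 + y3 ^+ 2 + y4 ^+ 2))%Z.
  have zE : z = 3 * 3 ^+ a by rewrite /z exprS.
  by rewrite sqE [z ^+ 2]expr2 {1}zE -!mulrA; exact: dvdz_mulr.
apply/negP; apply: ndvd3M; first by apply: ndvd3M => //; exact: ndvd3X.
have sq1 y : ~~ (3 %| y)%Z -> exists k, y ^+ 2 = 3 * k + 1.
  by move=> /ndvd3P[k [s [-> [->|->]]]]; [exists (3 * k ^+ 2 + 2 * k)|exists (3 * k ^+ 2 - 2 * k)]; ring.
have [k1 ->] := sq1 _ y13; have [k2 ->] := sq1 _ y23; have [k3 ->] := sq1 _ y33; have [k4 ->] := sq1 _ y43.
by apply/negP => /dvdzP[l]; clear; lia.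
Qed.

Definition esym2 (R : comNzRingType) (a b c d e : R) : R :=
  (a * b + a * c + a * d + b * c + b * d + c * d) + (a + b + c + d) * e.
Definition esym3 (R : comNzRingType) (a b c d e : R) : R :=
  (a * b * c + a * b * d + a * c * d + b * c * d) + (a * b + a * c + a * d + b * c + b * d + c * d) * e.
Definition esym4 (R : comNzRingType) (a b c d e : R) : R :=
  a * b * c * d + (a * b * c + a * b * d + a * c * d + b * c * d) * e.

(* All Z_i but the last being 1 mod 3, the translates Z_i + 35 satisfy quintic_esym_False with P = 3 h. *)
Lemma quintic10_residual (Z1 Z2 Z3 Z4 Z5 h c z1 z2 z3 z4 D : int) :
  D = 35 -> h != 0 -> 8 * c = h * (27 * h + 10) ->
  let b := 1 + 9 * c in let M := 5 + 27 * h in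
  Z1 + Z2 + Z3 + Z4 + Z5 = 0 ->
  esym2 Z1 Z2 Z3 Z4 Z5 = - 10 * D ^+ 2 * b ->
  esym3 Z1 Z2 Z3 Z4 Z5 = 4 * D ^+ 3 * b * M ->
  esym4 Z1 Z2 Z3 Z4 Z5 = - 15 * D ^+ 3 * b * (33 * b + 2) ->
  3 * (Z1 * Z2 * Z3 * Z4 * Z5) = 4 * D ^+ 4 * b * M * (19 * b + 2) ->
  Z1 = 3 * z1 + 1 -> Z2 = 3 * z2 + 1 -> Z3 = 3 * z3 + 1 -> Z4 = 3 * z4 + 1 -> False.
Proof.
move=> DE h0 hc b M e1 e2 e3 e4 e5 Z1E Z2E Z3E Z4E.
(* At h = 0, that is b = 1 and M = 5, the polynomial with roots Z / 35 is (w + 1)^4 (w - 4).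
   Translating by 35 moves its fourfold root to 0, so all elementary symmetric functions of the
   translates except the first become multiples of h. *)
have DZ Z z : Z = 3 * z + 1 -> Z + D = 3 * (z + 12) by move=> ->; rewrite DE; ring.
have D4 : D ^+ 4 = 35 * D ^+ 3 by rewrite exprS {1}DE.
have D5 : D ^+ 5 = 35 * D ^+ 4 by rewrite exprS {1}DE.
have D3 : ~~ (3 %| D)%Z by rewrite DE.
pose s := - 3630 * h - 65 * 459 * (h * c) + 2870 * c + 16 * 1026 * c ^+ 2.
have P0 : 3 * h != 0 by rewrite mulf_neq0.
have T53 : ~~ (3 %| Z5 + D)%Z.
  apply/negP => /dvdzP[k kE]; move: e1 kE; rewrite Z1E Z2E Z3E Z4E DE; clear; lia.
have u53 : ~~ (3 %| D ^+ 4 * (9 * s - 4))%Z.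
  apply: ndvd3M; first exact: ndvd3X.
  by apply/negP => /dvdzP[k]; clear; lia.
have Z5E : Z5 = - (Z1 + Z2 + Z3 + Z4) by rewrite -[RHS]add0r -e1; ring.
(* The unit and the three factors are 8 times the symmetric functions of the translates divided by 3
   h, where 8 c = h (27 h + 10) exhibits the factor h. *)
have := @quintic_esym_False (z1 + 12) (z2 + 12) (z3 + 12) (z4 + 12) (Z5 + D) (3 * h) (D ^+ 4 * (9 * s - 4))
  (- 30 * D ^+ 2 * (27 * h + 10)) (D ^+ 3 * (288 - 30 * (27 * h + 10) + 324 * h * (27 * h + 10)))
  (D ^+ 3 * (- 2010 * (27 * h + 10) - 81 * 165 * c * (27 * h + 10) + 2520 * 8 * b)).
rewrite /= -(DZ _ _ Z1E) -(DZ _ _ Z2E) -(DZ _ _ Z3E) -(DZ _ _ Z4E).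
apply=> //.
- transitivity (8 * (esym2 Z1 Z2 Z3 Z4 Z5 + 4 * D * (Z1 + Z2 + Z3 + Z4 + Z5) + 10 * D ^+ 2)).
    by rewrite /esym2; ring.
  rewrite e1 e2 /b; transitivity (- 90 * D ^+ 2 * (8 * c)); first by ring.
  by rewrite hc; ring.
- transitivity (8 * (esym3 Z1 Z2 Z3 Z4 Z5 + 3 * D * esym2 Z1 Z2 Z3 Z4 Z5
    + 6 * D ^+ 2 * (Z1 + Z2 + Z3 + Z4 + Z5) + 10 * D ^+ 3)).
    by rewrite /esym3 /esym2; ring.
  rewrite e1 e2 e3 /b /M; transitivity (D ^+ 3 * (864 * h - 90 * (8 * c) + 972 * (8 * c) * h)); first by ring.
  by rewrite hc; ring.
- transitivity (8 * (esym4 Z1 Z2 Z3 Z4 Z5 + 2 * D * esym3 Z1 Z2 Z3 Z4 Z5 + 3 * D ^+ 2 * esym2 Z1 Z2 Z3 Z4 Z5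
    + 4 * D ^+ 3 * (Z1 + Z2 + Z3 + Z4 + Z5) + 5 * D ^+ 4)).
    by rewrite /esym4 /esym3 /esym2; ring.
  rewrite e1 e2 e3 e4.
  transitivity (8 * (- 15 * D ^+ 3 * b * (33 * b + 2) + D ^+ 4 * (8 * b * M - 30 * b + 5))); first by ring.
  rewrite D4; transitivity (D ^+ 3 * (- 6030 * (8 * c) - 81 * 495 * c * (8 * c) + 7560 * 8 * b * h)).
    by rewrite /b /M; ring.
  by rewrite hc; ring.
- apply: (@mulfI _ (3 : int) isT).
  transitivity (8 * (3 * (Z1 * Z2 * Z3 * Z4 * Z5) + 3 * D * esym4 Z1 Z2 Z3 Z4 Z5 + 3 * D ^+ 2 * esym3 Z1 Z2 Z3 Z4 Z5
    + 3 * D ^+ 3 * esym2 Z1 Z2 Z3 Z4 Z5 + 3 * D ^+ 4 * (Z1 + Z2 + Z3 + Z4 + Z5) + 3 * D ^+ 5)).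
    by rewrite /esym4 /esym3 /esym2; ring.
  rewrite e1 e2 e3 e4 e5.
  transitivity (8 * (D ^+ 4 * (4 * b * M * (19 * b + 2) - 45 * b * (33 * b + 2))
    + D ^+ 5 * (12 * b * M - 30 * b + 3))).
    by ring.
  rewrite D5.
  transitivity (D ^+ 4 * (8 * (4 * b * M * (19 * b + 2) - 45 * b * (33 * b + 2) + 35 * (12 * b * M - 30 * b + 3)))).
    by ring.
  rewrite (_ : 8 * (4 * b * M * (19 * b + 2) - 45 * b * (33 * b + 2) + 35 * (12 * b * M - 30 * b + 3))
    = - 36 * h + 81 * (h * s)).
    by ring.
  have hc2 : 8 * c * c = h * (27 * h + 10) * c by rewrite hc.
  by rewrite /s /b /M; move: hc hc2; clear; lia.
Qed.

(* The Z_i are the numbers 35 w, w a root of the depressed polynomial for m = 10, and b is a third of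
   the b occurring there. *)
Record quintic10 (D b M Z1 Z2 Z3 Z4 Z5 : int) : Prop := Quintic10 {
  q10_D : D = 35;
  q10_M : M ^+ 2 = 24 * b + 1;
  q10_1 : Z1 + Z2 + Z3 + Z4 + Z5 = 0;
  q10_2 : esym2 Z1 Z2 Z3 Z4 Z5 = - 10 * D ^+ 2 * b;
  q10_3 : esym3 Z1 Z2 Z3 Z4 Z5 = 4 * D ^+ 3 * b * M;
  q10_4 : esym4 Z1 Z2 Z3 Z4 Z5 = - 15 * D ^+ 3 * b * (33 * b + 2);
  q10_5 : 3 * (Z1 * Z2 * Z3 * Z4 * Z5) = 4 * D ^+ 4 * b * M * (19 * b + 2) }.

Lemma quintic10_root D b M Z1 Z2 Z3 Z4 Z5 : quintic10 D b M Z1 Z2 Z3 Z4 Z5 ->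
  forall Z, Z \in [:: Z1; Z2; Z3; Z4; Z5] ->
  3 * Z ^+ 5 = b * (30 * D ^+ 2 * Z ^+ 3 + 12 * D ^+ 3 * M * Z ^+ 2 + 45 * D ^+ 3 * (33 * b + 2) * Z
    + 4 * D ^+ 4 * M * (19 * b + 2)).
Proof.
case=> _ _ e1 e2 e3 e4 e5 Z hZ.
have : Z ^+ 5 - (Z1 + Z2 + Z3 + Z4 + Z5) * Z ^+ 4 + esym2 Z1 Z2 Z3 Z4 Z5 * Z ^+ 3 - esym3 Z1 Z2 Z3 Z4 Z5 * Z ^+ 2
    + esym4 Z1 Z2 Z3 Z4 Z5 * Z - Z1 * Z2 * Z3 * Z4 * Z5 = 0.
  by move: hZ; rewrite !inE => /or4P[||| /orP[]] /eqP ->; rewrite /esym2 /esym3 /esym4; ring.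
rewrite e1 e2 e3 e4 => h.
transitivity (3 * (Z1 * Z2 * Z3 * Z4 * Z5) + b * (30 * D ^+ 2 * Z ^+ 3 + 12 * D ^+ 3 * M * Z ^+ 2
  + 45 * D ^+ 3 * (33 * b + 2) * Z)); last by rewrite e5; ring.
by rewrite -[LHS]subr0 -[X in _ - X](mulr0 3) -h; ring.
Qed.

Lemma quintic10_perm D b M Z1 Z2 Z3 Z4 Z5 : quintic10 D b M Z1 Z2 Z3 Z4 Z5 ->
  [/\ quintic10 D b M Z5 Z2 Z3 Z4 Z1, quintic10 D b M Z1 Z5 Z3 Z4 Z2, quintic10 D b M Z1 Z2 Z5 Z4 Z3 &
      quintic10 D b M Z1 Z2 Z3 Z5 Z4].
Proof.
case=> hD hM e1 e2 e3 e4 e5.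
by split; split=> //; rewrite -?e1 -?e2 -?e3 -?e4 -?e5 /esym2 /esym3 /esym4; ring.
Qed.

Lemma quintic10_opp D b M Z1 Z2 Z3 Z4 Z5 : quintic10 D b M Z1 Z2 Z3 Z4 Z5 ->
  quintic10 D b (- M) (- Z1) (- Z2) (- Z3) (- Z4) (- Z5).
Proof.
case=> hD hM e1 e2 e3 e4 e5; split=> //.
- by rewrite sqrrN.
- by rewrite -[RHS]oppr0 -e1; ring.
- by rewrite -e2 /esym2; ring.
- by transitivity (- esym3 Z1 Z2 Z3 Z4 Z5); [rewrite /esym3; ring|rewrite e3; ring].
- by rewrite -e4 /esym4; ring.
- by transitivity (- (3 * (Z1 * Z2 * Z3 * Z4 * Z5))); [ring|rewrite e5; ring].
Qed.

(** By [q10_5] the number 3 divides b or 19 b + 2, since M and D are prime to 3; the second means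
    that b is 1 modulo 3. *)
Lemma quintic10_mod3 D b M Z1 Z2 Z3 Z4 Z5 : quintic10 D b M Z1 Z2 Z3 Z4 Z5 ->
  ~~ (3 %| M)%Z /\ ((exists c, b = 3 * c) \/ exists c, b = 3 * c + 1).
Proof.
case=> hD hM _ _ _ _ e5.
have M3 : ~~ (3 %| M)%Z by apply/negP => /dvdzP[k kE]; move: hM; rewrite kE; clear; lia.
split=> //; have [c [r [bE h]]] := mod3P b; case: h => [r0|[r1|r1]].
- by left; exists c; rewrite bE r0 addr0.
- by right; exists c; rewrite bE r1.
exfalso; have D3 : ~~ (3 %| D)%Z by rewrite hD.
have : ~~ (3 %| 4 * D ^+ 4 * b * M * (19 * b + 2))%Z.
  rewrite bE r1; apply: ndvd3M; [apply: ndvd3M => //; apply: ndvd3M; [apply: ndvd3M => //; exact: ndvd3X|]|];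
  by apply/negP => /dvdzP[k]; clear; lia.
by rewrite -e5 dvdz_mulr.
Qed.

Lemma exp5_mod3 (x : int) : exists k, x ^+ 5 = x + 3 * k.
Proof.
have [q [r [-> h]]] := mod3P x.
exists (81 * q ^+ 5 + 135 * q ^+ 4 * r + 90 * q ^+ 3 * r ^+ 2 + 30 * q ^+ 2 * r ^+ 3 + 5 * q * r ^+ 4 - q).
by case: h => [->|[->|->]]; ring.
Qed.

(** Every root satisfies Z^5 = c (ka + 3 n) with ka prime to 3, so all roots have the same
    valuation. Their unit parts agree modulo 3 because y^5 = y there, and five equal nonzero
    residues do not add up to 0. *)
Lemma quintic10_dvd3_False D b M Z1 Z2 Z3 Z4 Z5 c : quintic10 D b M Z1 Z2 Z3 Z4 Z5 -> b != 0 ->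
  b = 3 * c -> False.
Proof.
move=> H b0 bc; have [M3 _] := quintic10_mod3 H; have root := quintic10_root H.
have D3 : ~~ (3 %| D)%Z by rewrite (q10_D H).
have c0 : c != 0 by apply: contra b0 => /eqP e; rewrite bc e mulr0.
have [j [c' [cE c3]]] := val3_ex c0.
pose ka := 4 * D ^+ 4 * M * (19 * b + 2).
have ka3 : ~~ (3 %| ka)%Z.
  apply: ndvd3M; first by apply: ndvd3M => //; apply: ndvd3M => //; exact: ndvd3X.
  by rewrite bc; apply/negP => /dvdzP[k]; clear; lia.
have val Z : Z \in [:: Z1; Z2; Z3; Z4; Z5] ->
    exists a y m, [/\ (5 * a)%N = j, Z = 3 ^+ a * y & y = c' * ka + 3 * m].
  move=> /root e; pose n := 10 * D ^+ 2 * Z ^+ 3 + 4 * D ^+ 3 * M * Z ^+ 2 + 15 * D ^+ 3 * (33 * b + 2) * Z.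
  have {}e : Z ^+ 5 = c * (ka + 3 * n).
    by apply: (@mulfI _ (3 : int) isT); rewrite e {1}bc /ka /n; ring.
  have n3 : ~~ (3 %| ka + 3 * n)%Z.
    have [k [s [kE hs]]] := ndvd3P ka3; apply/negP => /dvdzP[l]; rewrite kE; move: hs; clear.
    by case=> ->; lia.
  have Z0 : Z != 0.
    apply/negP => /eqP Z0; move: e; rewrite Z0 expr0n /= => /esym/eqP; rewrite mulf_eq0 (negPf c0) /= => /eqP e.
    by move: n3; rewrite e.
  have [a [y [ZE y3]]] := val3_ex Z0.
  have e' : 3 ^+ (5 * a) * y ^+ 5 = 3 ^+ j * (c' * (ka + 3 * n)).
    by rewrite [RHS]mulrA -cE -e ZE exprMn -exprM mulnC.
  have aj : (5 * a)%N = j by apply: (val3_inj e'); [exact: ndvd3X|exact: ndvd3M].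
  have [k kE] := exp5_mod3 y.
  exists a, y, (c' * n - k); split=> //.
  rewrite aj in e'; have {}e' := mulfI (expf_neq0 j (isT : 3 != 0 :> int)) e'.
  by rewrite -[LHS](addrK (3 * k)) -kE e'; ring.
have [a [y1 [m1 [aj E1 h1]]]] := val Z1 ltac:(by rewrite !inE eqxx).
have [a2 [y2 [m2 [aj2 E2 h2]]]] := val Z2 ltac:(by rewrite !inE eqxx ?orbT).
have [a3 [y3 [m3 [aj3 E3 h3]]]] := val Z3 ltac:(by rewrite !inE eqxx ?orbT).
have [a4 [y4 [m4 [aj4 E4 h4]]]] := val Z4 ltac:(by rewrite !inE eqxx ?orbT).
have [a5 [y5 [m5 [aj5 E5 h5]]]] := val Z5 ltac:(by rewrite !inE eqxx ?orbT).
have aE i : (5 * i)%N = j -> i = a by move: aj; clear; lia.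
rewrite (aE _ aj2) in E2; rewrite (aE _ aj3) in E3; rewrite (aE _ aj4) in E4; rewrite (aE _ aj5) in E5.
have s : y1 + y2 + y3 + y4 + y5 = 0.
  apply: (mulfI (expf_neq0 a (isT : 3 != 0 :> int))).
  by rewrite mulr0 -[RHS](q10_1 H) E1 E2 E3 E4 E5; ring.
have [k [r [kE hr]]] := ndvd3P (ndvd3M c3 ka3).
by move: s hr; rewrite h1 h2 h3 h4 h5 kE; clear => s; case=> rE; move: s; rewrite rE; lia.
Qed.

(** Modulo 3 the equation reduces to Z^2 = n for every root. The residue n = -1 is not a square, and
    n = 0 contradicts the second symmetric function. So n = 1 and all roots are 1 or -1; their sum
    and product leave exactly one root equal to -1, which is permuted to the last place for
    [quintic10_residual]. *)
Lemma quintic10_mod3_False D b M Z1 Z2 Z3 Z4 Z5 q k : quintic10 D b M Z1 Z2 Z3 Z4 Z5 -> M ^+ 2 != 25 ->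
  b = 3 * q + 1 -> M = 3 * k - 1 -> False.
Proof.
move=> H M25 bq Mk; have root := quintic10_root H.
pose n := 19 * q + 7; have nE : 19 * b + 2 = 3 * n by rewrite bq /n; ring.
have DE := q10_D H.
have e5 : Z1 * Z2 * Z3 * Z4 * Z5 = 4 * D ^+ 4 * b * M * n.
  by apply: (@mulfI _ (3 : int) isT); rewrite (q10_5 H) nE; ring.
have D2 : D ^+ 2 = 3 * 408 + 1 by rewrite DE.
have [x4 hx4] : exists x, D ^+ 4 = 3 * x + 1.
  by exists (3 * 408 ^+ 2 + 2 * 408); rewrite (exprM D 2 2) D2; ring.
have [x3 hx3] : exists x, D ^+ 3 = 3 * x - 1.
  exists (D * 408 + 12); rewrite exprS D2 mulrDr mulr1 {2}DE; ring.
have c5 : exists y, 4 * D ^+ 4 * b * M = 3 * y - 1.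
  exists (4 * (3 * x4 * q * (3 * k - 1) + x4 * (3 * k - 1) + q * (3 * k - 1) + k) - 1).
  by rewrite hx4 bq Mk; ring.
have c2 : exists y, 10 * D ^+ 2 * b = 3 * y + 1.
  by exists (10 * (3 * 408 * q + 408 + q) + 3); rewrite D2 bq; ring.
have c3 : exists y, 4 * D ^+ 3 * b * M = 3 * y + 1.
  exists (4 * (3 * x3 * q * (3 * k - 1) + x3 * (3 * k - 1) - q * (3 * k - 1) - k) + 1).
  by rewrite hx3 bq Mk; ring.
case: c5 c2 c3 => [y5 hy5] [y2 hy2] [y3 hy3].
have res Z : Z \in [:: Z1; Z2; Z3; Z4; Z5] -> exists z r u, [/\ Z = 3 * z + r, (r = 0 \/ r = 1 \/ r = -1) &
    n = r ^+ 2 + 3 * u].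
  move=> /root e; have [z [r [Zz hr]]] := mod3P Z; exists z, r.
  have {}e : Z ^+ 5 = (3 * y2 + 1) * Z ^+ 3 + (3 * y3 + 1) * Z ^+ 2 + 15 * D ^+ 3 * b * (33 * b + 2) * Z
      + (3 * y5 - 1) * n.
    by apply: (@mulfI _ (3 : int) isT); rewrite e -hy2 -hy3 -hy5 nE; ring.
  have [f fE] := exp5_mod3 Z.
  have [g gE] : exists g, Z ^+ 3 = Z + 3 * g.
    exists (9 * z ^+ 3 + 9 * z ^+ 2 * r + 3 * z * r ^+ 2 - z); rewrite Zz.
    by case: hr => [->|[->|->]]; ring.
  exists (y2 * Z ^+ 3 + y3 * Z ^+ 2 + 5 * D ^+ 3 * b * (33 * b + 2) * Z + y5 * n + g - f
    + 3 * z ^+ 2 + 2 * z * r); split=> //.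
  transitivity (Z ^+ 3 - Z ^+ 5 + Z ^+ 2
    + 3 * (y2 * Z ^+ 3 + y3 * Z ^+ 2 + 5 * D ^+ 3 * b * (33 * b + 2) * Z + y5 * n)).
    by rewrite e; ring.
  by rewrite fE {1}gE Zz; ring.
have [z1 [r1 [u1 [E1 h1 n1]]]] := res Z1 ltac:(by rewrite !inE eqxx).
have [z2 [r2 [u2 [E2 h2 n2]]]] := res Z2 ltac:(by rewrite !inE eqxx ?orbT).
have [z3 [r3 [u3 [E3 h3 n3]]]] := res Z3 ltac:(by rewrite !inE eqxx ?orbT).
have [z4 [r4 [u4 [E4 h4 n4]]]] := res Z4 ltac:(by rewrite !inE eqxx ?orbT).
have [z5 [r5 [u5 [E5 h5 n5]]]] := res Z5 ltac:(by rewrite !inE eqxx ?orbT).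
have [n' [s [nE' hs]]] := mod3P n.
have hn1 : s = 1.
  case: hs => [s0|[//|s1]]; last by exfalso; move: n1; rewrite nE' s1; case: h1 => [->|[->|->]]; clear; lia.
  have z r u : n = r ^+ 2 + 3 * u -> r = 0 \/ r = 1 \/ r = -1 -> r = 0.
    by rewrite nE' s0 => h [|[|]] // rE; exfalso; move: h; rewrite rE; clear; lia.
  have e2 := q10_2 H; exfalso; move: e2.
  rewrite /esym2 E1 E2 E3 E4 E5 (z _ _ n1 h1) (z _ _ n2 h2) (z _ _ n3 h3) (z _ _ n4 h4) (z _ _ n5 h5).
  by rewrite !mulNr hy2; clear; lia.
have pm r u : n = r ^+ 2 + 3 * u -> r = 0 \/ r = 1 \/ r = -1 -> r = 1 \/ r = -1.
  by rewrite nE' hn1 => h [rE|]; [exfalso; move: h; rewrite rE; clear; lia|].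
have {n1}h1 := pm _ _ n1 h1; have {n2}h2 := pm _ _ n2 h2; have {n3}h3 := pm _ _ n3 h3.
have {n4}h4 := pm _ _ n4 h4; have {n5}h5 := pm _ _ n5 h5.
have [c qE] : exists c, q = 3 * c by exists (n' - 6 * q - 2); move: nE'; rewrite /n hn1; clear; lia.
(* (M - 5) (M + 5) = 216 c, and M + 5 is prime to 3, so 27 divides M - 5. *)
have [h [MhE h0 hc]] : exists h, [/\ M = 5 + 27 * h, h != 0 & 8 * c = h * (27 * h + 10)].
  have e : (k - 2) * (3 * k + 4) = 72 * c.
    by have := q10_M H; rewrite Mk bq qE; clear; lia.
  have cr : coprimez (3 ^+ 2) (3 * k + 4).
    apply: coprimezXl; apply/coprimezP; exists (- k - 1, 1) => /=; ring.
  have : (3 ^+ 2 %| k - 2)%Z.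
    by rewrite -(Gauss_dvdzl _ cr) e; apply/dvdzP; exists (8 * c); ring.
  case/dvdzP => h hE; have MhE : M = 5 + 27 * h by rewrite Mk; move: hE; clear; lia.
  exists h; split=> //.
    by apply: contra M25 => /eqP h0; rewrite MhE h0.
  have kE : k = 9 * h + 2 by move: hE; clear; lia.
  by apply: (@mulfI _ (9 : int) isT); transitivity (72 * c); [|rewrite -e hE kE]; ring.
have bE : b = 1 + 9 * c by rewrite bq qE; ring.
have fin Y1 Y2 Y3 Y4 Y5 y1' y2' y3' y4' : quintic10 D b M Y1 Y2 Y3 Y4 Y5 ->
    Y1 = 3 * y1' + 1 -> Y2 = 3 * y2' + 1 -> Y3 = 3 * y3' + 1 -> Y4 = 3 * y4' + 1 -> False.
  case=> _ _ f1 f2 f3 f4 f5 g1 g2 g3 g4; rewrite bE MhE in f2 f3 f4 f5.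
  exact: (quintic10_residual DE h0 hc f1 f2 f3 f4 f5 g1 g2 g3 g4).
have [H1 H2 H3 H4] := quintic10_perm H.
have e1 := q10_1 H; rewrite hy5 nE' hn1 in e5; rewrite E1 E2 E3 E4 E5 in e1 e5.
move: E1 E2 E3 E4 E5; move: h1 h2 h3 h4 h5 e1 e5.
case=> ->; case=> ->; case=> ->; case=> ->; case=> -> e1 e5 E1 E2 E3 E4 E5;
  try (by exfalso; move: e1; clear; lia); try (by exfalso; move: e5; clear; lia);
  first [exact: fin H E1 E2 E3 E4|exact: fin H4 E1 E2 E3 E5|exact: fin H3 E1 E2 E5 E4
        |exact: fin H2 E1 E5 E3 E4|exact: fin H1 E5 E2 E3 E4].
Qed.

Lemma quintic10_False D b M Z1 Z2 Z3 Z4 Z5 : quintic10 D b M Z1 Z2 Z3 Z4 Z5 -> b != 0 -> M ^+ 2 != 25 -> False.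
Proof.
move=> H b0 M25; have [M3 [[c bc]|[c bc]]] := quintic10_mod3 H; first exact: quintic10_dvd3_False H b0 bc.
have [k [e [ME he]]] := ndvd3P M3; case: he => he.
  by apply: (quintic10_mod3_False (quintic10_opp H) (q := c) (k := - k)) => //; rewrite ?sqrrN // ME he; ring.
by apply: (quintic10_mod3_False H (q := c) (k := k)) => //; rewrite ME he.
Qed.

Lemma quintic_vieta (F : fieldType) (p q r s a b c d e : F) :
  uniq [:: a; b; c; d; e] ->
  (forall x, x \in [:: a; b; c; d; e] -> x ^+ 5 + p * x ^+ 3 + q * x ^+ 2 + r * x + s = 0) ->
  [/\ a + b + c + d + e = 0, esym2 a b c d e = p, esym3 a b c d e = - q, esym4 a b c d e = r &
      a * b * c * d * e = - s].
Proof.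
rewrite /= !inE !negb_or -!(subr_eq0 _ b) -!(subr_eq0 _ c) -!(subr_eq0 _ d) -!(subr_eq0 _ e) !andbT.
move=> /and4P[/and4P[ab ac ad ae] /and3P[bc bd be] /andP[cd ce] de] h.
have ha := h a (mem_head _ _).
have h1 x : x \in [:: b; c; d; e] -> a - x != 0 ->
    a ^+ 4 + a ^+ 3 * x + a ^+ 2 * x ^+ 2 + a * x ^+ 3 + x ^+ 4 + p * (a ^+ 2 + a * x + x ^+ 2)
      + q * (a + x) + r = 0.
  move=> hx ax; have hx' := h x (mem_behead (s := [:: a; b; c; d; e]) hx).
  by apply: (mulfI ax); rewrite mulr0 -[RHS](subrr 0) -{1}ha -hx'; ring.
have hb := h1 b (mem_head _ _) ab.
have h2 x : x \in [:: c; d; e] -> a - x != 0 -> b - x != 0 ->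
    a ^+ 3 + b ^+ 3 + x ^+ 3 + a ^+ 2 * b + a ^+ 2 * x + b ^+ 2 * a + b ^+ 2 * x + x ^+ 2 * a + x ^+ 2 * b
      + a * b * x + p * (a + b + x) + q = 0.
  move=> hx ax bx; have hx' := h1 x (mem_behead (s := [:: b; c; d; e]) hx) ax.
  by apply: (mulfI bx); rewrite mulr0 -[RHS](subrr 0) -{1}hb -hx'; ring.
have hc := h2 c (mem_head _ _) ac bc.
have h3 x : x \in [:: d; e] -> a - x != 0 -> b - x != 0 -> c - x != 0 ->
    a ^+ 2 + b ^+ 2 + c ^+ 2 + x ^+ 2 + a * b + a * c + a * x + b * c + b * x + c * x + p = 0.
  move=> hx ax bx cx; have hx' := h2 x (mem_behead (s := [:: c; d; e]) hx) ax bx.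
  by apply: (mulfI cx); rewrite mulr0 -[RHS](subrr 0) -{1}hc -hx'; ring.
have hd := h3 d (mem_head _ _) ad bd cd.
have he := h3 e (mem_behead (s := [:: d; e]) (mem_head _ _)) ae be ce.
have sm : a + b + c + d + e = 0.
  by apply: (mulfI de); rewrite mulr0 -[RHS](subrr 0) -{1}hd -he; ring.
have eE : e = - (a + b + c + d) by rewrite -[RHS]add0r -sm; ring.
have pE : p = - (a ^+ 2 + b ^+ 2 + c ^+ 2 + d ^+ 2 + a * b + a * c + a * d + b * c + b * d + c * d).
  by rewrite -[RHS]add0r -hd; ring.
have qE : q = - (a ^+ 3 + b ^+ 3 + c ^+ 3 + a ^+ 2 * b + a ^+ 2 * c + b ^+ 2 * a + b ^+ 2 * c + c ^+ 2 * a
    + c ^+ 2 * b + a * b * c + p * (a + b + c)) by rewrite -[RHS]add0r -hc; ring.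
have rE : r = - (a ^+ 4 + a ^+ 3 * b + a ^+ 2 * b ^+ 2 + a * b ^+ 3 + b ^+ 4 + p * (a ^+ 2 + a * b + b ^+ 2)
    + q * (a + b)) by rewrite -[RHS]add0r -hb; ring.
have sE : s = - (a ^+ 5 + p * a ^+ 3 + q * a ^+ 2 + r * a) by rewrite -[RHS]add0r -ha; ring.
by split=> //; rewrite ?sE ?rE ?qE ?pE /esym2 /esym3 /esym4 eE; ring.
Qed.

Lemma dvd_fifth3 (x k : int) : x ^+ 5 = 3 * k -> exists y, x = 3 * y.
Proof. by have [j ->] := exp5_mod3 x => e; exists (k - j); move: e; clear; lia. Qed.

Lemma no_quintic10 (M b : int) (w1 w2 w3 w4 w5 : rat) :
  M ^+ 2 = 8 * b + 1 -> b != 0 -> b != 3 -> uniq [:: w1; w2; w3; w4; w5] ->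
  (forall w, w \in [:: w1; w2; w3; w4; w5] ->
     w ^+ 5 - 10 / 3 * b%:~R * w ^+ 3 - 4 / 3 * (b%:~R * M%:~R) * w ^+ 2
     - b%:~R * (11 * b%:~R + 2) / 7 * w - 4 / 945 * (b%:~R * M%:~R * (19 * b%:~R + 6)) = 0) -> False.
Proof.
move=> Mb b0 b3 uw h.
have [D DE] : exists D : int, D = 35 by exists 35.
have D0 : D%:~R != 0 :> rat by rewrite intr_eq0 DE.
have D7 : 7^-1 = 5 / D%:~R :> rat by rewrite DE; field.
have D945 : 4 / 945 = 4 / (27 * D%:~R) :> rat.
  have -> : 945 = 27 * D%:~R :> rat by rewrite DE; ring.
  by [].
pose p : rat := - (10 / 3 * D%:~R ^+ 2 * b%:~R); pose q : rat := - (4 / 3 * D%:~R ^+ 3 * b%:~R * M%:~R).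
pose r : rat := - (5 * D%:~R ^+ 3 * b%:~R * (11 * b%:~R + 2)).
pose s : rat := - (4 / 27 * D%:~R ^+ 4 * b%:~R * M%:~R * (19 * b%:~R + 6)).
have H w : w \in [:: w1; w2; w3; w4; w5] ->
    (D%:~R * w) ^+ 5 + p * (D%:~R * w) ^+ 3 + q * (D%:~R * w) ^+ 2 + r * (D%:~R * w) + s = 0.
  move=> /h; rewrite D7 D945 => e; rewrite -[RHS](mulr0 (D%:~R ^+ 5)) -e /p /q /r /s; field.
  exact: D0.
have int_root w : w \in [:: w1; w2; w3; w4; w5] -> exists Z : int, D%:~R * w = Z%:~R.
  move=> /H e; have [|Y YE] := @quintic_root_int (36 * D ^+ 4 * b * M * (19 * b + 6))
      (405 * D ^+ 3 * b * (11 * b + 2)) (36 * D ^+ 3 * b * M) (30 * D ^+ 2 * b) (3 * (D%:~R * w)).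
    by rewrite -[LHS]subr0 -[X in _ - X](mulr0 (3 ^+ 5)) -e /p /q /r /s; field.
  (* Y = 3 D w is an integer whose fifth power is divisible by 3, so D w is already an integer. *)
  have [k kE] : exists k, Y ^+ 5 = 3 * k.
    exists (10 * D ^+ 2 * b * Y ^+ 3 + 12 * D ^+ 3 * b * M * Y ^+ 2 + 135 * D ^+ 3 * b * (11 * b + 2) * Y
      + 12 * D ^+ 4 * b * M * (19 * b + 6)).
    apply: (@intr_inj rat); transitivity (Y%:~R ^+ 5 : rat); first by ring.
    transitivity (3 * (10 * D%:~R ^+ 2 * b%:~R * Y%:~R ^+ 3 + 12 * D%:~R ^+ 3 * b%:~R * M%:~R * Y%:~R ^+ 2
      + 135 * D%:~R ^+ 3 * b%:~R * (11 * b%:~R + 2) * Y%:~R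
      + 12 * D%:~R ^+ 4 * b%:~R * M%:~R * (19 * b%:~R + 6) : rat)); last by ring.
    by rewrite -YE -[LHS]subr0 -[X in _ - X](mulr0 (3 ^+ 5)) -e /p /q /r /s; field.
  have [Z ZE] := dvd_fifth3 kE; exists Z; apply: (@mulfI _ (3 : rat) isT).
  by rewrite YE ZE; ring.
have [Z1 E1] := int_root w1 (mem_head _ _).
have [Z2 E2] := int_root w2 ltac:(by rewrite !inE eqxx ?orbT).
have [Z3 E3] := int_root w3 ltac:(by rewrite !inE eqxx ?orbT).
have [Z4 E4] := int_root w4 ltac:(by rewrite !inE eqxx ?orbT).
have [Z5 E5] := int_root w5 ltac:(by rewrite !inE eqxx ?orbT).
have mapE : [seq D%:~R * w | w <- [:: w1; w2; w3; w4; w5]] = [:: Z1%:~R; Z2%:~R; Z3%:~R; Z4%:~R; Z5%:~R].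
  by rewrite /= E1 E2 E3 E4 E5.
have uZ : uniq [:: Z1%:~R; Z2%:~R; Z3%:~R; Z4%:~R; Z5%:~R : rat].
  by rewrite -mapE (map_inj_uniq (mulfI D0)); exact: uw.
have hZ z : z \in [:: Z1%:~R; Z2%:~R; Z3%:~R; Z4%:~R; Z5%:~R] -> z ^+ 5 + p * z ^+ 3 + q * z ^+ 2 + r * z + s = 0.
  by rewrite -mapE => /mapP[w /H e zE]; rewrite zE; exact: e.
have [e1 e2 e3 e4 e5] := quintic_vieta uZ hZ.
have {}e2 : 3 * esym2 Z1 Z2 Z3 Z4 Z5 = - (10 * D ^+ 2 * b).
  apply: (@intr_inj rat); transitivity (3 * p); last by rewrite /p; field.
  by rewrite -e2 /esym2; ring.
have {}e3 : 3 * esym3 Z1 Z2 Z3 Z4 Z5 = 4 * D ^+ 3 * b * M.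
  apply: (@intr_inj rat); transitivity (3 * - q); last by rewrite /q; field.
  by rewrite -e3 /esym3; ring.
have {}e4 : esym4 Z1 Z2 Z3 Z4 Z5 = - (5 * D ^+ 3 * b * (11 * b + 2)).
  apply: (@intr_inj rat); transitivity r; last by rewrite /r; ring.
  by rewrite -e4 /esym4; ring.
have {}e5 : 27 * (Z1 * Z2 * Z3 * Z4 * Z5) = 4 * D ^+ 4 * b * M * (19 * b + 6).
  apply: (@intr_inj rat); transitivity (27 * - s); last by rewrite /s; field.
  by rewrite -e5; ring.
have {}e1 : Z1 + Z2 + Z3 + Z4 + Z5 = 0.
  by apply: (@intr_inj rat); rewrite -[RHS]e1; ring.
(* The second symmetric function is an integer, so the denominator 3 in its value must cancel
   against b. *)
have [b1 bE] : exists c, b = 3 * c.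
  have D3 : ~~ (3 %| D)%Z by rewrite DE.
  have [|/ndvd3M h3] := boolP (3 %| b)%Z; first by case/dvdzP => c cE; exists c; rewrite cE mulrC.
  have := h3 _ (ndvd3M (isT : ~~ (3 %| 10)%Z) (ndvd3X 2 D3)).
  case/negP; apply/dvdzP; exists (- esym2 Z1 Z2 Z3 Z4 Z5).
  by rewrite mulrC -[LHS]opprK -e2; ring.
apply: (@quintic10_False D b1 M Z1 Z2 Z3 Z4 Z5); last first.
- by apply: contra b3 => /eqP; rewrite Mb bE; clear; lia.
- by apply: contra b0 => /eqP e; rewrite bE e mulr0.
rewrite bE in e2 e3 e4 e5 Mb; split.
- exact: DE.
- by rewrite Mb; ring.
- exact: e1.
- by apply: (@mulfI _ (3 : int) isT); rewrite e2; ring.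
- by apply: (@mulfI _ (3 : int) isT); rewrite e3; ring.
- by rewrite e4; ring.
- by apply: (@mulfI _ (9 : int) isT); transitivity (27 * (Z1 * Z2 * Z3 * Z4 * Z5)); [ring|rewrite e5; ring].
Qed.

(** * Depressing the Gegenbauer polynomials *)

Lemma gegenbauer_eq0_neq0 a m x : gegenbauer_eq0 a m x -> x != 0.
Proof.
apply: contra_eq_neq => ->; rewrite big_ord_recl expr0 mul1r big1 ?addr0 //.
by move=> i _; rewrite /= exprS mul0r mulr0.
Qed.

Lemma gegenbauer_coefS (a m j : nat) :
  gegenbauer_coef rat a m j.+1 = gegenbauer_coef rat a m j *
   ((2 * j%:R + (odd m)%:R) * (2 * j%:R + (odd m)%:R + a%:R) - m%:R * (m%:R + a%:R)) /
   ((2 * j%:R + (odd m)%:R + 2) * (2 * j%:R + (odd m)%:R + 1)).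
Proof.
have e : (j.*2 + odd m)%:R = 2 * j%:R + (odd m)%:R :> rat by rewrite natrD -mul2n natrM.
rewrite /= -e; move: (j.*2 + odd m)%N => k; rewrite !natrM !natrD; congr (_ * _ / (_ * _)).
  by rewrite -addn2 natrD.
by rewrite -addn1 natrD.
Qed.

Arguments gegenbauer_coef : simpl never.

Lemma gegenbauer_eq0_nat (a m k : nat) (x : rat) : m./2 = k -> gegenbauer_eq0 a m x ->
  \sum_(0 <= i < k.+1) gegenbauer_coef rat a m i * x ^+ i = 0.
Proof. by move=> <-; rewrite big_mkord. Qed.

(** The equation in x is multiplied by c and compared with x^k times the goal, which turns it into
    an equation for 1/x; c is the k-th power of the factor of 1/x in the new variable. *)
Ltac depress h m k c :=
  let x0 := fresh "x0" in
  have x0 := gegenbauer_eq0_neq0 h;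
  have {}h := (@gegenbauer_eq0_nat _ m k _ (erefl k) h);
  rewrite !big_nat_recr //= big_geq // add0r !gegenbauer_coefS in h;
  rewrite /gegenbauer_coef /= in h;
  move/(congr1 (fun z => c * z)): h; rewrite mulr0 => h;
  apply: (mulfI (expf_neq0 k x0)); rewrite mulr0 -[RHS]h.

(* With u the inverse of a root, M = 2 m + 1 + 2 a; the variable (c u - ...) / e kills the second
   coefficient, and b = (M^2 - 1) / 8 or (M^2 - 9) / 8 is an integer. *)
Lemma depressed6 (a : nat) (x : rat) : gegenbauer_eq0 a.+1 6 x ->
  let M : rat := 2 * a%:R + 13 in let v := x^-1 - (a%:R + 7) in
  v ^+ 3 - (M ^+ 2 - 1) / 2 * v - 2 / 15 * (M * (M ^+ 2 - 1)) = 0.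
Proof. by move=> h M v; depress h 6%N 3%N (1 : rat); rewrite /v /M; field. Qed.

(** The mean of the values 1/x is a + m + 1 for even m and (a + m + 2) / 3 for odd m, whence the
    factor 3 in the odd cases. *)
Lemma depressed7 (a : nat) (x : rat) : gegenbauer_eq0 a.+1 7 x ->
  let M : rat := 2 * a%:R + 15 in let v := 3 * x^-1 - (a%:R + 9) in
  v ^+ 3 - 3 / 10 * (M ^+ 2 - 9) * v - 2 / 35 * (M * (M ^+ 2 - 9)) = 0.
Proof. by move=> h M v; depress h 7%N 3%N (27 : rat); rewrite /v /M; field. Qed.

Lemma depressed8 (a : nat) (x : rat) : gegenbauer_eq0 a.+1 8 x ->
  let M : rat := 2 * a%:R + 17 in let b := (M ^+ 2 - 1) / 8 in
  let w := (x^-1 - (a%:R + 9)) / 2 in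
  w ^+ 4 - 2 * b * w ^+ 2 - 8 / 15 * (b * M) * w - b * (11 * b + 2) / 35 = 0.
Proof. by move=> h M b w; depress h 8%N 4%N (1 / 16 : rat); rewrite /w /b /M; field. Qed.

Lemma depressed9 (a : nat) (x : rat) : gegenbauer_eq0 a.+1 9 x ->
  let M : rat := 2 * a%:R + 19 in let b := (M ^+ 2 - 9) / 8 in
  let w := (3 * x^-1 - (a%:R + 11)) / 2 in
  w ^+ 4 - 6 / 5 * b * w ^+ 2 - 8 / 35 * (b * M) * w - 3 / 35 * (b * (b + 2)) = 0.
Proof. by move=> h M b w; depress h 9%N 4%N (81 / 16 : rat); rewrite /w /b /M; field. Qed.

Lemma depressed10 (a : nat) (x : rat) : gegenbauer_eq0 a.+1 10 x ->
  let M : rat := 2 * a%:R + 21 in let b := (M ^+ 2 - 1) / 8 in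
  let w := (x^-1 - (a%:R + 11)) / 2 in
  w ^+ 5 - 10 / 3 * b * w ^+ 3 - 4 / 3 * (b * M) * w ^+ 2 - b * (11 * b + 2) / 7 * w
    - 4 / 945 * (b * M * (19 * b + 6)) = 0.
Proof. by move=> h M b w; depress h 10%N 5%N (1 / 32 : rat); rewrite /w /b /M; field. Qed.

(** * Conclusion for each m *)

Lemma affine_inv_inj (c k d : rat) : c != 0 -> d != 0 -> injective (fun x : rat => (c * x^-1 - k) / d).
Proof. by move=> c0 d0 x y /= /(divIf d0) /addIr /(mulfI c0) /invr_inj. Qed.

Lemma take_roots (P : rat -> Prop) (n : nat) (s : seq rat) (f : rat -> rat) : injective f ->
  uniq s -> (n <= size s)%N -> (forall x, x \in s -> P x) ->
  exists t, [/\ uniq t, size t = n & forall y, y \in t -> exists2 x, P x & y = f x].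
Proof.
move=> fI us ns h; exists (map f (take n s)); split.
- by rewrite map_inj_uniq // take_uniq.
- by rewrite size_map size_takel.
- by move=> y /mapP[x /mem_take /h ? ->]; exists x.
Qed.

Lemma no_split6 a : ~ gegenbauer_split a.+1 6.
Proof.
case=> s [us ns h].
have [t [ut st]] := take_roots (@affine_inv_inj 1 (a%:R + 7) 1 isT isT) us ns h.
case: t ut st => [|v1 [|v2 [|v3 [|]]]] // /and3P[]; rewrite !inE negb_or => /andP[h12 h13] h23 _ _ ht.
apply: (@no_cubic6 (2 * a%:Z + 13) v1 v2 v3) => //.
- by exists (a%:Z + 6); ring.
- by clear; lia.
move=> v /ht[x /depressed6 /= e ->]; rewrite -[RHS]e mul1r divr1 -[a%:R]/(a%:~R); ring.
Qed.

Lemma no_split7 a : ~ gegenbauer_split a.+1 7.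
Proof.
case=> s [us ns h].
have [t [ut st]] := take_roots (@affine_inv_inj 3 (a%:R + 9) 1 isT isT) us ns h.
case: t ut st => [|v1 [|v2 [|v3 [|]]]] // /and3P[]; rewrite !inE negb_or => /andP[h12 h13] h23 _ _ ht.
apply: (@no_cubic7 (2 * a%:Z + 15) v1 v2 v3) => //.
- by clear; lia.
move=> v /ht[x /depressed7 /= e ->]; rewrite -[RHS]e divr1; ring.
Qed.

Lemma half_prod (x y : nat) : odd (x + y) -> exists b : int, x%:Z * y%:Z = 2 * b.
Proof.
move=> o; have : ~~ odd (x * y) by rewrite oddM; move: o; rewrite oddD; case: (odd x); case: (odd y).
move=> e; exists (x * y)./2%:Z; move: (odd_double_half (x * y)); rewrite (negPf e); clear; lia.
Qed.

Lemma no_split8 a : ~ gegenbauer_split a.+1 8.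
Proof.
case=> s [us ns h].
have [t [ut st]] := take_roots (@affine_inv_inj 1 (a%:R + 9) 2 isT isT) us ns h.
case: t ut st => [|w1 [|w2 [|w3 [|w4 [|]]]]] // /and4P[]; rewrite !inE !negb_or.
move=> /and3P[h12 h13 h14] /andP[h23 h24] h34 _ _ ht.
(* For M = 2 a + 17, (M^2 - 1) / 8 = (a + 8) (a + 9) / 2. *)
have [b bE] := @half_prod (a + 8) (a + 9) ltac:(lia).
have Mb : (2 * a%:Z + 17) ^+ 2 = 8 * b + 1 by move: bE; clear; lia.
have bE' : b%:~R = ((2 * a%:R + 17) ^+ 2 - 1) / 8 :> rat.
  have := congr1 (fun x : int => x%:~R : rat) Mb; rewrite /= => e.
  transitivity (((8 * b + 1)%:~R - 1) / 8 : rat); first by field.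
  by rewrite -e; field.
apply: (@no_quartic8 (2 * a%:Z + 17) b w1 w2 w3 w4) => //.
- by exists (a%:Z + 8); ring.
- by move: bE; clear; lia.
- by move: bE; clear; lia.
have ME : 2 * a%:R + 17 = (2 * a%:Z + 17)%:~R :> rat by ring.
by move=> w /ht[x /depressed8 /= e ->]; rewrite mul1r; rewrite -bE' ME in e; exact: e.
Qed.

Lemma no_split9 a : ~ gegenbauer_split a.+1 9.
Proof.
case=> s [us ns h].
have [t [ut st]] := take_roots (@affine_inv_inj 3 (a%:R + 11) 2 isT isT) us ns h.
case: t ut st => [|w1 [|w2 [|w3 [|w4 [|]]]]] // /and4P[]; rewrite !inE !negb_or.
move=> /and3P[h12 h13 h14] /andP[h23 h24] h34 _ _ ht.
(* For M = 2 a + 19, (M^2 - 9) / 8 = (a + 8) (a + 11) / 2. *)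
have [b bE] := @half_prod (a + 8) (a + 11) ltac:(lia).
have Mb : (2 * a%:Z + 19) ^+ 2 = 8 * b + 9 by move: bE; clear; lia.
have bE' : b%:~R = ((2 * a%:R + 19) ^+ 2 - 9) / 8 :> rat.
  have := congr1 (fun x : int => x%:~R : rat) Mb; rewrite /= => e.
  transitivity (((8 * b + 9)%:~R - 9) / 8 : rat); first by field.
  by rewrite -e; field.
apply: (@no_quartic9 (2 * a%:Z + 19) b w1 w2 w3 w4) => //.
- by exists (a%:Z + 9); ring.
- by move: bE; clear; lia.
- by move: bE; clear; lia.
have ME : 2 * a%:R + 19 = (2 * a%:Z + 19)%:~R :> rat by ring.
by move=> w /ht[x /depressed9 /= e ->]; rewrite -bE' ME in e; exact: e.
Qed.

Lemma no_split10 a : ~ gegenbauer_split a.+1 10.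
Proof.
case=> s [us ns h].
have [t [ut st]] := take_roots (@affine_inv_inj 1 (a%:R + 11) 2 isT isT) us ns h.
case: t ut st => [|w1 [|w2 [|w3 [|w4 [|w5 [|]]]]]] // ut _ ht.
have [b bE] := @half_prod (a + 10) (a + 11) ltac:(lia).
have Mb : (2 * a%:Z + 21) ^+ 2 = 8 * b + 1 by move: bE; clear; lia.
have bE' : b%:~R = ((2 * a%:R + 21) ^+ 2 - 1) / 8 :> rat.
  have := congr1 (fun x : int => x%:~R : rat) Mb; rewrite /= => e.
  transitivity (((8 * b + 1)%:~R - 1) / 8 : rat); first by field.
  by rewrite -e; field.
apply: (@no_quintic10 (2 * a%:Z + 21) b w1 w2 w3 w4 w5 Mb _ _ ut).
- by move: bE; clear; lia.
- by move: bE; clear; lia.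
have ME : 2 * a%:R + 21 = (2 * a%:Z + 21)%:~R :> rat by ring.
by move=> w /ht[x /depressed10 /= e ->]; rewrite mul1r; rewrite -bE' ME in e; exact: e.
Qed.

Theorem theorem6p1 (R : realType) (d m : nat) (hd : (2 < d)%N)
    (hm : m \in [:: 6; 7; 8; 9; 10]%N) :
  ~ exists X : {fset 'rV[R]_d}, stiff_configuration m X.
Proof.
case=> X; case: d hd X => [|[|[|a]]] // _ X; move: hm; rewrite !inE.
by case/or4P=> [||| /orP[]] /eqP -> /stiff_gegenbauer_split => /(_ isT);
  [exact: no_split6|exact: no_split7|exact: no_split8|exact: no_split9|exact: no_split10].
Qed.
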